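(* Let $(D,e,\vdash,\dashv)$ be a bar-unital Lie dimonoid. 1. The underlying vector space of the associated coalgebra $F(D)=\mathcal{E}'_e(D)$, equipped with $\mathbf{1}$ and the multiplications $\mu_\vdash=(\vdash)_*\circ F_{2~D,D}$ and $\mu_\dashv=(\dashv)_*\circ F_{2~D,D}$, is an (associative) bar-unital dialgebra. In case $D$ is balanced, $F(D)$ is a cocommutative Hopf dialgebra. 2. In case $(D,e,\vdash,\dashv)$ is a Lie digroup (in the sense of Kinyon), $F(D)$ is a cocommutative Hopf dialgebra.
   Context: $\mathbb{K}$ denotes $\mathbb{R}$ or $\mathbb{C}$; manifolds are Hausdorff and second countable. A bar-unital Lie dimonoid $(D,e,\vdash,\dashv)$ is a pointed smooth manifold $(D,e)$ with two smooth associative multiplications $\vdash,\dashv:D\times D\to D$ such that for all $x,y,z$: $(x\vdash y)\vdash z=(x\dashv y)\vdash z$, $x\dashv(y\dashv z)=x\dashv(y\vdash z)$, $(x\vdash y)\dashv z=x\vdash(y\dashv z)$, $e\vdash x=x$, $x\dashv e=x$. It is balanced if $x\vdash e=e\dashv x$ for all $x$. A general Lie digroup is a bar-unital Lie dimonoid such that every $x$ has a right inverse for $\vdash$ (some $y$ with $x\vdash y=e$) and a left inverse for $\dashv$ (some $y$ with $y\dashv x=e$); these are then unique and depend smoothly on $x$. A Lie digroup in the sense of Kinyon is a general Lie digroup such that for each $x$ the right inverse with respect to $\vdash$ equals the left inverse with respect to $\dashv$ (equivalently, it is balanced). For a pointed manifold $(M,e)$, $F(M)=\mathcal{E}'_e(M)$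 is the $\mathbb{K}$-vector space of continuous linear maps $T:\mathcal{C}^\infty(M,\mathbb{K})\to\mathbb{K}$ (distributions) supported in $\{e\}$; for a smooth pointed map $\varphi$, $(\varphi_*T)(f)=T(f\circ\varphi)$. There are natural linear isomorphisms $F_{2~M,N}:\mathcal{E}'_{e_1}(M)\otimes\mathcal{E}'_{e_2}(N)\to\mathcal{E}'_{(e_1,e_2)}(M\times N)$, $F_{2~M,N}(S\otimes T)(f)=S\big(x\mapsto T(f(x,\cdot))\big)$. $\mathcal{E}'_e(M)$ is a coassociative cocommutative counital coalgebra with $\Delta_e=F_{2~M,M}^{-1}\circ(\mathrm{diag}_M)_*$, $\epsilon(T)=T(1)$, and the element $\mathbf{1}=\delta_e$ (so $\Delta\mathbf{1}=\mathbf{1}\otimes\mathbf{1}$, $\epsilon(\mathbf{1})=1$). A $C^3$-coalgebra is a coassociative counital coalgebra with an element $\mathbf{1}$ with $\Delta(\mathbf{1})=\mathbf{1}\otimes\mathbf{1}$, $\epsilon(\mathbf{1})=1$; morphisms preserve $\Delta,\epsilon,\mathbf{1}$. A bar-unital dialgebra is a vector space $A$ with an element $\mathbf{1}$ and two associative bilinear multiplications $\vdash,\dashv$ satisfying the same identities as a bar-unital dimonoid (with $\mathbf{1}$ in place of $e$); it is balanced if $a\vdash\mathbf{1}=\mathbf{1}\dashv a$ for all $a$. A cocommutative Hopf dialgebra is a cocommutative $C^3$-coalgebra $A$ with a bar-unital balanced dialgebra structure (bar-unit $\mathbf{1}$) such that $\vdash,\dashv:A\otimes A\to A$ are morphisms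 of $C^3$-coalgebras, for which there is a morphism of $C^3$-coalgebras $S:A\to A$ with $\sum_{(a)}a^{(1)}\vdash S(a^{(2)})=\epsilon(a)\mathbf{1}=\sum_{(a)}S(a^{(1)})\dashv a^{(2)}$ for all $a$. *)

(* Defs.v *)
From HB Require Import structures.
From mathcomp Require Import all_boot all_order all_algebra.
From mathcomp Require Import generic_quotient.
From mathcomp Require Import all_classical all_reals all_analysis.
From mathcomp.real_closed Require Import complex.

Set Implicit Arguments.
Unset Strict Implicit.
Unset Printing Implicit Defensive.
Import Order.TTheory GRing.Theory Num.Theory.
Import numFieldNormedType.Exports.
Local Open Scope classical_set_scope.
Local Open Scope ring_scope.

Definition bilinear_map (K : fieldType) (A B V : lmodType K)
    (beta : A -> B -> V) : Prop :=
  (forall b, linear (beta^~ b)) /\ (forall a, linear (beta a)).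

Section Tensor.
Variables (K : fieldType) (A B : lmodType K).

Definition tsum (V : lmodType K) (beta : A -> B -> V) (s : seq (A * B)) : V :=
  \sum_(p <- s) beta p.1 p.2.

(* A formal sum [:: (a1, b1); ...; (am, bm)] stands for
   a1 (x) b1 + ... + am (x) bm; two of them are the same tensor iff no bilinear
   map distinguishes them. *)
Definition tens_eq : rel (seq (A * B)) := fun s t =>
  `[< forall (V : lmodType K) (beta : A -> B -> V),
        bilinear_map beta -> tsum beta s = tsum beta t >].

Lemma tens_eqP s t :
  reflect (forall (V : lmodType K) (beta : A -> B -> V),
             bilinear_map beta -> tsum beta s = tsum beta t) (tens_eq s t).
Proof. exact: asboolP. Qed.

Lemma tens_eq_equiv : equiv_class_of tens_eq.
Proof.
split.
- by move=> s; apply/tens_eqP.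
- by move=> s t; apply/tens_eqP/tens_eqP => h V b hb; rewrite h.
- move=> t s u /tens_eqP h1 /tens_eqP h2; apply/tens_eqP => V b hb.
  by rewrite h1 // h2.
Qed.

Canonical tens_equiv := EquivRelPack tens_eq_equiv.

Definition tens : Type := {eq_quot tens_equiv}%qT.
HB.instance Definition _ := Choice.on tens.
HB.instance Definition _ := EqQuotient.on tens.

Definition tpi (s : seq (A * B)) : tens := (\pi_tens s)%qT.

Lemma tpi_eq s t :
  (forall (V : lmodType K) (beta : A -> B -> V),
      bilinear_map beta -> tsum beta s = tsum beta t) -> tpi s = tpi t.
Proof. by move=> h; apply/eqmodP/tens_eqP. Qed.

Lemma tpiE (V : lmodType K) (beta : A -> B -> V) s :
  bilinear_map beta -> tsum beta (repr (tpi s)) = tsum beta s.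
Proof.
move=> hb; have /eqmodP/tens_eqP : (\pi_tens (repr (tpi s)) = \pi_tens s)%qT.
  by rewrite reprK.
exact.
Qed.

Lemma tpiK (u : tens) : tpi (repr u) = u. Proof. exact: reprK. Qed.

Lemma tsum_cat (V : lmodType K) (beta : A -> B -> V) s t :
  tsum beta (s ++ t) = tsum beta s + tsum beta t.
Proof. by rewrite /tsum big_cat. Qed.

Definition tscale_seq (k : K) (s : seq (A * B)) := [seq (k *: p.1, p.2) | p <- s].

Lemma bilinear_mapZl (V : lmodType K) (beta : A -> B -> V) k a b :
  bilinear_map beta -> beta (k *: a) b = k *: beta a b.
Proof.
move=> [h _]; have h0 : beta 0 b = 0.
  have := h b (-1) 0 0; rewrite /= scaler0 addr0 scaleN1r.
  by rewrite addNr.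
by have := h b k a 0; rewrite /= addr0 h0 addr0.
Qed.

Lemma tsum_scale (V : lmodType K) (beta : A -> B -> V) k s :
  bilinear_map beta -> tsum beta (tscale_seq k s) = k *: tsum beta s.
Proof.
move=> hb; rewrite /tsum big_map scaler_sumr.
by apply: eq_bigr => p _ /=; rewrite bilinear_mapZl.
Qed.

Definition tzero := tpi [::].
Definition tadd (u v : tens) := tpi (repr u ++ repr v).
Definition tscale (k : K) (u : tens) := tpi (tscale_seq k (repr u)).
Definition topp (u : tens) := tscale (-1) u.

Lemma taddA : associative tadd.
Proof.
by move=> u v w; apply: tpi_eq => V b hb; rewrite !tsum_cat !tpiE // !tsum_cat addrA.
Qed.
Lemma taddC : commutative tadd.
Proof. by move=> u v; apply: tpi_eq => V b hb; rewrite !tsum_cat addrC. Qed.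
Lemma tadd0 : left_id tzero tadd.
Proof.
move=> u; rewrite -[RHS]tpiK; apply: tpi_eq => V b hb.
by rewrite tsum_cat tpiE // /tsum big_nil add0r.
Qed.
Lemma taddN : left_inverse tzero topp tadd.
Proof.
move=> u; apply: tpi_eq => V b hb.
by rewrite tsum_cat tpiE // tsum_scale // scaleN1r addNr /tsum big_nil.
Qed.

HB.instance Definition _ := GRing.isZmodule.Build tens taddA taddC tadd0 taddN.

Lemma tscaleA k l u : tscale k (tscale l u) = tscale (k * l) u.
Proof. by apply: tpi_eq => V b hb; rewrite !tsum_scale // tpiE // tsum_scale // scalerA. Qed.
Lemma tscale1 : left_id 1 tscale.
Proof.
move=> u; rewrite -[RHS]tpiK; apply: tpi_eq => V b hb.
by rewrite tsum_scale // scale1r.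
Qed.
Lemma tscaleDr : right_distributive tscale +%R.
Proof.
move=> k u v; apply: tpi_eq => V b hb.
by rewrite tsum_cat !tsum_scale // !tpiE // tsum_cat !tsum_scale // scalerDr.
Qed.
Lemma tscaleDl u : {morph tscale^~ u : k l / k + l}.
Proof.
move=> k l; apply: tpi_eq => V b hb.
by rewrite tsum_cat !tpiE // !tsum_scale // scalerDl.
Qed.

HB.instance Definition _ :=
  GRing.Zmodule_isLmodule.Build K tens tscaleA tscale1 tscaleDr tscaleDl.

Definition tmul (a : A) (b : B) : tens := tpi [:: (a, b)].

(* The linear map with tlift beta (tmul a b) = beta a b, for beta bilinear. *)
Definition tlift (V : lmodType K) (beta : A -> B -> V) (u : tens) : V :=
  tsum beta (repr u).

Lemma tmul_bilinear : bilinear_map tmul.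
Proof.
split=> [b k a a'|a k b b']; apply: tpi_eq => V beta hb;
  rewrite tsum_cat !tpiE // tsum_scale // !tpiE // /tsum !big_seq1 /=.
- by rewrite hb.1.
- by rewrite hb.2.
Qed.

Lemma tlift_linear (V : lmodType K) (beta : A -> B -> V) :
  bilinear_map beta -> linear (tlift beta).
Proof.
move=> hb k u v; rewrite /tlift tpiE // tsum_cat; congr (_ + _).
by rewrite tpiE // tsum_scale.
Qed.

Lemma tlift_tmul (V : lmodType K) (beta : A -> B -> V) a b :
  bilinear_map beta -> tlift beta (tmul a b) = beta a b.
Proof. by move=> hb; rewrite /tlift tpiE // /tsum big_seq1. Qed.

Lemma tens_span (u : tens) : exists s, u = \sum_(p <- s) tmul p.1 p.2.
Proof.
exists (repr u); rewrite -[LHS]tpiK; elim: (repr u) => [|p s IH].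
  by rewrite big_nil.
rewrite big_cons -IH; apply: tpi_eq => V b hb.
by rewrite tsum_cat !tpiE // -tsum_cat; case: p.
Qed.

End Tensor.

Section TensorMaps.
Variable K : fieldType.

Definition tmap (A A' B B' : lmodType K) (f : A -> A') (g : B -> B') :
    tens A B -> tens A' B' :=
  tlift (fun a b => tmul (f a) (g b)).

Definition tswap (A B : lmodType K) : tens A B -> tens B A :=
  tlift (fun a b => tmul b a).

Definition tassoc (A B C : lmodType K) :
    tens (tens A B) C -> tens A (tens B C) :=
  tlift (fun u c => tlift (fun a b => tmul a (tmul b c)) u).

(* (a (x) b) (x) (c (x) d) |-> (a (x) c) (x) (b (x) d) *)
Definition tinterchange (A B C D : lmodType K) :
    tens (tens A B) (tens C D) -> tens (tens A C) (tens B D) :=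
  tlift (fun u v =>
    tlift (fun a b => tlift (fun c d => tmul (tmul a c) (tmul b d)) v) u).

End TensorMaps.

Record coalg_data (K : fieldType) (A : lmodType K) := CoalgData {
  comul : A -> tens A A;
  counit : A -> K;
  grouplike1 : A }.

Section Coalgebra.
Variable K : fieldType.

Definition is_C3_coalgebra (A : lmodType K) (X : coalg_data A) : Prop :=
  [/\ linear (comul X) /\ scalar (counit X),
      forall a, tassoc (tmap (comul X) id (comul X a)) =
                tmap id (comul X) (comul X a),
      forall a, tlift (fun b c => counit X b *: c) (comul X a) = a /\
                tlift (fun b c => counit X c *: b) (comul X a) = a,
      comul X (grouplike1 X) = tmul (grouplike1 X) (grouplike1 X)
    & counit X (grouplike1 X) = 1].

Definition cocommutative (A : lmodType K) (X : coalg_data A) : Prop :=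
  forall a, tswap (comul X a) = comul X a.

Definition C3_morphism (A B : lmodType K) (X : coalg_data A) (Y : coalg_data B)
    (f : A -> B) : Prop :=
  [/\ linear f,
      forall a, comul Y (f a) = tmap f f (comul X a),
      forall a, counit Y (f a) = counit X a
    & f (grouplike1 X) = grouplike1 Y].

Definition coalg_tensor (A B : lmodType K) (X : coalg_data A)
    (Y : coalg_data B) : coalg_data (tens A B) :=
  CoalgData
    (fun u => tinterchange (tmap (comul X) (comul Y) u))
    (tlift (fun a b => counit X a * counit Y b : K^o))
    (tmul (grouplike1 X) (grouplike1 Y)).

End Coalgebra.

Definition barunital_dimonoid (T : Type) (e : T) (vd dv : T -> T -> T) : Prop :=
  [/\ associative vd /\ associative dv,
      forall x y z, vd (vd x y) z = vd (dv x y) z,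
      forall x y z, dv x (dv y z) = dv x (vd y z),
      forall x y z, dv (vd x y) z = vd x (dv y z)
    & (forall x, vd e x = x) /\ (forall x, dv x e = x)].

Definition balanced (T : Type) (e : T) (vd dv : T -> T -> T) : Prop :=
  forall x, vd x e = dv e x.

Section Dialgebra.
Variables (K : fieldType) (A : lmodType K).

Definition barunital_dialgebra (one : A) (vd dv : tens A A -> A) : Prop :=
  [/\ linear vd, linear dv
    & barunital_dimonoid one (fun a b => vd (tmul a b))
                             (fun a b => dv (tmul a b))].

Definition cocommutative_Hopf_dialgebra (X : coalg_data A)
    (vd dv : tens A A -> A) : Prop :=
  [/\ is_C3_coalgebra X /\ cocommutative X,
      barunital_dialgebra (grouplike1 X) vd dv,
      balanced (grouplike1 X) (fun a b => vd (tmul a b))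
                              (fun a b => dv (tmul a b)),
      C3_morphism (coalg_tensor X X) X vd /\ C3_morphism (coalg_tensor X X) X dv
    & exists2 S : A -> A, C3_morphism X X S &
        forall a, vd (tmap id S (comul X a)) = counit X a *: grouplike1 X /\
                  dv (tmap S id (comul X a)) = counit X a *: grouplike1 X].

End Dialgebra.

Section SmoothEuclidean.
Variable R : realType.

Definition ipartial n (s : seq 'I_n) (f : 'rV[R]_n -> R^o) : 'rV[R]_n -> R^o :=
  foldr (fun i g => 'D_(delta_mx 0 i) g) f s.

Definition smooth_on n (U : set 'rV[R]_n) (f : 'rV[R]_n -> R^o) : Prop :=
  forall (s : seq 'I_n) x, U x ->
    (forall i, derivable (ipartial s f) x (delta_mx 0 i)) /\
    {for x, continuous (ipartial s f)}.

Lemma smooth_on_lin n (U : set 'rV[R]_n) (f g : 'rV[R]_n -> R^o) (a : R) :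
  open U -> smooth_on U f -> smooth_on U g ->
  smooth_on U (fun x => a * f x + g x) /\
  forall s x, U x -> ipartial s (fun y => a * f y + g y) x =
                     a * ipartial s f x + ipartial s g x.
Proof.
move=> oU sf sg.
have E s x : U x -> ipartial s (fun y => a * f y + g y) x =
                    a * ipartial s f x + ipartial s g x.
  elim: s x => [|i s IH] x Ux //=.
  have [dfx _] := sf s x Ux; have [dgx _] := sg s x Ux.
  have E1 : \near x, ipartial s (fun y => a * f y + g y) x =
                     (a *: ipartial s f + ipartial s g) x.
    near=> y; apply: IH; near: y; exact: open_nbhs_nbhs.
  rewrite (near_eq_derive _ E1) deriveD ?deriveZ //.
  exact: derivableZ.
split=> // s x Ux; have [dfx cfx] := sf s x Ux; have [dgx cgx] := sg s x Ux.
have E1 : \near x, (a *: ipartial s f + ipartial s g) x =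
                   ipartial s (fun y => a * f y + g y) x.
  near=> y; apply/esym/E; near: y; exact: open_nbhs_nbhs.
split=> [i|].
  apply: (near_eq_derivable E1); apply: derivableD => //; exact: derivableZ.
rewrite /prop_for /continuous_at E //.
apply: cvg_trans (near_eq_cvg E1) _.
apply: cvgD => //; exact: cvgZr.
Unshelve. all: by end_near. Qed.

Lemma smooth_on_comp_lin n m (l : {linear 'rV[R]_m -> 'rV[R]_n})
    (U : set 'rV[R]_n) (V : set 'rV[R]_m) (f : 'rV[R]_n -> R^o) :
  continuous l ->
  (forall i, l (delta_mx 0 i) = 0 \/ exists j, l (delta_mx 0 i) = delta_mx 0 j) ->
  smooth_on U f -> (forall x, V x -> U (l x)) -> smooth_on V (f \o l).
Proof.
move=> cl hl sf VU.
have q (g : 'rV[R]_n -> R^o) x v : (fun h : R => h^-1 *: (((g \o l) \o shift x) (h *: v) - (g \o l) x))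
    = (fun h : R => h^-1 *: ((g \o shift (l x)) (h *: l v) - g (l x))).
  by apply/funext => h; rewrite /= [l (h *: v + x)]linearP.
have E s : ipartial s (f \o l) = cst 0 \/
    exists t, ipartial s (f \o l) = ipartial t f \o l.
  elim: s => [|i s IH]; first by right; exists [::].
  have -> : ipartial (i :: s) (f \o l) = 'D_(delta_mx 0 i) (ipartial s (f \o l)).
    by [].
  case: IH => [->|[t ->]].
    by left; apply/funext => x; rewrite /= derive_cst.
  case: (hl i) => [l0|[j lj]]; [left|right; exists (j :: t)];
    apply/funext => x /=; rewrite /derive q ?l0 ?lj //.
  exact: derive0.
move=> s x Vx; case: (E s) => [->|[t ->]].
  by split=> [i|]; [exact: derivable_cst|exact: cst_continuous].
have [dt ct] := sf t _ (VU x Vx); split=> [i|].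
  rewrite /derivable q; case: (hl i) => [->|[j ->]]; last exact: dt.
  exact: derivable0.
apply: continuous_comp; [exact: cl|exact: ct].
Qed.

End SmoothEuclidean.

Lemma rV_cvg (R : realType) (T : Type) (F : set_system T) n (f : T -> 'rV[R]_n)
    (l : 'rV[R]_n) :
  Filter F -> (forall j, (fun x => f x 0 j) @ F --> l 0 j) -> f @ F --> l.
Proof.
move=> FF h A [P lP PA].
have : F (fun x => forall j, P 0 j (f x 0 j)).
  apply: filter_forall => j; exact: (h j (P 0 j) (lP 0 j)).
apply: (@filterS _ F) => x Px; apply: PA => i j; rewrite (ord1 i); exact: Px.
Qed.

Lemma lsubmx_rV_continuous (R : realType) m n :
  continuous (fun x : 'rV[R]_(m + n) => lsubmx x).
Proof.
move=> x; apply: (@rV_cvg _ _ (nbhs x)) => j; under eq_fun do rewrite mxE.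
rewrite mxE; exact: coord_continuous.
Qed.

Lemma rsubmx_rV_continuous (R : realType) m n :
  continuous (fun x : 'rV[R]_(m + n) => rsubmx x).
Proof.
move=> x; apply: (@rV_cvg _ _ (nbhs x)) => j; under eq_fun do rewrite mxE.
rewrite mxE; exact: coord_continuous.
Qed.

Lemma open_setX (T U : topologicalType) (A : set T) (B : set U) :
  open A -> open B -> open (A `*` B).
Proof.
rewrite !openE => oA oB [x y] [/= /oA nA /oB nB].
by exists (A, B).
Qed.

Lemma hausdorff_setX (T U : topologicalType) :
  hausdorff_space T -> hausdorff_space U -> hausdorff_space (T * U)%type.
Proof.
move=> hT hU [x1 x2] [y1 y2] h; congr (_, _).
- apply: hT => A B nA nB.
  have [[a b] [/= [Aa _] [Ba _]]] := h (A `*` setT) (B `*` setT)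
    (ex_intro2 _ _ (A, setT) (conj nA filterT) (@subset_refl _ _))
    (ex_intro2 _ _ (B, setT) (conj nB filterT) (@subset_refl _ _)).
  by exists a.
- apply: hU => A B nA nB.
  have [[a b] [/= [_ Aa] [_ Ba]]] := h (setT `*` A) (setT `*` B)
    (ex_intro2 _ _ (setT, A) (conj filterT nA) (@subset_refl _ _))
    (ex_intro2 _ _ (setT, B) (conj filterT nB) (@subset_refl _ _)).
  by exists b.
Qed.

Lemma second_countable_setX (T U : topologicalType) :
  @second_countable T -> @second_countable U -> @second_countable (T * U)%type.
Proof.
move=> [A cA [oA bA]] [B cB [oB bB]].
exists [set p.1 `*` p.2 | p in A `*` B].
  apply: (sub_countable (card_image_le _ _)); exact: countableX.
split=> [_ [[a b] [/= Aa Bb] <-]|[x y] P [[P1 P2] [/= n1 n2] sP]].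
  by apply: open_setX; [exact: oA|exact: oB].
have [a [Aa ax] aP] := bA x P1 n1; have [b [Bb by_] bP] := bB y P2 n2.
exists (a `*` b); first by split; [exists (a, b)|].
by move=> [u v] [/= /aP ? /bP ?]; apply: sP.
Qed.

Section Manifolds.
Variable R : realType.

Record chart (M : topologicalType) (n : nat) := Chart {
  chart_dom : set M;
  chart_map : M -> 'rV[R]_n;
  chart_inv : 'rV[R]_n -> M }.

Definition chart_cod (M : topologicalType) n (c : chart M n) : set 'rV[R]_n :=
  chart_map c @` chart_dom c.

(* chart_map c is a homeomorphism from the open set chart_dom c onto an open
   subset of R^n, with inverse chart_inv c. *)
Definition is_chart (M : topologicalType) n (c : chart M n) : Prop :=
  [/\ open (chart_dom c), open (chart_cod c),
      forall x, chart_dom c x -> chart_inv c (chart_map c x) = x,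
      forall x, chart_dom c x -> {for x, continuous (chart_map c)}
    & forall y, chart_cod c y -> {for y, continuous (chart_inv c)}].

Definition chart_compatible (M : topologicalType) n (c d : chart M n) : Prop :=
  forall j, smooth_on (chart_map c @` (chart_dom c `&` chart_dom d))
                      (fun y => chart_map d (chart_inv c y) 0 j).

Record manifold (n : nat) := Manifold {
  manifold_sort :> topologicalType;
  atlas : set (chart manifold_sort n);
  manifold_hausdorff : hausdorff_space manifold_sort;
  manifold_second_countable : @second_countable manifold_sort;
  atlas_is_chart : forall c, atlas c -> is_chart c;
  atlas_cover : forall x, exists2 c, atlas c & chart_dom c x;
  atlas_compatible : forall c d, atlas c -> atlas d -> chart_compatible c d }.

Definition smooth_map m n (M : manifold m) (N : manifold n) (phi : M -> N) :
    Prop :=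
  continuous phi /\
  forall c d, atlas c -> atlas d -> forall j,
    smooth_on (chart_map c @` (chart_dom c `&` phi @^-1` chart_dom d))
              (fun y => chart_map d (phi (chart_inv c y)) 0 j).

Section Product.
Variables (m n : nat) (M : manifold m) (N : manifold n).

Definition prod_chart (c : chart M m) (d : chart N n) :
    chart (M * N)%type (m + n) :=
  Chart (chart_dom c `*` chart_dom d)
        (fun p => row_mx (chart_map c p.1) (chart_map d p.2))
        (fun y => (chart_inv c (lsubmx y), chart_inv d (rsubmx y))).

Definition prod_atlas : set (chart (M * N)%type (m + n)) :=
  [set b | exists c d, [/\ atlas c, atlas d & b = prod_chart c d]].

Lemma prod_chart_cod c d : chart_cod (prod_chart c d) =
  [set y | chart_cod c (lsubmx y) /\ chart_cod d (rsubmx y)].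
Proof.
apply/seteqP; split=> [_ [[x y] [/= cx dy] <-]|z [[x cx xz] [y dy yz]]] /=.
  by rewrite row_mxKl row_mxKr; split; [exists x|exists y].
by exists (x, y) => //=; rewrite xz yz hsubmxK.
Qed.

Lemma prod_atlas_is_chart b : prod_atlas b -> is_chart b.
Proof.
move=> [c [d [Ac Ad ->]]].
have [oc oc' cK cc ci] := atlas_is_chart Ac.
have [od od' dK dc di] := atlas_is_chart Ad.
split.
- exact: open_setX.
- rewrite prod_chart_cod; apply: openI.
    by apply: (open_comp _ oc') => x _; exact: lsubmx_rV_continuous.
  by apply: (open_comp _ od') => x _; exact: rsubmx_rV_continuous.
- by move=> [x y] [/= cx dy]; rewrite row_mxKl row_mxKr cK // dK.
- move=> [x y] [/= cx dy]; apply: (@rV_cvg _ _ (nbhs (x, y))) => j.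
  rewrite mxE; under eq_fun do rewrite mxE.
  case: (fintype.split j) => k.
    apply: (@cvg_comp _ _ _ (fun p : M * N => chart_map c p.1)
      (fun v : 'rV[R]_m => v 0 k) _ (nbhs (chart_map c x))).
      apply: (@cvg_comp _ _ _ fst (chart_map c) _ (nbhs x)); [exact: cvg_fst|exact: cc].
    exact: coord_continuous.
  apply: (@cvg_comp _ _ _ (fun p : M * N => chart_map d p.2)
    (fun v : 'rV[R]_n => v 0 k) _ (nbhs (chart_map d y))).
    apply: (@cvg_comp _ _ _ snd (chart_map d) _ (nbhs y)); [exact: cvg_snd|exact: dc].
  exact: coord_continuous.
- move=> z; rewrite prod_chart_cod => -[/= cz dz]; apply: (@cvg_pair _ _ _ (nbhs z)) => /=.
    apply: (@cvg_comp _ _ _ (@lsubmx R 1 m n) (chart_inv c) (nbhs z) (nbhs (lsubmx z))).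
      exact: lsubmx_rV_continuous.
    exact: ci.
  apply: (@cvg_comp _ _ _ (@rsubmx R 1 m n) (chart_inv d) (nbhs z) (nbhs (rsubmx z))).
      exact: rsubmx_rV_continuous.
    exact: di.
Qed.

Lemma prod_atlas_cover x : exists2 c, prod_atlas c & chart_dom c x.
Proof.
have [c Ac cx] := atlas_cover x.1; have [d Ad dx] := atlas_cover x.2.
by exists (prod_chart c d) => //; exists c, d.
Qed.

Lemma lsubmx_delta (i : 'I_(m + n)) :
  lsubmx (delta_mx 0 i : 'rV[R]_(m + n)) = 0 \/
  exists j, lsubmx (delta_mx 0 i : 'rV[R]_(m + n)) = delta_mx 0 j.
Proof.
case: (splitP i) => k ik; [right; exists k|left]; apply/rowP => j;
  rewrite !mxE /= -val_eqE /= ik //.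
by rewrite ltn_eqF // ltn_addr.
Qed.

Lemma rsubmx_delta (i : 'I_(m + n)) :
  rsubmx (delta_mx 0 i : 'rV[R]_(m + n)) = 0 \/
  exists j, rsubmx (delta_mx 0 i : 'rV[R]_(m + n)) = delta_mx 0 j.
Proof.
case: (splitP i) => k ik; [left|right; exists k]; apply/rowP => j;
  rewrite !mxE /= -val_eqE /= ik ?eqn_add2l //.
by rewrite gtn_eqF // ltn_addr.
Qed.

Lemma prod_atlas_compatible b b' :
  prod_atlas b -> prod_atlas b' -> chart_compatible b b'.
Proof.
move=> [c [d [Ac Ad ->]]] [c' [d' [Ac' Ad' ->]]] j.
have sc := atlas_compatible Ac Ac'; have sd := atlas_compatible Ad Ad'.
case: (split_ordP j) => k ->.
- rewrite (_ : (fun _ => _) = (fun y => chart_map c' (chart_inv c y) 0 k)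
     \o (@lsubmx R 1 m n)); last by apply/funext => y /=; rewrite row_mxEl.
  apply: (@smooth_on_comp_lin _ _ _ (@lsubmx R 1 m n) _ _ _ _ _ (sc k)).
  + exact: lsubmx_rV_continuous.
  + exact: lsubmx_delta.
  + move=> _ [[x y] [[/= cx dy] [/= cx' dy']] <-].
    by rewrite row_mxKl; exists x.
- rewrite (_ : (fun _ => _) = (fun y => chart_map d' (chart_inv d y) 0 k)
     \o (@rsubmx R 1 m n)); last by apply/funext => y /=; rewrite row_mxEr.
  apply: (@smooth_on_comp_lin _ _ _ (@rsubmx R 1 m n) _ _ _ _ _ (sd k)).
  + exact: rsubmx_rV_continuous.
  + exact: rsubmx_delta.
  + move=> _ [[x y] [[/= cx dy] [/= cx' dy']] <-].
    by rewrite row_mxKr; exists y.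
Qed.

Definition prod_manifold : manifold (m + n) :=
  Manifold (hausdorff_setX (@manifold_hausdorff _ M) (@manifold_hausdorff _ N))
    (second_countable_setX (@manifold_second_countable _ M)
                           (@manifold_second_countable _ N))
    prod_atlas_is_chart prod_atlas_cover prod_atlas_compatible.

End Product.

End Manifolds.

Variant scalar_kind := RealScalars | ComplexScalars.

Section Distributions.
Variables (R : realType) (k : scalar_kind).

Definition scalars : numFieldType :=
  match k with
  | RealScalars => R : numFieldType
  | ComplexScalars => complex.complex R : numFieldType
  end.

Local Notation K := scalars.

Definition reK : K -> R^o :=
  match k return Num.NumField.sort (match k with
    RealScalars => R : numFieldType
  | ComplexScalars => complex.complex R : numFieldType end) -> R^o with
  | RealScalars => fun x => x
  | ComplexScalars => @complex.Re R
  end.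

Definition imK : K -> R^o :=
  match k return Num.NumField.sort (match k with
    RealScalars => R : numFieldType
  | ComplexScalars => complex.complex R : numFieldType end) -> R^o with
  | RealScalars => fun=> 0
  | ComplexScalars => @complex.Im R
  end.

Lemma reK_lin a u v : reK (a * u + v) = reK a * reK u + (- imK a * imK u + reK v).
Proof.
rewrite /reK /imK /scalars in a u v *.
case: k a u v => [a u v|[a b] [c d] [e f]] /=; first by rewrite oppr0 mul0r add0r.
by rewrite addrA mulNr.
Qed.

Lemma imK_lin a u v : imK (a * u + v) = reK a * imK u + (imK a * reK u + imK v).
Proof.
rewrite /reK /imK /scalars in a u v *.
case: k a u v => [a u v|[a b] [c d] [e f]] /=; first by rewrite mulr0 mul0r !addr0.
by rewrite addrA.
Qed.

Section SmoothFunctions.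
Variables (n : nat) (M : manifold R n).

Definition smooth_fun (f : M -> K^o) : Prop :=
  forall c, atlas c ->
    smooth_on (chart_cod c) (fun y => reK (f (chart_inv c y))) /\
    smooth_on (chart_cod c) (fun y => imK (f (chart_inv c y))).

Definition smooth_pred : {pred M -> K^o} := [pred f | `[< smooth_fun f >]].

Lemma smooth_submod_closed : submod_closed smooth_pred.
Proof.
have lin (f g : M -> K^o) (a : K) : smooth_fun f -> smooth_fun g ->
    smooth_fun (a *: f + g).
  move=> sf sg c Ac; have oc : open (chart_cod c) by case: (atlas_is_chart Ac).
  have [rf if_] := sf c Ac; have [rg ig] := sg c Ac; split.
  - rewrite (_ : (fun _ => _) = (fun y => reK a * reK (f (chart_inv c y)) +
      (- imK a * imK (f (chart_inv c y)) + reK (g (chart_inv c y))))).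
      apply: (smooth_on_lin _ _ _ _).1 => //.
      exact: (smooth_on_lin _ _ _ _).1.
    by apply/funext => y; rewrite -reK_lin.
  - rewrite (_ : (fun _ => _) = (fun y => reK a * imK (f (chart_inv c y)) +
      (imK a * reK (f (chart_inv c y)) + imK (g (chart_inv c y))))).
      apply: (smooth_on_lin _ _ _ _).1 => //.
      exact: (smooth_on_lin _ _ _ _).1.
    by apply/funext => y; rewrite -imK_lin.
split=> [|a f g].
  apply/asboolP => c Ac.
  have r0 : reK 0 = 0 by rewrite /reK /scalars; case: k.
  have i0 : imK 0 = 0 by rewrite /imK /scalars; case: k.
  have E s : ipartial s (cst (0 : R) : 'rV[R]_n -> R^o) = cst 0.
    elim: s => [//|i s IH]; rewrite /ipartial /= -/(ipartial s _) IH.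
    by apply/funext => x; rewrite derive_cst.
  have s0 : smooth_on (chart_cod c) (cst (0 : R) : 'rV[R]_n -> R^o).
    move=> s x _; rewrite E; split=> [i|]; first exact: derivable_cst.
    exact: cst_continuous.
  by split; [rewrite (_ : (fun _ => _) = cst 0) //; apply/funext => y; exact: r0
            |rewrite (_ : (fun _ => _) = cst 0) //; apply/funext => y; exact: i0].
by move=> /asboolP sf /asboolP sg; apply/asboolP; exact: lin.
Qed.

HB.instance Definition _ :=
  GRing.isSubmodClosed.Build K (M -> K^o) smooth_pred smooth_submod_closed.

Definition Cinf : Type := {f : M -> K^o | smooth_pred f}.
HB.instance Definition _ := SubChoice.on Cinf.
HB.instance Definition _ := [SubChoice_isSubLmodule of Cinf by <:].

(* The ball of radius r about f for the seminorm sup_Q |d^s (. o chart_inv c)|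
   (computed on real and imaginary parts). *)
Definition Cinf_ball (c : chart R M n) (Q : set 'rV[R]_n) (s : seq 'I_n) (f : Cinf)
    (r : R) : set Cinf :=
  [set g | forall y, Q y ->
     `|ipartial s (fun z => reK (val (g - f) (chart_inv c z))) y| < r /\
     `|ipartial s (fun z => imK (val (g - f) (chart_inv c z))) y| < r].

Definition Cinf_subbase : set (set Cinf) :=
  [set B | exists c Q s f r,
     [/\ atlas c, compact Q, Q `<=` chart_cod c, 0 < r & B = Cinf_ball c Q s f r]].

(* The usual Frechet topology: uniform convergence of all derivatives on the
   compact subsets of the charts. *)
HB.instance Definition _ := isSubBaseTopological.Build Cinf Cinf_subbase id.

Definition fun_support (f : Cinf) : set M := closure [set x | val f x != 0].

Definition point_distribution (e : M) (T : Cinf -> K^o) : Prop :=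
  [/\ linear T, continuous T & forall f, ~ fun_support f e -> T f = 0].

Definition point_distribution_pred (e : M) : {pred Cinf -> K^o} :=
  [pred T | `[< point_distribution e T >]].

Lemma point_distribution_submod_closed e :
  submod_closed (point_distribution_pred e).
Proof.
split=> [|a S T].
  apply/asboolP; split=> [b f g|f|//]; first by rewrite /= scaler0 addr0.
  exact: cst_continuous.
move=> /asboolP[lS cS sS] /asboolP[lT cT sT]; apply/asboolP; split.
- move=> b f g; rewrite [LHS]/(a *: S _ + T _) lS lT.
  rewrite [RHS]/(b *: (a *: S f + T f) + (a *: S g + T g)).
  by rewrite !scalerDr !scalerA [a * b]mulrC; exact: addrACA.
- by move=> f; have h := cvgD (cvgZl_tmp (k := a) (cS f)) (cT f); exact: h.
- move=> f fe; rewrite [LHS]/(a *: S f + T f) sS // sT //.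
  by rewrite scaler0; exact: addr0.
Qed.

HB.instance Definition _ e :=
  GRing.isSubmodClosed.Build K (Cinf -> K^o) (point_distribution_pred e)
    (point_distribution_submod_closed e).

Definition E' (e : M) : Type :=
  {T : Cinf -> K^o | point_distribution_pred e T}.
HB.instance Definition _ e := SubChoice.on (E' e).
HB.instance Definition _ e := [SubChoice_isSubLmodule of E' e by <:].

(* Below, insubd 0 only packs a function or functional that is smooth, resp. a
   point distribution, together with a proof of it; the default value 0 is
   never used at smooth (pointed) maps. *)
Definition mkCinf (f : M -> K^o) : Cinf := insubd 0 f.
Definition mkE' (e : M) (T : Cinf -> K^o) : E' e := insubd 0 T.

Definition dirac_at (e : M) : E' e := mkE' e (fun f => val f e).

Definition E'_counit (e : M) (T : E' e) : K := val T (mkCinf (cst 1)).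

End SmoothFunctions.

Section Functor.
Variables (m n : nat) (M : manifold R m) (N : manifold R n).

Definition E'_map (phi : M -> N) (e1 : M) (e2 : N) (T : E' e1) : E' e2 :=
  mkE' e2 (fun f => val T (mkCinf (val f \o phi))).

Definition F2 (e1 : M) (e2 : N) (S : E' e1) (T : E' e2) :
    E' ((e1, e2) : prod_manifold M N) :=
  mkE' (_ : prod_manifold M N) (fun f =>
    val S (mkCinf (fun x => val T (mkCinf (fun y => val f (x, y)))))).

Definition F2_tens (e1 : M) (e2 : N) :
    tens (E' e1) (E' e2) -> E' ((e1, e2) : prod_manifold M N) :=
  tlift (@F2 e1 e2).

(* F2_tens is bijective, so this is its inverse. *)
Definition F2_inv (e1 : M) (e2 : N) (U : E' ((e1, e2) : prod_manifold M N)) :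
    tens (E' e1) (E' e2) :=
  xget 0 [set t | F2_tens t = U].

End Functor.

Definition F_coalg n (M : manifold R n) (e : M) : coalg_data (E' e) :=
  CoalgData
    (fun T => F2_inv (E'_map (fun x => (x, x) : prod_manifold M M) (e, e) T))
    (@E'_counit n M e)
    (dirac_at e).

Definition F_mul n (D : manifold R n) (e : D) (op : D -> D -> D) :
    tens (E' e) (E' e) -> E' e :=
  fun t => E'_map (fun p : prod_manifold D D => op p.1 p.2) e (F2_tens t).

End Distributions.

Arguments dirac_at {R} k {n M} e.
Arguments F_coalg {R} k {n M} e.
Arguments F_mul {R} k {n D} e op t.

Section LieDimonoids.
Variables (R : realType) (n : nat) (D : manifold R n).

Definition barunital_Lie_dimonoid (e : D) (vd dv : D -> D -> D) : Prop :=
  [/\ smooth_map (fun p : prod_manifold D D => vd p.1 p.2),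
      smooth_map (fun p : prod_manifold D D => dv p.1 p.2)
    & barunital_dimonoid e vd dv].

Definition general_Lie_digroup (e : D) (vd dv : D -> D -> D) : Prop :=
  [/\ barunital_Lie_dimonoid e vd dv,
      forall x, exists y, vd x y = e
    & forall x, exists y, dv y x = e].

(* Lie digroups in the sense of Kinyon. *)
Definition Lie_digroup (e : D) (vd dv : D -> D -> D) : Prop :=
  general_Lie_digroup e vd dv /\
  forall x y z, vd x y = e -> dv z x = e -> y = z.

End LieDimonoids.

(* Main.v *)
Require Import Defs.
From HB Require Import structures.
From mathcomp Require Import all_boot all_order all_algebra.
From mathcomp Require Import all_classical all_reals all_analysis.
From mathcomp.real_closed Require Import complex.
From mathcomp Require Import ring lra zify.

Set Implicit Arguments.
Unset Strict Implicit.
Unset Printing Implicit Defensive.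
Import Order.TTheory GRing.Theory Num.Theory.
Import numFieldNormedType.Exports.
Local Open Scope classical_set_scope.
Local Open Scope ring_scope.

(** The proof rests on two facts about point distributions. The first is their
classical description: a distribution supported at [e] is a finite linear
combination of the functionals [chart_dist e c s], which take the partial
derivative of multi-index [s] at [e] in one chart [c]
([point_distribution_structure], [E'_span]). By continuity a point distribution
[T] is small on functions whose derivatives of order at most [N] are small on
finitely many compact sets. If the derivatives of [f] of order at most [N]
vanish at [e], then [f] multiplied by a cutoff function of radius [r] tends to 0
in that sense as [r] decreases to 0, while [T] does not see the cutoff; so [T]
kills [f] ([distribution_flat]). Hence [T] vanishes on the common kernel of
finitely many partial derivatives and is a combination of them ([kernel_span]).

The second fact is that the structure maps can be computed on test functions.
Write [ap T g] for the value of [T] on the smooth function [g]. Since partial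
derivatives transform into combinations of partial derivatives, pushforwards and
external products are again point distributions, with
[ap (E'_map phi e2 T) g = ap T (g \o phi)] ([ap_map]) and
[ap (F2 S T) G = ap S (fun x => ap T (fun y => G (x, y)))] ([ap_F2]). The image of
[T] under the diagonal is a finite sum of external products, by the Leibniz rule
and the symmetry of second derivatives ([diag_formula], [ap_diag],
[comul_exists]). The coproduct of [T] is thus characterised by [ap2 g h (comul T) = ap T (g * h)] ([ap2_comul]), and since
tensors are separated by products of separating functionals ([tens_separated]),
every axiom of a cocommutative coalgebra reduces to an axiom of the algebra of
smooth functions. In the same way every identity of the dialgebra reduces to the
corresponding identity of [D].

The antipode of a balanced dimonoid cannot be taken to be the pushforward by an
inversion, which need not exist globally. Instead consider the powers
[power j x = x |- (x |- ... |- (x |- e))]. The coproduct of [chart_dist e c s] is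
the unit tensored with it, plus terms whose second factors have smaller order;
therefore [j |-> (power j)_* T] is a polynomial function of [j], by induction on
the order ([power_chart_dist], [power_map_poly]). The antipode of [T] is the
value of that polynomial at [-1]. All the identities required of it hold for the maps
[power j] with [j] a natural number, up to a shift of [j], and an identity
between polynomial functions extends to [j = -1] ([polyval_unique]): for
instance the sum of the [T1 |- (power j)_* T2] over the coproduct of [T] is
[(power j.+1)_* T], whose value at [j = -1] is [(power 0)_* T], that is, the
counit of [T] times the unit. On the other side one uses
[power j x -| x = power j.+1 x] in a balanced dimonoid ([power_dv]), so that the
same antipode serves for both multiplications. Finally a Lie digroup in the
sense of Kinyon is balanced: if [y] is the inverse of [x] then
[x |- e = x |- (y -| x) = (x |- y) -| x = e -| x] ([Lie_digroup_balanced]). *)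

(** * Mean value theorem along a line *)

Section LineDerivative.
Variables (R : realType) (V W : normedModType R).

Lemma growth_rate_line (f : V -> W) (a v : V) (s : R) :
  (fun h : R => h^-1 *: (((fun t : R => f (a + t *: v)) \o shift s) (h *: (1 : R^o)) - f (a + s *: v)))
  = (fun h : R => h^-1 *: ((f \o shift (a + s *: v)) (h *: v) - f (a + s *: v))).
Proof.
apply/funext => h /=; congr (_ *: (f _ - _)).
by rewrite [h *: 1]mulr1 scalerDl addrCA.
Qed.

Lemma derivable_line (f : V -> W) (a v : V) (s : R) :
  derivable (fun t : R => f (a + t *: v)) s 1 = derivable f (a + s *: v) v.
Proof. by rewrite /derivable growth_rate_line. Qed.

Lemma derive_line (f : V -> W) (a v : V) (s : R) :
  'D_1 (fun t : R => f (a + t *: v)) s = 'D_v f (a + s *: v).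
Proof. by rewrite /derive growth_rate_line. Qed.

End LineDerivative.

Section MeanValue.
Variable R : realType.

Lemma MVT_signed (g : R -> R^o) (t : R) :
  (forall s, `|s| <= `|t| -> derivable g s 1) ->
  exists2 xi, `|xi| <= `|t| & g t - g 0 = t * 'D_1 g xi.
Proof.
move=> dg; have cg a b : `|a| <= `|t| -> `|b| <= `|t| ->
    {within `[a, b], continuous g}.
  move=> at_ bt; apply: derivable_within_continuous => x.
  rewrite in_itv /= => /andP[ax xb]; apply: dg.
  move: at_ bt; rewrite !ler_norml => /andP[? ?] /andP[? ?].
  by apply/andP; split; lra.
have dg' a b : `|a| <= `|t| -> `|b| <= `|t| ->
    forall x, x \in `]a, b[%R -> is_derive x 1 g ('D_1 g x).
  move=> at_ bt x; rewrite in_itv /= => /andP[ax xb]; apply/derivableP/dg.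
  move: at_ bt; rewrite !ler_norml => /andP[? ?] /andP[? ?].
  by apply/andP; split; lra.
have n0 : `|0 : R| <= `|t| by rewrite normr0.
case: (leP 0 t) => t0.
- have [c] := MVT_segment t0 (dg' _ _ n0 (lexx _)) (cg _ _ n0 (lexx _)).
  rewrite in_itv /= => /andP[c0 ct] E; exists c.
    by rewrite !ger0_norm.
  by rewrite E subr0 mulrC.
- have [c] := MVT_segment (ltW t0) (dg' _ _ (lexx _) n0) (cg _ _ (lexx _) n0).
  rewrite in_itv /= => /andP[c0 ct] E; exists c.
    by rewrite ler0_norm // ler0_norm ?(ltW t0) // lerN2.
  by rewrite -opprB E sub0r mulrN opprK mulrC.
Qed.

Lemma MVT_line (V : normedModType R) (f : V -> R^o) (a v : V) (t : R) :
  (forall s, `|s| <= `|t| -> derivable f (a + s *: v) v) ->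
  exists2 xi, `|xi| <= `|t| & f (a + t *: v) - f a = t * 'D_v f (a + xi *: v).
Proof.
move=> df; have [|xi xit E] := @MVT_signed (fun s => f (a + s *: v)) t.
  by move=> s st; rewrite derivable_line; exact: df.
by exists xi => //; move: E; rewrite scale0r addr0 derive_line.
Qed.

End MeanValue.

Section ContinuousPartials.
Variables (R : realType) (n : nat).
Implicit Types (f : 'rV[R]_n -> R^o) (U : set 'rV[R]_n).

Let trunc (v : 'rV[R]_n) (k : nat) : 'rV[R]_n := \row_j (if (j < k)%N then v 0 j else 0).

Lemma rV_norm_le (v : 'rV[R]_n) (r : R) : 0 <= r ->
  (forall j, `|v 0 j| <= r) -> `|v| <= r.
Proof.
move=> r0 h; rewrite /Num.Def.normr /= mx_normrE bigmax_le // => -[i j] _ /=.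
by rewrite ord1.
Qed.

Lemma rV_coord_le (v : 'rV[R]_n) j : `|v 0 j| <= `|v|.
Proof.
rewrite [leRHS]/Num.Def.normr /= mx_normrE.
exact: (le_bigmax _ (fun i : 'I_1 * 'I_n => `|v i.1 i.2|) (0, j)).
Qed.

(** The increment is split along the coordinates and the mean value theorem is
    applied to each piece; the intermediate points stay in the ball because the
    norm is the maximum norm. *)
Lemma increment_bound f (a v : 'rV[R]_n) (r e : R) :
  `|v| < r -> 
  (forall x i, `|x - a| < r -> derivable f x (delta_mx 0 i)) ->
  (forall x i, `|x - a| < r -> `|'D_(delta_mx 0 i) f x - 'D_(delta_mx 0 i) f a| <= e) ->
  `|f (a + v) - f a - \sum_i v 0 i * 'D_(delta_mx 0 i) f a| <= n%:R * e * `|v|.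
Proof.
move=> vr df ce.
(* [trunc v k] interpolates between 0 and [v], one coordinate at a time. *)
have T0 : trunc v 0 = 0 by apply/rowP => j; rewrite !mxE.
have Tn : trunc v n = v by apply/rowP => j; rewrite !mxE ltn_ord.
have TS (i : 'I_n) : trunc v i.+1 = trunc v i + v 0 i *: delta_mx 0 i.
  apply/rowP => j; rewrite !mxE eqxx /= ltnS leq_eqVlt -val_eqE /=.
  by case: eqP => [/val_inj ->|_]; rewrite ?ltnn /= ?mulr1 ?mulr0 ?add0r ?addr0.
have in_r (i : 'I_n) s : `|s| <= `|v 0 i| ->
    `|a + trunc v i + s *: delta_mx 0 i - a| < r.
  move=> sv; apply: le_lt_trans vr; rewrite addrAC [a + _]addrC addrK.
  apply: rV_norm_le => // j; rewrite !mxE eqxx /=.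
  case: ltnP => ij; last first.
    rewrite add0r; case: eqP => [_|_]; last by rewrite mulr0 normr0.
    by rewrite mulr1 (le_trans sv) ?rV_coord_le.
  have /negPf -> : j != i by rewrite -val_eqE /= ltn_eqF.
  by rewrite mulr0 addr0 rV_coord_le.
have step (i : 'I_n) : `|f (a + trunc v i.+1) - f (a + trunc v i)
     - v 0 i * 'D_(delta_mx 0 i) f a| <= e * `|v|.
  have [|xi xiv E] := @MVT_line R _ f (a + trunc v i) (delta_mx 0 i) (v 0 i).
    by move=> s sv; apply: df; exact: in_r.
  rewrite TS addrA E -mulrBr normrM mulrC.
  by apply: ler_pM => //; [apply: ce; exact: in_r|exact: rV_coord_le].
have -> : f (a + v) - f a = \sum_(i < n) (f (a + trunc v i.+1) - f (a + trunc v i)).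
  rewrite -(big_mkord xpredT (fun i => f (a + trunc v i.+1) - f (a + trunc v i))).
  rewrite (telescope_sumr (fun i => f (a + trunc v i))) //.
  by rewrite T0 Tn addr0.
rewrite -sumrB; apply: (le_trans (ler_norm_sum _ _ _)).
apply: (le_trans (ler_sum _ (fun i _ => step i))).
by rewrite sumr_const card_ord -mulrA mulr_natl.
Qed.

End ContinuousPartials.

Section SumRules.
Variables (R : realType) (V : normedModType R) (I : eqType).
Implicit Types (l : seq I) (F : I -> V -> R^o).

Lemma continuous_sum l F (x : V) :
  (forall i, i \in l -> {for x, continuous (F i)}) ->
  {for x, continuous (fun y => \sum_(i <- l) F i y : R^o)}.
Proof.
elim: l => [_|i l IH h].
  rewrite (_ : (fun _ => _) = cst 0); last by apply/funext => y; rewrite big_nil.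
  exact: cst_continuous.
rewrite (_ : (fun _ => _) = F i + (fun y => \sum_(j <- l) F j y)); last first.
  by apply/funext => y; rewrite big_cons.
apply: cvgD; first by apply: h; rewrite mem_head.
by apply: IH => j jl; apply: h; rewrite inE jl orbT.
Qed.

Lemma is_derive_sum_seq l F (dF : I -> R^o) (x v : V) :
  (forall i, i \in l -> is_derive x v (F i) (dF i)) ->
  is_derive x v (fun y => \sum_(i <- l) F i y : R^o) (\sum_(i <- l) dF i).
Proof.
elim: l => [_|i l IH h].
  rewrite (_ : (fun _ => _) = cst 0); last by apply/funext => y; rewrite big_nil.
  by rewrite big_nil; exact: is_derive_cst.
rewrite (_ : (fun _ => _) = F i + (fun y => \sum_(j <- l) F j y)); last first.
  by apply/funext => y; rewrite big_cons.
rewrite big_cons; apply: is_deriveD.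
  by apply: h; rewrite mem_head.
by apply: IH => j jl; apply: h; rewrite inE jl orbT.
Qed.

End SumRules.

(** * Functions with continuous partial derivatives *)

Section ContinuousPartialsDiff.
Variables (R : realType) (n : nat).
Implicit Types (f : 'rV[R]_n -> R^o).

Definition C1_at f (a : 'rV[R]_n) :=
  (\forall x \near a, forall i, derivable f x (delta_mx 0 i)) /\
  (forall i, {for a, continuous ('D_(delta_mx 0 i) f)}).

(** Continuity of the partial derivatives makes the bound of [increment_bound]
    hold with an arbitrarily small constant. *)
Lemma C1_differentiable f a : C1_at f a ->
  differentiable f a /\
  forall v, 'd f a v = \sum_i v 0 i * 'D_(delta_mx 0 i) f a.
Proof.
move=> [df cf].
pose d (v : 'rV[R]_n) : R^o := \sum_i v 0 i * 'D_(delta_mx 0 i) f a.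
have lind : linear d.
  move=> k u v; rewrite /d scaler_sumr -big_split /=; apply: eq_bigr => i _.
  by rewrite !mxE mulrDl -scalerAl.
pose dL : {linear 'rV[R]_n -> R^o} := HB.pack d (GRing.isLinear.Build _ _ _ _ _ lind).
have cd : continuous dL.
  move=> x; apply: continuous_sum => i _.
  have h : (fun v : 'rV[R]_n => v 0 i) @ x --> x 0 i by exact: coord_continuous.
  by apply: (cvgM h); exact: cvg_cst.
have E : f \o shift a = cst (f a) + dL +o_ (0 : 'rV[R]_n) id.
  apply/eqaddoP => e e0.
  pose e' := e / n.+1%:R.
  have e'0 : 0 < e' by rewrite divr_gt0.
  have [r r0 hr] : exists2 r : R, 0 < r & forall x, `|x - a| < r ->
     forall i, derivable f x (delta_mx 0 i) /\
     `|'D_(delta_mx 0 i) f x - 'D_(delta_mx 0 i) f a| <= e'.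
    have : \forall x \near a, forall i, derivable f x (delta_mx 0 i) /\
     `|'D_(delta_mx 0 i) f x - 'D_(delta_mx 0 i) f a| <= e'.
      near=> x => i; split; first by move: i; near: x.
      move: i; near: x; apply: filter_forall => i.
      have /cvgrPdist_le /(_ _ e'0) := cf i.
      by apply: filterS => x; rewrite distrC.
    move=> /nbhs_ballP[r /= r0 h]; exists r => // x xr; apply: h.
    by rewrite -ball_normE /= distrC.
  near=> v; rewrite /= -![(_ + _ : _ -> _) _]/(_ + _) -![(- _ : _ -> _) _]/(- _) /=.
  rewrite /cst opprD addrA [v + a]addrC.
  apply: (le_trans (@increment_bound R n f a v r e' _ _ _)).
  - by near: v; exact: (@nbhs0_lt _ 'rV[R]_n r r0).
  - by move=> x i xr; have [] := hr x xr i.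
  - by move=> x i xr; have [] := hr x xr i.
  - rewrite ler_wpM2r // /e' mulrCA -[leRHS]mulr1 ler_pM2l //.
    by rewrite ler_pdivrMr // mul1r ler_nat.
have dE : 'd f a = dL :> ('rV[R]_n -> R^o) by exact: diff_unique cd E.
split; last by move=> v; rewrite dE.
by apply/diff_locallyP; rewrite dE.
Unshelve. all: by end_near. Qed.

Lemma chain_rule (V : normedModType R) f (phi : V -> 'rV[R]_n) (x v : V) :
  C1_at f (phi x) -> (forall j, derivable (fun y => phi y 0 j : R^o) x v) ->
  is_derive x v (f \o phi)
    (\sum_j 'D_(delta_mx 0 j) f (phi x) * 'D_v (fun y => phi y 0 j : R^o) x).
Proof.
move=> Cf dphi; have [df dE] := C1_differentiable Cf.
have dphi' : derivable phi x v.
  by apply/derivable_mxP => i j; rewrite (ord1 i); exact: dphi.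
pose ga (h : R) := phi (x + h *: v).
have ga0 : ga 0 = phi x by rewrite /ga scale0r addr0.
have dga : differentiable (ga : R^o -> _) 0.
  by apply/derivable1_diffP; rewrite derivable_line scale0r addr0.
have df0 : differentiable f (ga 0) by rewrite ga0.
have dfga : differentiable (f \o ga : R^o -> R^o) 0.
  by apply: differentiable_comp.
have Ex : x = x + 0 *: v by rewrite scale0r addr0.
split.
  rewrite {1}Ex -(derivable_line (f \o phi)); exact/derivable1_diffP.
rewrite {1}Ex -(derive_line (f \o phi)).
have -> : 'D_1 (fun t : R => (f \o phi) (x + t *: v)) 0 = 'd f (ga 0) ('D_1 ga 0).
  rewrite (deriveE _ dga) -[fun t => _]/(f \o ga) (deriveE _ dfga).
  by rewrite (diff_comp dga df0).
rewrite ga0 dE derive_line scale0r addr0.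
by apply: eq_bigr => j _; rewrite mulrC derive_mx // mxE.
Qed.

End ContinuousPartialsDiff.

(** * Smooth functions on open subsets of Euclidean space *)

Lemma continuous_mul_at (R : realType) (V : normedModType R) (f g : V -> R^o) (x : V) :
  {for x, continuous f} -> {for x, continuous g} ->
  {for x, continuous (fun y => f y * g y : R^o)}.
Proof. by move=> cf cg; exact: (cvgM cf cg). Qed.

Section SmoothCalculus.
Variable R : realType.

Section Basics.
Variable n : nat.
Implicit Types (f g : 'rV[R]_n -> R^o) (U V : set 'rV[R]_n) (s t : seq 'I_n).

Lemma ipartial_cat s t f : ipartial (s ++ t) f = ipartial s (ipartial t f).
Proof. exact: foldr_cat. Qed.

Lemma smooth_onS U V f : V `<=` U -> smooth_on U f -> smooth_on V f.
Proof. by move=> VU sf s x Vx; apply: sf; exact: VU. Qed.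

Lemma smooth_on_ipartial U f s : smooth_on U f -> smooth_on U (ipartial s f).
Proof. by move=> sf t x Ux; rewrite -ipartial_cat; exact: sf. Qed.

Lemma smooth_on_is_derive U f s i x : smooth_on U f -> U x ->
  is_derive x (delta_mx 0 i) (ipartial s f) (ipartial (i :: s) f x).
Proof. by move=> sf Ux; apply/derivableP; have [] := sf s x Ux. Qed.

Lemma smooth_on_cont U f s x : smooth_on U f -> U x ->
  {for x, continuous (ipartial s f)}.
Proof. by move=> sf Ux; have [] := sf s x Ux. Qed.

Lemma smooth_on_C1 U f s x : open U -> smooth_on U f -> U x ->
  C1_at (ipartial s f) x.
Proof.
move=> oU sf Ux; split=> [|i].
  by near=> y; apply: (sf s y _).1; near: y; exact: open_nbhs_nbhs.
exact: (smooth_on_cont (s := i :: s) sf Ux).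
Unshelve. all: by end_near. Qed.

Lemma ipartial_eq_on U f g s : open U -> (forall x, U x -> f x = g x) ->
  forall x, U x -> ipartial s f x = ipartial s g x.
Proof.
move=> oU fg; elim: s => [|i s IH] x Ux /=; first exact: fg.
apply: near_eq_derive; near=> y; apply: IH; near: y; exact: open_nbhs_nbhs.
Unshelve. all: by end_near. Qed.

(** Smoothness is a statement about all iterated partial derivatives, so it is
    convenient to guess them all at once: a family [E] starting with [f] in which
    prefixing an index amounts to differentiating is the family of the iterated
    partial derivatives of [f]. *)
Lemma smooth_on_formula U f (E : seq 'I_n -> 'rV[R]_n -> R^o) : open U ->
  (forall x, U x -> f x = E [::] x) ->
  (forall s x, U x -> {for x, continuous (E s)}) ->
  (forall s i x, U x -> is_derive x (delta_mx 0 i) (E s) (E (i :: s) x)) ->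
  smooth_on U f /\ forall s x, U x -> ipartial s f x = E s x.
Proof.
move=> oU f0 cE dE.
have fE s x : U x -> ipartial s f x = E s x.
  elim: s x => [|i s IH] x Ux /=; first exact: f0.
  rewrite -[RHS](@derive_val _ _ _ _ _ _ _ (dE s i x Ux)).
  by apply: near_eq_derive; near=> y; apply: IH; near: y; exact: open_nbhs_nbhs.
split=> // s x Ux.
have nE : \near x, E s x = ipartial s f x.
  by near=> y; apply/esym/fE; near: y; exact: open_nbhs_nbhs.
split=> [i|].
  by apply: (near_eq_derivable nE); exact: (@ex_derive _ _ _ _ _ _ _ (dE s i x Ux)).
rewrite /prop_for /continuous_at fE //.
by apply: cvg_trans (near_eq_cvg nE) _; exact: cE.
Unshelve. all: by end_near. Qed.

Lemma smooth_on_eq U f g : open U -> (forall x, U x -> f x = g x) ->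
  smooth_on U f -> smooth_on U g.
Proof.
move=> oU fg sf; apply: (smooth_on_formula (E := fun s => ipartial s f) oU _ _ _).1.
- by move=> x Ux; rewrite /= fg.
- by move=> s x Ux; exact: smooth_on_cont sf Ux.
- by move=> s i x Ux; exact: smooth_on_is_derive sf Ux.
Qed.

Lemma smooth_on_cst U (c : R) : open U -> smooth_on U (cst c).
Proof.
move=> oU; apply: (smooth_on_formula (E := fun s => cst (if s is [::] then c else 0)) oU _ _ _).1.
- by [].
- by move=> s x _; exact: cst_continuous.
Qed.

Lemma coord_is_derive (x v : 'rV[R]_n) j :
  is_derive x v (fun y : 'rV[R]_n => y 0 j : R^o) (v 0 j).
Proof.
have d1 := @derivable_id _ _ x v.
split; first by have /derivable_mxP := d1; exact.
by have := derive_mx d1; rewrite derive_id => /rowP /(_ j); rewrite mxE => <-.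
Qed.

Lemma smooth_on_coord U j : open U -> smooth_on U (fun y => y 0 j).
Proof.
move=> oU; apply: (smooth_on_formula (E := fun s => match s with
  | [::] => fun y => y 0 j | [:: i] => cst (i == j)%:R | _ => cst 0 end) oU _ _ _).1.
- by [].
- move=> [|i [|k s]] x _; [exact: coord_continuous|exact: cst_continuous|exact: cst_continuous].
- move=> [|i [|k s]] i' x _; try exact: is_derive_cst.
  by apply: is_derive_eq (coord_is_derive _ _ _) _; rewrite !mxE eqxx /= eq_sym.
Qed.

Lemma smooth_onD U f g : open U -> smooth_on U f -> smooth_on U g ->
  smooth_on U (fun x => f x + g x).
Proof.
move=> oU sf sg; apply: (smooth_on_eq oU) (smooth_on_lin 1 oU sf sg).1 => x _.
by rewrite mul1r.
Qed.

Lemma smooth_onZ U f (c : R) : open U -> smooth_on U f ->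
  smooth_on U (fun x => c * f x).
Proof.
move=> oU sf; apply: (smooth_on_eq oU) (smooth_on_lin c oU sf (smooth_on_cst 0 oU)).1 => x _.
by rewrite addr0.
Qed.

Lemma smooth_on_sum (I : Type) (l : seq I) (F : I -> 'rV[R]_n -> R^o) U :
  open U -> (forall i, smooth_on U (F i)) ->
  smooth_on U (fun x => \sum_(i <- l) F i x).
Proof.
move=> oU sF; elim: l => [|i l IH].
  by apply: (smooth_on_eq oU) (smooth_on_cst 0 oU) => x _; rewrite big_nil.
by apply: (smooth_on_eq oU) (smooth_onD oU (sF i) IH) => x _; rewrite big_cons.
Qed.

End Basics.

(** The index set of the Leibniz rule, and later of the coproduct of a partial
    derivative: each entry of the multi-index goes to one of two factors. *)
Fixpoint splits (T : Type) (s : seq T) : seq (seq T * seq T) :=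
  if s is i :: s' then
    [seq (i :: p.1, p.2) | p <- splits s'] ++ [seq (p.1, i :: p.2) | p <- splits s']
  else [:: ([::], [::])].

Lemma splits_size (T : eqType) (s : seq T) p : p \in splits s ->
  (size p.1 + size p.2 = size s)%N.
Proof.
elim: s p => [|i s IH] p /=; first by rewrite inE => /eqP ->.
by rewrite mem_cat => /orP[] /mapP[q /IH <- ->] /=; rewrite ?addSn ?addnS.
Qed.

Lemma Leibniz n (U : set 'rV[R]_n) (f g : 'rV[R]_n -> R^o) : open U ->
  smooth_on U f -> smooth_on U g ->
  smooth_on U (fun x => f x * g x) /\
  forall s x, U x -> ipartial s (fun x => f x * g x) x =
    \sum_(p <- splits s) ipartial p.1 f x * ipartial p.2 g x.
Proof.
move=> oU sf sg.
apply: (smooth_on_formula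
  (E := fun s x => \sum_(p <- splits s) ipartial p.1 f x * ipartial p.2 g x) oU).
- by move=> x _; rewrite big_seq1.
- move=> s x Ux; apply: continuous_sum => p _.
  by apply: continuous_mul_at; [exact: smooth_on_cont sf Ux|exact: smooth_on_cont sg Ux].
- move=> s i x Ux.
  apply: (@is_derive_eq _ _ _ _ _ _ _ (\sum_(p <- splits s)
     (ipartial p.1 f x *: ipartial (i :: p.2) g x +
      ipartial p.2 g x *: ipartial (i :: p.1) f x))).
    apply: is_derive_sum_seq => p _; apply: is_deriveM.
      exact: smooth_on_is_derive sf Ux.
    exact: smooth_on_is_derive sg Ux.
  rewrite /= big_cat /= !big_map -big_split /=; apply: eq_bigr => p _.
  by rewrite addrC; congr (_ + _); rewrite mulrC.
Qed.

Section Chain.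
Variables m n : nat.
Implicit Types (f : 'rV[R]_n -> R^o) (phi : 'rV[R]_m -> 'rV[R]_n).

(** The pairs (t, P) such that the derivative of f o phi of multi-index s is the sum
    of the products of P with the derivative of f of multi-index t, composed with
    phi. That P does not depend on f is what matters: this form yields at once the smoothness of composites, uniform estimates in a
    change of charts, and the expansion of a pushforward of a partial derivative. *)
Fixpoint chain_terms phi (s : seq 'I_m) : seq (seq 'I_n * ('rV[R]_m -> R^o)) :=
  if s is i :: s' then
    flatten [seq (q.1, 'D_(delta_mx 0 i) q.2 : 'rV[R]_m -> R^o) ::
      [seq (j :: q.1, fun x => q.2 x * 'D_(delta_mx 0 i) (fun y => phi y 0 j : R^o) x)
        | j <- enum 'I_n]
      | q : seq 'I_n * ('rV[R]_m -> R^o) <- chain_terms phi s']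
  else [:: ([::], cst 1)].

Lemma chain_terms_size phi s q : q \in chain_terms phi s ->
  (size q.1 <= size s)%N.
Proof.
elim: s q => [|i s IH] q /=; first by rewrite inE => /eqP ->.
move=> /flatten_mapP[p /IH ps]; rewrite inE => /orP[/eqP ->|/mapP[j _ ->]] //=.
exact: leqW.
Qed.

Lemma chain_terms_smooth phi (V : set 'rV[R]_m) s q : open V ->
  (forall j, smooth_on V (fun y => phi y 0 j)) ->
  q \in chain_terms phi s -> smooth_on V q.2.
Proof.
move=> oV sphi; elim: s q => [|i s IH] q /=.
  by rewrite inE => /eqP ->; exact: smooth_on_cst.
move=> /flatten_mapP[p /IH ps]; rewrite inE => /orP[/eqP ->|/mapP[j _ ->]] /=.
  exact: (smooth_on_ipartial [:: i] ps).
by apply: (Leibniz oV ps _).1; exact: (smooth_on_ipartial [:: i] (sphi j)).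
Qed.

Lemma smooth_comp phi f (V : set 'rV[R]_m) (U : set 'rV[R]_n) :
  open V -> open U -> (forall x, V x -> U (phi x)) ->
  (forall j, smooth_on V (fun y => phi y 0 j)) -> smooth_on U f ->
  smooth_on V (f \o phi) /\
  forall s x, V x -> ipartial s (f \o phi) x =
    \sum_(q <- chain_terms phi s) q.2 x * ipartial q.1 f (phi x).
Proof.
move=> oV oU VU sphi sf.
have cphi x : V x -> {for x, continuous phi}.
  move=> Vx; apply: (@rV_cvg _ _ (nbhs x)) => j; exact: (smooth_on_cont (s := [::]) (sphi j) Vx).
apply: (smooth_on_formula
  (E := fun s x => \sum_(q <- chain_terms phi s) q.2 x * ipartial q.1 f (phi x)) oV).
- by move=> x _; rewrite big_seq1 mul1r.
- move=> s x Vx; apply: continuous_sum => q qs; apply: continuous_mul_at.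
    exact: (smooth_on_cont (s := [::]) (chain_terms_smooth oV sphi qs) Vx).
  apply: continuous_comp; [exact: cphi|exact: smooth_on_cont sf (VU _ Vx)].
- move=> s i x Vx.
  apply: (@is_derive_eq _ _ _ _ _ _ _ (\sum_(q <- chain_terms phi s)
     (q.2 x *: (\sum_j ipartial (j :: q.1) f (phi x) *
          'D_(delta_mx 0 i) (fun y => phi y 0 j : R^o) x) +
      ipartial q.1 f (phi x) *: 'D_(delta_mx 0 i) q.2 x))).
    apply: is_derive_sum_seq => q qs; apply: is_deriveM.
      exact: (smooth_on_is_derive [::] i (chain_terms_smooth oV sphi qs) Vx).
    apply: chain_rule; first exact: smooth_on_C1 oU sf (VU _ Vx).
    by move=> j; have [] := sphi j [::] x Vx.
  rewrite /= big_flatten big_map; apply: eq_bigr => q _.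
  rewrite big_cons /= big_map big_enum /= addrC; congr (_ + _).
    rewrite scaler_sumr; apply: eq_big => // j _.
    by rewrite -[LHS]/(q.2 x * (_ * _)) mulrA mulrAC.
  exact: mulrC.
Qed.

End Chain.

End SmoothCalculus.

(** * Symmetry of second derivatives and affine substitutions *)

Section Schwarz.
Variables (R : realType) (n : nat).
Implicit Types (f : 'rV[R]_n -> R^o) (U : set 'rV[R]_n).

(** The difference quotients are the same. *)
Lemma is_derive_translate (V W : normedModType R) (f : V -> W) (w x v : V) (df : W) :
  is_derive (x + w) v f df -> is_derive x v (fun y => f (y + w)) df.
Proof.
have E : (fun h : R => h^-1 *: (((fun y => f (y + w)) \o shift x) (h *: v) - f (x + w)))
    = (fun h : R => h^-1 *: ((f \o shift (x + w)) (h *: v) - f (x + w))).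
  by apply/funext => h /=; rewrite addrA.
by case=> d <-; split; rewrite /derivable /derive E.
Qed.

Lemma norm_delta_le (i : 'I_n) : `|delta_mx 0 i : 'rV[R]_n| <= 1.
Proof.
apply: rV_norm_le => // j; rewrite mxE eqxx /=.
by case: eqP; rewrite ?normr1 ?normr0.
Qed.

(** Two applications of the mean value theorem. The left-hand side is symmetric
    in [i] and [j], which is what [ipartial_swap] exploits. *)
Lemma second_difference f P U (a : 'rV[R]_n) (r h : R) (i j : 'I_n) :
  P = ipartial [:: j; i] f ->
  smooth_on U f -> (forall x, `|x - a| < r -> U x) -> 0 < h -> h + h < r ->
  exists2 x, `|x - a| < r &
    f (a + h *: delta_mx 0 i + h *: delta_mx 0 j) - f (a + h *: delta_mx 0 i)
    - (f (a + h *: delta_mx 0 j) - f a) = h * (h * P x).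
Proof.
move=> -> sf hU h0 hr.
have near_a (s t : R) : `|s| <= h -> `|t| <= h ->
    `|a + s *: delta_mx 0 i + t *: delta_mx 0 j - a| < r.
  have E (u v : 'rV[R]_n) : a + u + v - a = u + v.
    by rewrite [a + u]addrC [u + a + v]addrAC addrK.
  move=> sh th; rewrite E.
  apply: le_lt_trans (ler_normD _ _) _; apply: le_lt_trans hr.
  rewrite !normrZ; apply: lerD.
    by rewrite -[leRHS]mulr1; apply: ler_pM => //; exact: norm_delta_le.
  by rewrite -[leRHS]mulr1; apply: ler_pM => //; exact: norm_delta_le.
have near_a0 (s : R) : `|s| <= h -> `|a + s *: delta_mx 0 i - a| < r.
  move=> sh; have := near_a s 0 sh; rewrite scale0r addr0; apply.
  by rewrite normr0 ltW.
pose u x := f (x + h *: delta_mx 0 j) - f x.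
have du s : `|s| <= h -> is_derive (a + s *: delta_mx 0 i) (delta_mx 0 i) u
    (ipartial [:: i] f (a + s *: delta_mx 0 i + h *: delta_mx 0 j)
      - ipartial [:: i] f (a + s *: delta_mx 0 i)).
  move=> sh; apply: is_deriveB.
    apply: is_derive_translate; apply: (smooth_on_is_derive [::] i sf).
    by apply/hU/near_a => //; rewrite ger0_norm // ltW.
  apply: (smooth_on_is_derive [::] i sf); exact/hU/near_a0.
have hn : `|h| = h by rewrite ger0_norm // ltW.
have [|s sh Es] := @MVT_line R _ u a (delta_mx 0 i) h.
  by move=> s; rewrite hn => /du[].
rewrite hn in sh.
have [|t th Et] := @MVT_line R _ (ipartial [:: i] f)
    (a + s *: delta_mx 0 i) (delta_mx 0 j) h.
  by move=> t; rewrite hn => th; have [] := sf [:: i] _ (hU _ (near_a _ _ sh th)).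
rewrite hn in th.
exists (a + s *: delta_mx 0 i + t *: delta_mx 0 j); first exact: near_a.
move: Es; rewrite /u => ->; congr (_ * _).
by rewrite (@derive_val _ _ _ _ _ _ _ (du s sh)).
Qed.

(** Both mixed derivatives are limits of the same second difference quotient. *)
Lemma ipartial_swap f U i j x : open U -> smooth_on U f -> U x ->
  ipartial [:: i; j] f x = ipartial [:: j; i] f x.
Proof.
move=> oU sf Ux.
have cP := smooth_on_cont (s := [:: i; j]) sf Ux.
have cQ := smooth_on_cont (s := [:: j; i]) sf Ux.
have SP := @second_difference f _ U _ _ _ j i erefl sf.
have SQ := @second_difference f _ U _ _ _ i j erefl sf.
move: (ipartial [:: i; j] f) (ipartial [:: j; i] f) cP cQ SP SQ => P Q cP cQ SP SQ.
apply/eqP; rewrite -subr_eq0 -normr_le0; apply/ler_addgt0Pr => e e0.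
rewrite add0r; have e2 : 0 < e / 2 by rewrite divr_gt0.
have nU : nbhs x U by exact: open_nbhs_nbhs.
have nP : \forall y \near x, `|P x - P y| <= e / 2.
  by have /cvgrPdist_le /(_ _ e2) := cP.
have nQ : \forall y \near x, `|Q x - Q y| <= e / 2.
  by have /cvgrPdist_le /(_ _ e2) := cQ.
have [r /= r0 hr] := (nbhs_ballP _ _).1 (filterI nU (filterI nP nQ)).
have hr' y : `|y - x| < r -> [/\ U y, `|P x - P y| <= e / 2 & `|Q x - Q y| <= e / 2].
  by move=> yr; have [|? [? ?]] := hr y; first by rewrite -ball_normE /= distrC.
have h0 : 0 < r / 3 by rewrite divr_gt0.
have hh : r / 3 + r / 3 < r by lra.
have hU y : `|y - x| < r -> U y by move=> /hr'[].
have [y yr Ey] := SQ _ _ _ hU h0 hh.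
have [z zr Ez] := SP _ _ _ hU h0 hh.
have {Ey Ez} E : Q y = P z.
  apply: (mulfI (lt0r_neq0 h0)); apply: (mulfI (lt0r_neq0 h0)).
  rewrite -Ey -Ez [x + _ + _]addrAC !opprB [LHS]addrACA [RHS]addrACA.
  by congr (_ + _); rewrite addrC.
have [_ _ hy] := hr' y yr; have [_ hz _] := hr' z zr.
rewrite -(subrKA (P z)) -{2}E.
by apply: le_trans (ler_normD _ _) _; rewrite (splitr e) lerD // distrC.
Qed.

Lemma ipartial_move f U (s t : seq 'I_n) i x : open U -> smooth_on U f -> U x ->
  ipartial (s ++ i :: t) f x = ipartial (i :: s ++ t) f x.
Proof.
move=> oU sf; elim: s x => [|j s IH] x Ux //=.
rewrite -[LHS]/(ipartial [:: j] (ipartial (s ++ i :: t) f) x).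
rewrite (ipartial_eq_on _ oU IH Ux).
exact: (ipartial_swap _ _ oU (smooth_on_ipartial (s ++ t) sf) Ux).
Qed.

End Schwarz.

Section AffineSubstitution.
Variable R : realType.

(** Such maps intertwine iterated partial derivatives literally, without any
    differentiability assumption; the embeddings of the slices of a product are
    the examples of interest. *)
Definition coord_affine m n (sg : 'I_m -> 'I_n) (l : 'rV[R]_m -> 'rV[R]_n) :=
  continuous l /\
  forall i h x, l (h *: delta_mx 0 i + x) = h *: delta_mx 0 (sg i) + l x.

Lemma growth_rate_affine m n (sg : 'I_m -> 'I_n) l (f : 'rV[R]_n -> R^o) i x :
  coord_affine sg l ->
  (fun h : R => h^-1 *: (((f \o l) \o shift x) (h *: delta_mx 0 i) - (f \o l) x))
  = (fun h : R => h^-1 *: ((f \o shift (l x)) (h *: delta_mx 0 (sg i)) - f (l x))).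
Proof. by move=> [_ hl]; apply/funext => h /=; rewrite hl. Qed.

Lemma ipartial_affine m n (sg : 'I_m -> 'I_n) l (f : 'rV[R]_n -> R^o) s :
  coord_affine sg l -> ipartial s (f \o l) = ipartial (map sg s) f \o l.
Proof.
move=> al; elim: s => [//|i s IH].
rewrite -[LHS]/('D_(delta_mx 0 i) (ipartial s (f \o l))) IH.
by apply/funext => x; rewrite /= /derive (growth_rate_affine _ _ _ al).
Qed.

Lemma smooth_on_affine m n (sg : 'I_m -> 'I_n) l (f : 'rV[R]_n -> R^o)
    (U : set 'rV[R]_n) (V : set 'rV[R]_m) :
  coord_affine sg l -> (forall x, V x -> U (l x)) -> smooth_on U f ->
  smooth_on V (f \o l).
Proof.
move=> al VU sf s x Vx; have [cl hl] := al.
have [df cf] := sf (map sg s) _ (VU x Vx).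
rewrite (ipartial_affine f s al); split=> [i|].
  by rewrite /derivable (growth_rate_affine _ _ _ al); exact: df.
by apply: continuous_comp; [exact: cl|exact: cf].
Qed.

Lemma row_mx_continuousr m n (a : 'rV[R]_m) :
  continuous (fun y : 'rV[R]_n => row_mx a y).
Proof.
move=> y; apply: (@rV_cvg _ _ (nbhs y)) => j; rewrite mxE; under eq_fun do rewrite mxE.
by case: (fintype.split j) => k; [exact: cvg_cst|exact: coord_continuous].
Qed.

Lemma row_mx_continuousl m n (b : 'rV[R]_n) :
  continuous (fun y : 'rV[R]_m => row_mx y b).
Proof.
move=> y; apply: (@rV_cvg _ _ (nbhs y)) => j; rewrite mxE; under eq_fun do rewrite mxE.
by case: (fintype.split j) => k; [exact: coord_continuous|exact: cvg_cst].
Qed.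

Lemma slicer_affine m n (a : 'rV[R]_m) :
  coord_affine (@rshift m n) (fun y => row_mx a y).
Proof.
split=> [|i h x]; first exact: row_mx_continuousr.
apply/rowP => j; rewrite !mxE; case: splitP => k jk; rewrite ?mxE /=.
  by rewrite -val_eqE /= jk ltn_eqF ?mulr0 ?add0r // ltn_addr.
by rewrite -(inj_eq val_inj) -(inj_eq val_inj j) /= jk eqn_add2l.
Qed.

Lemma slicel_affine m n (b : 'rV[R]_n) :
  coord_affine (@lshift m n) (fun y => row_mx y b).
Proof.
split=> [|i h x]; first exact: row_mx_continuousl.
apply/rowP => j; rewrite !mxE; case: splitP => k jk; rewrite ?mxE /=.
  by rewrite -(inj_eq val_inj) -(inj_eq val_inj j) /= jk.
by rewrite -val_eqE /= jk gtn_eqF ?mulr0 ?add0r // ltn_addr.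
Qed.

(** The derivative of [f (x, x)] in direction [i] is the sum of the derivatives
    of [f] in the two directions that [i] induces on the product. The symmetry of
    second derivatives sorts the directions of the first factor to the front. *)
Lemma diag_formula n (f : 'rV[R]_(n + n) -> R^o) (W : set 'rV[R]_(n + n))
    (U : set 'rV[R]_n) : open W -> open U -> (forall x, U x -> W (row_mx x x)) ->
  smooth_on W f -> smooth_on U (fun x => f (row_mx x x)) /\
  forall s x, U x -> ipartial s (fun x => f (row_mx x x)) x =
    \sum_(p <- splits s)
      ipartial (map (@lshift n n) p.1 ++ map (@rshift n n) p.2) f (row_mx x x).
Proof.
move=> oW oU UW sf.
have cdiag x : {for x, continuous (fun y : 'rV[R]_n => row_mx y y)}.
  apply: (@rV_cvg _ _ (nbhs x)) => j; rewrite mxE; under eq_fun do rewrite mxE.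
  by case: (fintype.split j) => k; exact: coord_continuous.
apply: (smooth_on_formula (E := fun s x => \sum_(p <- splits s)
      ipartial (map (@lshift n n) p.1 ++ map (@rshift n n) p.2) f (row_mx x x)) oU).
- by move=> x _; rewrite big_seq1.
- move=> s x Ux; apply: continuous_sum => p _.
  apply: continuous_comp; [exact: cdiag|exact: smooth_on_cont sf (UW _ Ux)].
move=> s i x Ux; rewrite /= big_cat /= !big_map -big_split /=.
apply: is_derive_sum_seq => p _ /=.
rewrite [X in _ + X](ipartial_move _ _ _ oW sf (UW _ Ux)).
set t := (X in ipartial X f).
have dl k : is_derive x (delta_mx 0 i) (fun y : 'rV[R]_n => row_mx y y 0 (lshift n k) : R^o) (k == i)%:R.
  rewrite (_ : (fun _ => _) = fun y : 'rV[R]_n => y 0 k : R^o); last first.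
    by apply/funext => y; rewrite row_mxEl.
  by apply: is_derive_eq (coord_is_derive _ _ _) _; rewrite mxE eqxx.
have dr k : is_derive x (delta_mx 0 i) (fun y : 'rV[R]_n => row_mx y y 0 (rshift n k) : R^o) (k == i)%:R.
  rewrite (_ : (fun _ => _) = fun y : 'rV[R]_n => y 0 k : R^o); last first.
    by apply/funext => y; rewrite row_mxEr.
  by apply: is_derive_eq (coord_is_derive _ _ _) _; rewrite mxE eqxx.
have dd j : derivable (fun y : 'rV[R]_n => row_mx y y 0 j : R^o) x (delta_mx 0 i).
  by case: (split_ordP j) => k ->; [case: (dl k)|case: (dr k)].
have C1t : C1_at (ipartial t f) (row_mx x x) := smooth_on_C1 t oW sf (UW _ Ux).
have Ed := chain_rule (phi := fun y : 'rV[R]_n => row_mx y y) C1t dd.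
apply: is_derive_eq Ed _; rewrite big_split_ord /=; congr (_ + _).
  rewrite (bigD1 i) //= big1 ?addr0 => [|k ki].
    by rewrite (@derive_val _ _ _ _ _ _ _ (dl i)) eqxx mulr1.
  by rewrite (@derive_val _ _ _ _ _ _ _ (dl k)) (negPf ki) mulr0.
rewrite (bigD1 i) //= big1 ?addr0 => [|k ki].
  by rewrite (@derive_val _ _ _ _ _ _ _ (dr i)) eqxx mulr1.
by rewrite (@derive_val _ _ _ _ _ _ _ (dr k)) (negPf ki) mulr0.
Qed.

End AffineSubstitution.

(** * Smooth cutoff functions *)

Section OneVariable.
Variable R : realType.

(** [G k] plays the role of the [k]-th derivative of [G 0]; the function
    [G 0] is regarded as a function on row vectors of length 1 in order to use
    [smooth_comp]. *)
Lemma smooth_comp_1d n (G : nat -> R -> R^o) (I : set R) (g : 'rV[R]_n -> R^o)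
    (U : set 'rV[R]_n) :
  open I -> open U -> (forall k t, I t -> is_derive t 1 (G k) (G k.+1 t)) ->
  (forall x, U x -> I (g x)) -> smooth_on U g -> smooth_on U (fun x => G 0%N (g x)).
Proof.
move=> oI oU dG UI sg.
pose W := [set y : 'rV[R]_1 | I (y 0 0)].
have oW : open W by apply: open_comp oI => y _; exact: coord_continuous.
have cG k t : I t -> {for t, continuous (G k)}.
  move=> It; apply: differentiable_continuous; apply/derivable1_diffP.
  by case: (dG k t It).
have sG : smooth_on W (fun y => G 0%N (y 0 0)).
  apply: (smooth_on_formula (E := fun s y => G (size s) (y 0 0)) oW _ _ _).1.
  - by [].
  - move=> s y Wy; apply: (continuous_comp (f := fun y : 'rV[R]_1 => y 0 0)).
      exact: coord_continuous.
    exact: cG.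
  - move=> s i y Wy /=.
    have dy := coord_is_derive y (delta_mx 0 i) 0.
    have D := dG (size s) _ Wy.
    have dGy : differentiable (G (size s)) (y 0 0).
      by apply/derivable1_diffP; case: D.
    have dc : differentiable (fun y : 'rV[R]_1 => y 0 0 : R^o) y.
      exact: differentiable_coord.
    have dGc : differentiable (G (size s) \o (fun y : 'rV[R]_1 => y 0 0 : R^o)) y.
      exact: differentiable_comp.
    split; first exact: (diff_derivable dGc).
    rewrite (deriveE _ dGc) (diff_comp dc dGy) /= -(deriveE _ dc).
    rewrite (@derive_val _ _ _ _ _ _ _ dy) mxE eqxx (ord1 i) /=.
    by rewrite -(deriveE _ dGy) (@derive_val _ _ _ _ _ _ _ D).
pose phi (x : 'rV[R]_n) : 'rV[R]_1 := \row_(_ < 1) g x.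
have h := (@smooth_comp R n 1 phi _ U W oU oW _ _ sG).1.
rewrite (_ : (fun _ => _) = (fun y : 'rV[R]_1 => G 0%N (y 0 0)) \o phi).
  apply: h => [x Ux|j]; first by rewrite /W /= mxE; exact: UI.
  by rewrite (_ : (fun _ => _) = g) //; apply/funext => y; rewrite mxE.
by apply/funext => x /=; rewrite mxE.
Qed.

Lemma smooth_on_inv n (g : 'rV[R]_n -> R^o) (U : set 'rV[R]_n) : open U ->
  (forall x, U x -> 0 < g x) -> smooth_on U g -> smooth_on U (fun x => (g x)^-1).
Proof.
move=> oU g0 sg.
pose G (k : nat) (t : R) : R^o := (-1) ^+ k * k`!%:R * t^-1 ^+ k.+1.
rewrite (_ : (fun _ => _) = fun x => G 0%N (g x)); last first.
  by apply/funext => x; rewrite /G expr0 expr1 mul1r mul1r.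
apply: (@smooth_comp_1d _ G [set t | 0 < t] g U (@open_gt R 0) oU _ g0 sg).
move=> k t /= t0.
have tn0 : t != 0 by rewrite gt_eqF.
have dV : is_derive (t : R^o) 1 (fun u : R => u^-1 : R^o) (- t ^- 2).
  have h := @is_deriveV _ (fun u : R => u) t 1 1 tn0 (is_derive_id _ _).
  by apply: is_derive_eq h _; rewrite scaler1.
have dX := @is_deriveX _ _ (fun u : R => u^-1 : R^o) k.+1 t 1 _ dV.
have dZ := @is_deriveZ _ _ _ _ ((-1) ^+ k * k`!%:R) t 1 _ dX.
rewrite (_ : G k = ((-1) ^+ k * k`!%:R) *: ((fun u : R => u^-1 : R^o) ^+ k.+1)).
  apply: is_derive_eq dZ _; rewrite /G /= -[LHS]/(_ * (_ * _)) factS natrM -exprVn !exprS.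
  by ring.
by apply/funext => u; rewrite /G -[RHS]/(_ * _) fctE.
Qed.

End OneVariable.

Section FlatExponential.
Variable R : realType.

Lemma power_le_exp (i : nat) : exists2 C : R, 0 <= C &
  forall u, 0 < u -> u ^+ i <= C * expR u.
Proof.
(* exp u = (exp (u / i))^i >= (u / i)^i *)
exists (i%:R ^+ i) => [|u u0]; first exact: exprn_ge0.
case: i => [|i]; first by rewrite !expr0 mul1r ltW // expR_gt1.
have i0 : 0 < i.+1%:R :> R by [].
have -> : expR u = expR (u / i.+1%:R) ^+ i.+1.
  by rewrite -expRM_natl mulrC divfK // gt_eqF.
have uE : u <= i.+1%:R * expR (u / i.+1%:R); last first.
  by rewrite -exprMn; apply: lerXn2r uE; rewrite nnegrE ?ltW // mulr_gt0 // expR_gt0.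
rewrite -ler_pdivrMl // mulrC; by apply: le_trans (expR_ge1Dx _); rewrite lerDr.
Qed.

(** The functions q(1/t) exp(-1/t), extended by 0 to t <= 0. They form a family
    closed under differentiation, which contains exp(-1/t). *)
Definition flat_exp (q : {poly R}) (t : R) : R^o :=
  if 0 < t then q.[t^-1] * expR (- t^-1) else 0.

(** A quadratic bound is what differentiability at 0 requires; it holds because
    the exponential dominates every power. *)
Lemma flat_exp_bound q : exists2 C : R, 0 <= C &
  forall t, `|flat_exp q t| <= C * t ^+ 2.
Proof.
have [C C0 hC] : exists2 C : R, 0 <= C & forall u, 0 < u ->
    `|q.[u]| * u ^+ 2 <= C * expR u.
  have h (i : nat) := cid2 (power_le_exp (i + 2)).
  exists (\sum_(i < size q) `|q`_i| * projT1 (h i)) => [|u u0].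
    by apply: sumr_ge0 => i _; case: (h i) => c c0 _ /=; exact: mulr_ge0.
  rewrite horner_coef mulr_suml.
  apply: (@le_trans _ _ ((\sum_(i < size q) `|q`_i * u ^+ i|) * u ^+ 2)).
    by rewrite ler_wpM2r ?sqr_ge0 // ler_norm_sum.
  rewrite mulr_suml; apply: ler_sum => i _; case: (h i) => c c0 hc /=.
  rewrite normrM [`|u ^+ i|]ger0_norm ?exprn_ge0 ?(ltW u0) // -mulrA -exprD -mulrA.
  by rewrite ler_wpM2l // hc.
exists C => // t; rewrite /flat_exp; case: ltP => t0; last first.
  by rewrite normr0 mulr_ge0 // sqr_ge0.
have v0 : 0 < t^-1 by rewrite invr_gt0.
rewrite normrM [`|expR _|]gtr0_norm ?expR_gt0 // expRN.
rewrite ler_pdivrMr ?expR_gt0 // mulrAC -ler_pdivrMr ?exprn_gt0 //.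
by rewrite -exprVn; exact: hC.
Qed.

Lemma flat_exp_is_derive (q : {poly R}) (t : R) :
  is_derive (t : R^o) 1 (flat_exp q) (flat_exp ('X^2 * (q - q^`())) t).
Proof.
case: (ltgtP t 0) => t0.
- have E : \forall u \near t, (cst 0 : R -> R^o) u = flat_exp q u.
    near=> u; rewrite /flat_exp ltNge ltW //; near: u.
    by apply: open_nbhs_nbhs; split => //; exact: open_lt.
  apply: (near_eq_is_derive E).
  by rewrite /flat_exp ltNge ltW //=; exact: is_derive_cst.
- have E : \forall u \near t, (fun u : R => q.[u^-1] * expR (- u^-1) : R^o) u = flat_exp q u.
    near=> u; rewrite /flat_exp ifT //; near: u.
    by apply: open_nbhs_nbhs; split => //; exact: open_gt.
  apply: (near_eq_is_derive E); rewrite /flat_exp t0.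
  have tn0 : t != 0 by rewrite gt_eqF.
  have dV : is_derive (t : R^o) 1 (fun u : R => u^-1 : R^o) (- t ^- 2).
    have h := @is_deriveV _ (fun u : R => u) t 1 1 tn0 (is_derive_id _ _).
    by apply: is_derive_eq h _; rewrite scaler1.
  have dq : is_derive (t : R^o) 1 (fun u : R => q.[u^-1] : R^o) (q^`().[t^-1] * (- t ^- 2)).
    exact: (@is_derive1_comp _ (horner q) (fun u => u^-1) t _ _ (is_derive_poly _ _) dV).
  have de : is_derive (t : R^o) 1 (fun u : R => expR (- u^-1) : R^o) (expR (- t^-1) * (t ^- 2)).
    have := @is_derive1_comp _ expR (fun u : R => - u^-1) t _ _ (is_derive_expR _) (is_deriveN dV).
    by rewrite opprK.
  apply: is_derive_eq (is_deriveM dq de) _.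
  rewrite hornerM hornerXn hornerD hornerN -exprVn.
  rewrite -[LHS]/(_ * (_ * _) + _ * (_ * _)); ring.
- rewrite t0 {2}/flat_exp ltxx.
  have [C C0 hC] := flat_exp_bound q.
  have C1 : 0 < C + 1 by apply: ltr_wpDl.
  have f0 : flat_exp q 0 = 0 by rewrite /flat_exp ltxx.
  have lim0 : h^-1 *: ((flat_exp q \o shift 0) (h *: (1 : R^o)) - flat_exp q 0) @[h --> 0^'] --> (0 : R^o).
    apply/cvgrPdist_le => e e0; near=> h.
    rewrite /= f0 subr0 addr0 [h *: 1]mulr1 sub0r normrN normrZ.
    apply: (@le_trans _ _ (`|h^-1| * (C * h ^+ 2))).
      by rewrite ler_wpM2l.
    rewrite normfV -[h ^+ 2]ger0_norm ?sqr_ge0 // normrX mulrCA.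
    rewrite expr2 mulKf ?normr_eq0; last by near: h; exact: nbhs_dnbhs_neq.
    apply: (@le_trans _ _ ((C + 1) * `|h|)); first by rewrite ler_wpM2r // lerDl.
    rewrite mulrC -ler_pdivlMr //; near: h; apply: dnbhs0_le.
    by rewrite divr_gt0.
  split; first by apply/cvg_ex; exists 0.
  exact: cvg_lim lim0.
Unshelve. all: by end_near. Qed.

End FlatExponential.

Section Cutoff.
Variables (R : realType) (n : nat).

Lemma ipartial_cst0 (s : seq 'I_n) : ipartial s (cst (0 : R^o)) = cst 0 :> ('rV[R]_n -> R^o).
Proof.
elim: s => [//|i s IH]; rewrite -[LHS]/('D_(delta_mx 0 i) (ipartial s (cst 0))) IH.
by apply/funext => x; rewrite derive_cst.
Qed.

Lemma unit_ball_compact : compact (closed_ball (0 : 'rV[R]_n) 1).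
Proof.
apply: bounded_closed_compact; last exact: closed_ball_closed.
exists 1; split; first exact: real1.
move=> M M1 x; rewrite closed_ballE //= /closed_ball_ /= sub0r normrN => x1.
by apply: (le_trans x1); exact: ltW.
Qed.

Lemma flat_exp_smooth (g : 'rV[R]_n -> R^o) (U : set 'rV[R]_n) : open U ->
  smooth_on U g -> smooth_on U (fun x => flat_exp 1 (g x)).
Proof.
move=> oU sg.
pose q k := iter k (fun q : {poly R} => 'X^2 * (q - q^`())) 1.
apply: (@smooth_comp_1d R n (fun k => flat_exp (q k)) setT g U openT oU) => //.
by move=> k t _; exact: flat_exp_is_derive.
Qed.

Lemma flat_exp1_gt0 (t : R) : 0 < t -> 0 < flat_exp 1 t.
Proof. by move=> t0; rewrite /flat_exp t0 hornerC mul1r expR_gt0. Qed.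

Lemma flat_exp_eq0 (q : {poly R}) (t : R) : t <= 0 -> flat_exp q t = 0.
Proof. by move=> t0; rewrite /flat_exp ltNge t0. Qed.

Lemma flat_exp1_ge0 (t : R) : 0 <= flat_exp 1 t.
Proof.
by have [/flat_exp1_gt0/ltW//|t0] := ltP 0 t; rewrite flat_exp_eq0.
Qed.

(** With b(t) = exp(-1/t) for t > 0 and q the square of the Euclidean norm, take
    b(1 - q) / (b(1 - q) + b(q - 1/4)); one of the two terms of the denominator is
    always positive. The derivatives are bounded since they vanish off the unit
    ball, which is compact. *)
Lemma bump_exists : exists chi : 'rV[R]_n -> R^o,
  [/\ smooth_on setT chi,
      exists2 rho : R, 0 < rho & forall x, `|x| <= rho -> chi x = 1,
      forall x, 1 <= `|x| -> chi x = 0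
    & forall s, exists C, forall x, `|ipartial s chi x| <= C].
Proof.
pose q (x : 'rV[R]_n) : R^o := \sum_(i < n) x 0 i * x 0 i.
have q_ge (x : 'rV[R]_n) (i : 'I_n) : x 0 i * x 0 i <= q x.
  rewrite /q (bigD1 i) //= lerDl; apply: sumr_ge0 => j _; exact: sqr_ge0.
pose num x := flat_exp 1 (1 - q x); pose den x := num x + flat_exp 1 (q x - 1/4).
have den0 x : 0 < den x.
  have [h|h] := ltP (q x) 1.
    by apply: ltr_wpDr; [exact: flat_exp1_ge0|apply: flat_exp1_gt0; lra].
  by apply: ltr_wpDl; [exact: flat_exp1_ge0|apply: flat_exp1_gt0; lra].
have sq : smooth_on setT q.
  apply: smooth_on_sum => [|i]; first exact: openT.
  by apply: (Leibniz openT _ _).1; apply: smooth_on_coord; exact: openT.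
have snum : smooth_on setT num.
  apply: flat_exp_smooth; first exact: openT.
  apply: (smooth_on_eq openT) (smooth_onD openT (smooth_on_cst 1 openT) (smooth_onZ (-1) openT sq)).
  by move=> x _; rewrite mulN1r.
have sden : smooth_on setT den.
  apply: (smooth_onD openT snum); apply: flat_exp_smooth; first exact: openT.
  exact: (smooth_onD openT sq (smooth_on_cst (- (1/4)) openT)).
pose chi x : R^o := num x * (den x)^-1.
have schi : smooth_on setT chi.
  apply: (Leibniz openT snum _).1; exact: (smooth_on_inv openT _ sden).
have chi0 x : 1 <= `|x| -> chi x = 0.
  move=> x1; rewrite /chi /num flat_exp_eq0 ?mul0r // subr_le0 leNgt.
  apply/negP => qx; move: x1; rewrite leNgt => /negP; apply.
  have h i : `|x 0 i| < 1.
    rewrite -(@ltr_pXn2r _ 2) ?nnegrE // expr1n -normrX ger0_norm ?sqr_ge0 //.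
    by apply: le_lt_trans qx; rewrite expr2.
  rewrite /Num.Def.normr /= mx_normrE bigmax_lt // => -[i j] _ /=.
  by rewrite (ord1 i).
exists chi; split=> //.
- have r0 : 0 < (2 * n.+1%:R)^-1 :> R by rewrite invr_gt0 mulr_gt0.
  exists (2 * n.+1%:R)^-1 => // x xr.
  have q4 : q x <= 1/4.
    apply: (@le_trans _ _ (\sum_(i < n) ((2 * n.+1%:R)^-1 * 2^-1 : R))).
      apply: ler_sum => i _; apply: (le_trans (ler_norm _)); rewrite normrM.
      have xi : `|x 0 i| <= (2 * n.+1%:R)^-1 by apply: le_trans xr; exact: rV_coord_le.
      apply: ler_pM => //; apply: (le_trans xi).
      by rewrite lef_pV2 ?posrE ?mulr_gt0 // ler_peMr // ler1n.
    have n1 : n%:R / n.+1%:R <= 1 :> R by rewrite ler_pdivrMr // mul1r ler_nat.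
    rewrite sumr_const card_ord -[_ *+ n]mulr_natl invfM.
    have -> : n%:R * (2^-1 / n.+1%:R / 2) = (n%:R / n.+1%:R) / 4 :> R.
      by field; rewrite addrC natr1 pnatr_eq0.
    by rewrite ler_pdivrMr // mul1r mulVf.
  rewrite /chi /den [X in _ / (_ + X)]flat_exp_eq0 ?addr0; last lra.
  by rewrite divff // gt_eqF // flat_exp1_gt0; lra.
- move=> s.
  have ne : closed_ball (0 : 'rV[R]_n) 1 !=set0 by exists 0; exact: closed_ballxx.
  have cs : {within closed_ball (0 : 'rV[R]_n) 1, continuous (fun x => `|ipartial s chi x|)}.
    apply: continuous_subspaceT => x.
    exact: (cvg_norm (smooth_on_cont (s := s) schi I)).
  have [x0 _ hx0] := compact_EVT_max ne unit_ball_compact cs.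
  exists `|ipartial s chi x0| => x.
  have [x1|x1] := leP `|x| 1.
    by rewrite hx0 // inE closed_ballE //= /closed_ball_ /= sub0r normrN.
  pose U := [set x : 'rV[R]_n | 1 < `|x|].
  have oU : open U.
    by apply: (open_comp (f := fun x : 'rV[R]_n => `|x|) _ (@open_gt R 1)) => y _; exact: norm_continuous.
  rewrite (@ipartial_eq_on _ _ U chi (cst 0)) // => [|y y1].
    by rewrite ipartial_cst0 normr0.
  exact/chi0/ltW.
Qed.

Lemma ipartial_scale (chi : 'rV[R]_n -> R^o) (c : R) (w : 'rV[R]_n) :
  smooth_on setT chi ->
  smooth_on setT (fun x => chi (c *: x + w)) /\
  forall s x, ipartial s (fun x => chi (c *: x + w)) x =
    c ^+ size s * ipartial s chi (c *: x + w).
Proof.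
move=> sc.
have := @smooth_on_formula R n setT (fun x => chi (c *: x + w))
  (fun s x => c ^+ size s * ipartial s chi (c *: x + w)) openT.
have dphi x i j : is_derive x (delta_mx 0 i) (fun y : 'rV[R]_n => (c *: y + w) 0 j : R^o)
    (c * (j == i)%:R).
  rewrite (_ : (fun _ => _) = c *: (fun y : 'rV[R]_n => y 0 j : R^o) + cst (w 0 j)).
    apply: is_derive_eq (is_deriveD (is_deriveZ c (coord_is_derive _ _ _)) (is_derive_cst _ _ _)) _.
    by rewrite addr0 mxE eqxx.
  by apply/funext => y; rewrite !mxE.
case=> [x _|s x _|s i x _|h1 h2].
- by rewrite mul1r.
- have cphi : {for x, continuous (fun y : 'rV[R]_n => c *: y + w)}.
    apply: (@rV_cvg _ _ (nbhs x)) => j.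
    have [d _] := dphi x j j.
    rewrite !mxE; under eq_fun do rewrite !mxE.
    have cj : (fun y : 'rV[R]_n => y 0 j : R^o) @ x --> (x 0 j : R^o) by exact: coord_continuous.
    by apply: (cvgD (cvgM (cvg_cst c) cj) (cvg_cst _)).
  apply: continuous_mul_at; first exact: cst_continuous.
  by apply: continuous_comp; [exact: cphi|exact: smooth_on_cont sc _].
- have C1c : C1_at (ipartial s chi) (c *: x + w) := smooth_on_C1 s openT sc I.
  have dd j : derivable (fun y : 'rV[R]_n => (c *: y + w) 0 j : R^o) x (delta_mx 0 i).
    by case: (dphi x i j).
  have D := chain_rule (phi := fun y : 'rV[R]_n => c *: y + w) C1c dd.
  apply: is_derive_eq (is_deriveZ (c ^+ size s) D) _.
  rewrite (bigD1 i) //= big1 ?addr0 => [|k ki].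
    rewrite (@derive_val _ _ _ _ _ _ _ (dphi x i i)) eqxx mulr1.
    by rewrite -[LHS]/(_ * (_ * _)) exprSr -mulrA; congr (_ * _); rewrite mulrC.
  by rewrite (@derive_val _ _ _ _ _ _ _ (dphi x i k)) (negPf ki) !mulr0.
- by split=> // s x; exact: h2.
Qed.

End Cutoff.

(** * Flat functions *)

Section Vanishing.
Variables (R : realType) (T : eqType).

(** Uniform convergence to 0 on sets that may shrink with the parameter. *)
Definition vanishing (D : R -> set T) (F : R -> T -> R) :=
  forall e, 0 < e -> \forall r \near (0 : R)^'+, forall x, D r x -> `|F r x| <= e.

Lemma vanishing_sum (I : eqType) (l : seq I) D (F : I -> R -> T -> R) :
  (forall i, i \in l -> vanishing D (F i)) ->
  vanishing D (fun r x => \sum_(i <- l) F i r x).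
Proof.
elim: l => [_|i l IH h] e e0.
  by near=> r => x _; rewrite big_nil normr0 ltW.
have e2 : 0 < e / 2 by rewrite divr_gt0.
have h1 := h i (mem_head _ _) _ e2.
have h2 := IH (fun j jl => h j (mem_behead (s := i :: l) jl)) _ e2.
near=> r => x Dx; rewrite big_cons; apply: (le_trans (ler_normD _ _)).
by rewrite (splitr e) lerD //; move: x Dx; near: r.
Unshelve. all: by end_near. Qed.

Lemma vanishing_mul D (F G : R -> T -> R) (C : R) :
  (\forall r \near (0 : R)^'+, forall x, D r x -> `|F r x| <= C) ->
  vanishing D G -> vanishing D (fun r x => F r x * G r x).
Proof.
move=> hF hG e e0; have C1 : 0 < `|C| + 1 by rewrite ltr_wpDl.
have e2 : 0 < e / (`|C| + 1) by rewrite divr_gt0.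
have h := hG _ e2; near=> r => x Dx; rewrite normrM.
apply: (@le_trans _ _ ((`|C| + 1) * (e / (`|C| + 1)))); last first.
  by rewrite mulrC divfK // gt_eqF.
apply: ler_pM => //; last by move: x Dx; near: r.
apply: (@le_trans _ _ C); first by move: x Dx; near: r.
by apply: (le_trans (ler_norm C)); rewrite lerDl.
Unshelve. all: by end_near. Qed.

End Vanishing.

Section FlatFunctions.
Variables (R : realType) (n : nat).
Implicit Types (f : 'rV[R]_n -> R^o) (a : 'rV[R]_n).

Definition flat_at N f a := forall t : seq 'I_n, (size t <= N)%N -> ipartial t f a = 0.

(** Taylor's estimate without Taylor's formula: descending induction on the order
    of the derivative, each step being the mean value theorem along the segment
    from [a] to [x]. *)
Lemma flat_estimate U f a N : open U -> U a -> smooth_on U f -> flat_at N f a ->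
  forall k t, (size t + k = N.+1)%N ->
  exists C, \forall x \near a, `|ipartial t f x| <= C * `|x - a| ^+ k.
Proof.
move=> oU Ua sf flat; elim=> [|k IH] t tk.
  have /cvgrPdist_le /(_ _ ltr01) h := smooth_on_cont (s := t) sf Ua.
  exists (`|ipartial t f a| + 1); near=> x.
  rewrite expr0 mulr1 -[ipartial t f x](subrK (ipartial t f a)) addrC.
  apply: (le_trans (ler_normD _ _)); rewrite lerD2l distrC; near: x; exact: h.
have fta : ipartial t f a = 0.
  by apply: flat; move: tk; rewrite addnS => -[<-]; rewrite leq_addr.
have {}IH i : {C | \forall x \near a, `|ipartial (i :: t) f x| <= C * `|x - a| ^+ k}.
  by apply: cid; apply: IH; rewrite /= addSnnS.
pose C := \sum_i `|sval (IH i)|; exists C.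
have hC i : \forall x \near a, `|ipartial (i :: t) f x| <= `|sval (IH i)| * `|x - a| ^+ k.
  have := svalP (IH i); apply: filterS => x; move/le_trans; apply.
  by rewrite ler_wpM2r ?exprn_ge0 // ler_norm.
have hall : \forall x \near a, forall i, `|ipartial (i :: t) f x| <= `|sval (IH i)| * `|x - a| ^+ k.
  exact: (@filter_forall _ 'I_n (fun i x => `|ipartial (i :: t) f x| <= `|sval (IH i)| * `|x - a| ^+ k) (nbhs a) _ hC).
have nU : \forall x \near a, U x /\ forall i, `|ipartial (i :: t) f x| <= `|sval (IH i)| * `|x - a| ^+ k.
  by near=> x; split; near: x; [exact: open_nbhs_nbhs|exact: hall].
have [r /= r0 hr] := (nbhs_ballP _ _).1 nU.
have hr' x : `|x - a| < r -> U x /\ forall i, `|ipartial (i :: t) f x| <= `|sval (IH i)| * `|x - a| ^+ k.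
  by move=> xr; apply: hr; rewrite -ball_normE /= distrC.
apply/nbhs_ballP; exists r => //= x; rewrite -ball_normE /= distrC => xr.
set v := x - a; have inb s : `|s| <= `|1 : R| -> `|a + s *: v - a| <= `|v|.
  rewrite normr1 [a + _]addrC addrK normrZ => s1.
  by rewrite -[leRHS]mul1r ler_wpM2r.
have C1 s : `|s| <= `|1 : R| -> C1_at (ipartial t f) (a + s *: v).
  move=> s1; apply: (smooth_on_C1 _ oU sf); apply: (hr' _ _).1.
  exact: le_lt_trans (inb s s1) xr.
have [|s s1] := @MVT_line R _ (ipartial t f) a v 1.
  by move=> s s1; apply: diff_derivable; case: (C1_differentiable (C1 s s1)).
have [df dE] := C1_differentiable (C1 s s1).
rewrite mul1r scale1r fta subr0 (deriveE _ df) dE.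
have -> : a + v = x by rewrite /v addrC subrK.
move=> ->; apply: (le_trans (ler_norm_sum _ _ _)).
rewrite /C mulr_suml; apply: ler_sum => i _.
have [_ /(_ i) hi] := hr' _ (le_lt_trans (inb s s1) xr).
rewrite normrM exprS mulrCA; apply: ler_pM => //; first exact: rV_coord_le.
apply: (le_trans hi); rewrite ler_wpM2l // lerXn2r ?nnegrE //; exact: inb.
Unshelve. all: by end_near. Qed.

Definition cutoff (chi : 'rV[R]_n -> R^o) a (r : R) : 'rV[R]_n -> R^o :=
  fun x => chi (r^-1 *: x - r^-1 *: a).

(** By the Leibniz rule a derivative of order [size s] of the product is a sum of
    terms of size at most a constant times r^-i r^(N + 1 - j) with
    i + j = size s <= N. *)
Lemma cutoff_flat chi U f a N s : smooth_on setT chi ->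
  (forall s, exists C, forall x, `|ipartial s chi x| <= C) ->
  open U -> U a -> smooth_on U f -> flat_at N f a -> (size s <= N)%N ->
  vanishing (fun r => [set x | `|x - a| <= r])
    (fun r => ipartial s (fun x => cutoff chi a r x * f x)).
Proof.
move=> schi bchi oU Ua sf flat sN.
have [r0 r00 hU] : exists2 r0, 0 < r0 & forall x, `|x - a| < r0 -> U x.
  have [r0 /= r00 h] := (nbhs_ballP _ _).1 (open_nbhs_nbhs (conj oU Ua)).
  by exists r0 => // x xr; apply: h; rewrite -ball_normE /= distrC.
suff h : vanishing (fun r => [set x | `|x - a| <= r]) (fun r x =>
    \sum_(p <- splits s) r^-1 ^+ size p.1 * ipartial p.1 chi (r^-1 *: x - r^-1 *: a)
       * ipartial p.2 f x).
  move=> e e0; have he := h e e0.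
  near=> r => x /= xr.
  have Ux : U x by apply: hU; apply: (le_lt_trans xr); near: r; exact: nbhs_right_lt.
  have [sc Ec] := ipartial_scale r^-1 (- (r^-1 *: a)) schi.
  rewrite ((Leibniz oU (smooth_onS (@subsetT _ U) sc) sf).2 s x Ux).
  under eq_bigr do rewrite Ec.
  by move: x xr {Ux}; near: r.
apply: vanishing_sum => p ps; have ss := splits_size ps.
have [C hC] := bchi p.1.
have [|D hD] := flat_estimate oU Ua sf flat (k := N.+1 - size p.2) (t := p.2).
  by rewrite subnKC // ltnW // ltnS (leq_trans _ sN) // -ss leq_addl.
have [r1 r10 hD'] : exists2 r1, 0 < r1 & forall x, `|x - a| < r1 ->
     `|ipartial p.2 f x| <= D * `|x - a| ^+ (N.+1 - size p.2).
  have [r1 /= r10 h] := (nbhs_ballP _ _).1 hD.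
  by exists r1 => // x xr; apply: h; rewrite -ball_normE /= distrC.
move=> e e0.
(* At least one power of [r] is left over after the cutoff has consumed [size p.1] of them. *)
have pE : (N.+1 - size p.2 = size p.1 + (N - size s).+1)%N.
  by move: sN; rewrite -ss; lia.
have CD0 : 0 < `|C| * `|D| + 1 by rewrite ltr_wpDl // mulr_ge0.
near=> r => x /= xr.
have rp : 0 < r by near: r; exact: nbhs_right_gt.
have rle1 : r <= 1 by near: r; exact: nbhs_right_le.
have hx : `|ipartial p.2 f x| <= `|D| * r ^+ (N.+1 - size p.2).
  apply: le_trans (hD' x _) _.
    by apply: (le_lt_trans xr); near: r; exact: nbhs_right_lt.
  apply: (@le_trans _ _ (`|D| * `|x - a| ^+ (N.+1 - size p.2))).
    by rewrite ler_wpM2r ?exprn_ge0 // ler_norm.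
  by rewrite ler_wpM2l // lerXn2r // nnegrE // ltW.
have rs0 : 0 <= r^-1 ^+ size p.1 by rewrite exprn_ge0 // invr_ge0 ltW.
rewrite !normrM [`|r^-1 ^+ _|]ger0_norm //.
apply: (@le_trans _ _ (r^-1 ^+ size p.1 * `|C| * (`|D| * r ^+ (N.+1 - size p.2)))).
  apply: ler_pM => //; first by rewrite mulr_ge0.
  by rewrite ler_wpM2l //; apply: (le_trans (hC _)); exact: ler_norm.
rewrite pE.
have -> : r^-1 ^+ size p.1 * `|C| * (`|D| * r ^+ (size p.1 + (N - size s).+1))
   = (`|C| * `|D|) * r ^+ (N - size s).+1.
  rewrite exprD exprVn; field; by rewrite expf_neq0 // gt_eqF.
apply: (@le_trans _ _ ((`|C| * `|D| + 1) * r)).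
  apply: ler_pM; rewrite ?mulr_ge0 ?exprn_ge0 ?(ltW rp) ?lerDl //.
  by rewrite exprS ler_piMr ?(ltW rp) // exprn_ile1 // ltW.
rewrite mulrC -ler_pdivlMr //; near: r; apply: nbhs_right_le.
by apply: divr_gt0; [exact: e0|exact: CD0].
Unshelve. all: by end_near. Qed.

End FlatFunctions.

(** * Smooth maps between manifolds *)

Section ManifoldCalculus.
Variable R : realType.

Lemma smooth_on_local n (U : set 'rV[R]_n) (f : 'rV[R]_n -> R^o) :
  (forall y, U y -> exists2 V, V y & smooth_on V f) -> smooth_on U f.
Proof. by move=> h s y /h[V Vy sf]; exact: sf. Qed.

Section OneManifold.
Variables (m : nat) (M : manifold R m).
Implicit Types (c d : chart R M m) (W V : set M) (g h : M -> R^o).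

Definition chart_img c W : set 'rV[R]_m := chart_map c @` (chart_dom c `&` W).

Lemma chart_imgP c W y : atlas c -> chart_img c W y <->
  [/\ chart_cod c y, W (chart_inv c y) & chart_dom c (chart_inv c y)].
Proof.
move=> Ac; have [_ _ cK _ _] := atlas_is_chart Ac; split=> [[x [cx Wx] <-]|].
  by rewrite cK //; split=> //; exists x.
move=> [[x cx <-]]; rewrite cK // => Wx _; by exists x.
Qed.

Lemma chart_codP c y : atlas c -> chart_cod c y ->
  chart_dom c (chart_inv c y) /\ chart_map c (chart_inv c y) = y.
Proof.
by move=> Ac; have [_ _ cK _ _] := atlas_is_chart Ac => -[x cx <-]; rewrite cK.
Qed.

Lemma chart_img_open c W : atlas c -> open W -> open (chart_img c W).
Proof.
move=> Ac oW; have [oc oc' cK cc ci] := atlas_is_chart Ac.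
rewrite openE => y /(chart_imgP _ _ Ac)[ycod Wy dy].
have h : \forall z \near y, W (chart_inv c z).
  by apply: (ci y ycod); exact: open_nbhs_nbhs.
have h' : nbhs y (chart_cod c) by exact: open_nbhs_nbhs.
rewrite /interior; near=> z; apply/(chart_imgP _ _ Ac).
have zc : chart_cod c z by near: z.
by split=> //; [near: z|have [] := chart_codP Ac zc].
Unshelve. all: by end_near. Qed.

Lemma chart_img_setT c : chart_img c setT = chart_cod c.
Proof. by rewrite /chart_img setIT. Qed.

(** Smoothness of a function which matters on [W] only, as do the coordinates of
    a map into a manifold. It unifies [smooth_fun] and [smooth_map]. *)
Definition smooth_near W g :=
  forall c, atlas c -> smooth_on (chart_img c W) (fun y => g (chart_inv c y)).

Lemma smooth_nearS W V g : V `<=` W -> smooth_near W g -> smooth_near V g.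
Proof.
move=> VW sg c Ac; apply: smooth_onS (sg c Ac).
by apply: image_subset => x [cx /VW].
Qed.

Lemma smooth_near_local W g :
  (forall p, W p -> exists2 V, V p & smooth_near V g) -> smooth_near W g.
Proof.
move=> h c Ac; apply: smooth_on_local => _ [x [cx /h[V Vx sg]] <-].
by exists (chart_img c V); [exists x|exact: sg].
Qed.

Lemma smooth_near_eq W g h : open W -> (forall p, W p -> g p = h p) ->
  smooth_near W g -> smooth_near W h.
Proof.
move=> oW gh sg c Ac; apply: smooth_on_eq (sg c Ac); first exact: chart_img_open.
by move=> y /(chart_imgP _ _ Ac)[_ /gh].
Qed.

Lemma smooth_near_cst W (k : R) : open W -> smooth_near W (cst k).
Proof. by move=> oW c Ac; apply: smooth_on_cst; exact: chart_img_open. Qed.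

Lemma smooth_nearD W g h : open W -> smooth_near W g -> smooth_near W h ->
  smooth_near W (fun p => g p + h p).
Proof.
move=> oW sg sh c Ac; apply: smooth_onD; [exact: chart_img_open|exact: sg|exact: sh].
Qed.

Lemma smooth_nearZ W (k : R) h : open W -> smooth_near W h ->
  smooth_near W (fun p => k * h p).
Proof.
move=> oW sh c Ac; apply: smooth_onZ; [exact: chart_img_open|exact: sh].
Qed.

Lemma smooth_nearM W g h : open W -> smooth_near W g -> smooth_near W h ->
  smooth_near W (fun p => g p * h p).
Proof.
move=> oW sg sh c Ac.
exact: (Leibniz (chart_img_open Ac oW) (sg c Ac) (sh c Ac)).1.
Qed.

End OneManifold.

Section Maps.
Variables (m n : nat) (M : manifold R m) (N : manifold R n).
Implicit Types (phi : M -> N) (g : N -> R^o).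

Definition in_charts (c : chart R M m) (d : chart R N n) phi : 'rV[R]_m -> 'rV[R]_n :=
  fun y => chart_map d (phi (chart_inv c y)).

(** [chain_terms] read in charts. *)
Lemma pullback_formula phi c d g (V : set N) :
  smooth_map phi -> atlas c -> atlas d -> open V ->
  smooth_on (chart_img d V) (fun z => g (chart_inv d z)) ->
  smooth_on (chart_img c (phi @^-1` (chart_dom d `&` V))) (fun y => g (phi (chart_inv c y))) /\
  forall s y, chart_img c (phi @^-1` (chart_dom d `&` V)) y ->
    ipartial s (fun y => g (phi (chart_inv c y))) y =
    \sum_(q <- chain_terms (in_charts c d phi) s)
       q.2 y * ipartial q.1 (fun z => g (chart_inv d z)) (in_charts c d phi y).
Proof.
move=> [cphi sphi] Ac Ad oV sg.
have [od _ dK _ _] := atlas_is_chart Ad.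
have oW : open (phi @^-1` (chart_dom d `&` V)).
  by apply: open_comp => [x _|]; [exact: cphi|exact: openI].
have oI := chart_img_open Ac oW; have oI' := chart_img_open Ad oV.
have E y : chart_img c (phi @^-1` (chart_dom d `&` V)) y ->
    ((fun z => g (chart_inv d z)) \o in_charts c d phi) y = g (phi (chart_inv c y)).
  by move=> /(chart_imgP _ _ Ac)[_ [dy _] _]; rewrite /= /in_charts dK.
have [||s1 s2] := @smooth_comp R m n (in_charts c d phi) (fun z => g (chart_inv d z))
   _ _ oI oI' _ _ sg.
- move=> y /(chart_imgP _ _ Ac)[_ [dy Vy] _]; apply/(chart_imgP _ _ Ad).
  by rewrite /in_charts dK //; split=> //; exists (phi (chart_inv c y)).
- move=> j; apply: smooth_onS (sphi c d Ac Ad j).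
  by apply: image_subset => x [cx [dx _]].
split; first exact: (smooth_on_eq oI E s1).
by move=> s y Iy; rewrite -(ipartial_eq_on s oI E Iy) s2.
Qed.

Lemma smooth_near_pullback phi g (V : set N) : smooth_map phi -> open V ->
  smooth_near V g -> smooth_near (phi @^-1` V) (g \o phi).
Proof.
move=> sphi oV sg c Ac; apply: smooth_on_local => _ [x [cx Vx] <-].
have [d Ad dx] := atlas_cover (phi x).
exists (chart_img c (phi @^-1` (chart_dom d `&` V))); first by exists x.
exact: (pullback_formula sphi Ac Ad oV (sg d Ad)).1.
Qed.

Lemma smooth_mapE phi : smooth_map phi <-> continuous phi /\
  forall d, atlas d -> forall j,
    smooth_near (phi @^-1` chart_dom d) (fun p => chart_map d (phi p) 0 j).
Proof.
split=> -[cphi h]; split=> //.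
  by move=> d Ad j c Ac; exact: h.
by move=> c d Ac Ad j; exact: (h d Ad j c Ac).
Qed.

Lemma smooth_map_cst (q : N) : smooth_map (fun _ : M => q).
Proof.
apply/smooth_mapE; split; first exact: cst_continuous.
move=> d Ad j.
have [qd|qd] := pselect (chart_dom d q).
  rewrite (_ : _ @^-1` _ = setT); last by apply/seteqP; split.
  exact: smooth_near_cst openT.
rewrite (_ : _ @^-1` _ = set0); last by apply/seteqP; split.
exact: smooth_near_cst open0.
Qed.

End Maps.

Lemma smooth_map_id m (M : manifold R m) : smooth_map (fun x : M => x).
Proof.
split; first by move=> x A.
by move=> c d Ac Ad j; exact: (atlas_compatible Ac Ad).
Qed.

Lemma smooth_map_comp l m n (L : manifold R l) (M : manifold R m) (N : manifold R n)
    (phi : L -> M) (psi : M -> N) :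
  smooth_map phi -> smooth_map psi -> smooth_map (psi \o phi).
Proof.
move=> sphi /smooth_mapE[cpsi spsi]; apply/smooth_mapE; split.
  by move=> x; apply: continuous_comp; [exact: sphi.1|exact: cpsi].
move=> d Ad j; have [od _ _ _ _] := atlas_is_chart Ad.
apply: (smooth_near_pullback sphi) (spsi d Ad j).
by apply: open_comp od => x _; exact: cpsi.
Qed.

Section ProductMaps.
Variables (m n : nat) (M : manifold R m) (N : manifold R n).

Lemma smooth_map_pair l (L : manifold R l) (phi : L -> M) (psi : L -> N) :
  smooth_map phi -> smooth_map psi ->
  smooth_map (fun x => (phi x, psi x) : prod_manifold M N).
Proof.
move=> /smooth_mapE[cphi sphi] /smooth_mapE[cpsi spsi]; apply/smooth_mapE; split.
  by move=> x; apply: (@cvg_pair _ _ _ (nbhs x)); [exact: cphi|exact: cpsi].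
move=> _ [c [d [Ac Ad ->]]] j; case: (split_ordP j) => k -> /=.
- rewrite (_ : (fun _ => _) = fun x => chart_map c (phi x) 0 k).
    by apply: smooth_nearS (sphi c Ac k) => x [].
  by apply/funext => x; rewrite row_mxEl.
- rewrite (_ : (fun _ => _) = fun x => chart_map d (psi x) 0 k).
    by apply: smooth_nearS (spsi d Ad k) => x [].
  by apply/funext => x; rewrite row_mxEr.
Qed.

Lemma smooth_map_fst : smooth_map (fun p : prod_manifold M N => p.1).
Proof.
split; first by move=> x; exact: cvg_fst.
move=> _ c' [c [d [Ac Ad ->]]] Ac' j /=.
apply: (@smooth_on_comp_lin R _ _ (@lsubmx R 1 m n) _ _
   (fun y => chart_map c' (chart_inv c y) 0 j) _ _ (atlas_compatible Ac Ac' j)).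
- exact: lsubmx_rV_continuous.
- exact: lsubmx_delta.
- by move=> _ [[x y] [[/= cx dy] cx'] <-]; rewrite row_mxKl; exists x.
Qed.

Lemma smooth_map_snd : smooth_map (fun p : prod_manifold M N => p.2).
Proof.
split; first by move=> x; exact: cvg_snd.
move=> _ d' [c [d [Ac Ad ->]]] Ad' j /=.
apply: (@smooth_on_comp_lin R _ _ (@rsubmx R 1 m n) _ _
   (fun y => chart_map d' (chart_inv d y) 0 j) _ _ (atlas_compatible Ad Ad' j)).
- exact: rsubmx_rV_continuous.
- exact: rsubmx_delta.
- by move=> _ [[x y] [[/= cx dy] dy'] <-]; rewrite row_mxKr; exists y.
Qed.

End ProductMaps.

End ManifoldCalculus.

(** * Scalar-valued smooth functions *)

Section Scalars.
Variables (R : realType) (k : scalar_kind).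
Local Notation K := (scalars R k).
Implicit Types (a u v : K).

(** The scalar with given real and imaginary parts; the latter is dropped over
    the real numbers. *)
Definition mkK (x y : R) : K :=
  match k return Num.NumField.sort (match k with
    RealScalars => R : numFieldType
  | ComplexScalars => complex.complex R : numFieldType end) with
  | RealScalars => x
  | ComplexScalars => complex.Complex x y
  end.

Lemma reK0 : reK (0 : K) = 0.
Proof. by rewrite /reK /scalars; case: k. Qed.
Lemma imK0 : imK (0 : K) = 0.
Proof. by rewrite /imK /scalars; case: k. Qed.

Lemma reKM a u : reK (a * u) = reK a * reK u - imK a * imK u.
Proof. by rewrite -[a * u]addr0 reK_lin reK0 addr0 mulNr. Qed.
Lemma imKM a u : imK (a * u) = reK a * imK u + imK a * reK u.
Proof. by rewrite -[a * u]addr0 imK_lin imK0 addr0. Qed.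

Lemma eqK u v : reK u = reK v -> imK u = imK v -> u = v.
Proof.
rewrite /reK /imK /scalars in u v *.
by case: k u v => [u v|[a b] [c d]] //= -> ->.
Qed.

Lemma mkK_re (x y : R) : reK (mkK x y) = x.
Proof. by rewrite /reK /mkK; case: k. Qed.

Lemma imK_real u : k = RealScalars -> imK u = 0.
Proof. by rewrite /imK /scalars in u *; case: k u. Qed.

Lemma mkK_imE (x y : R) : (k = RealScalars -> y = 0) -> imK (mkK x y) = y.
Proof. by rewrite /imK /mkK; case: k => // ->. Qed.

Lemma reKN1 : reK (-1 : K) = -1.
Proof. by rewrite /reK /scalars; case: k. Qed.
Lemma imKN1 : imK (-1 : K) = 0.
Proof. by rewrite /imK /scalars; case: k => //=; rewrite oppr0. Qed.

Lemma reKD u v : reK (u + v) = reK u + reK v.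
Proof. by rewrite /reK /scalars in u v *; case: k u v => [u v|[a b] [c d]]. Qed.
Lemma imKD u v : imK (u + v) = imK u + imK v.
Proof. by rewrite /imK /scalars in u v *; case: k u v => [u v|[a b] [c d]] //=; rewrite addr0. Qed.

Lemma reK_sum (I : Type) (l : seq I) (F : I -> K) :
  reK (\sum_(i <- l) F i) = \sum_(i <- l) reK (F i).
Proof. by elim: l => [|i l IH]; rewrite ?big_nil ?reK0 // !big_cons reKD IH. Qed.
Lemma imK_sum (I : Type) (l : seq I) (F : I -> K) :
  imK (\sum_(i <- l) F i) = \sum_(i <- l) imK (F i).
Proof. by elim: l => [|i l IH]; rewrite ?big_nil ?imK0 // !big_cons imKD IH. Qed.

Lemma reK_realM (x : R) u : reK (mkK x 0 * u) = x * reK u.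
Proof. by rewrite reKM mkK_re mkK_imE // mul0r subr0. Qed.
Lemma imK_realM (x : R) u : imK (mkK x 0 * u) = x * imK u.
Proof. by rewrite imKM mkK_re mkK_imE // mul0r addr0. Qed.

(** The modulus of a complex number is at most the sum of the absolute values of its
    real and imaginary parts. *)
Lemma nbhs_scalars (z : K^o) (A : set K^o) : nbhs z A ->
  exists2 r : R, 0 < r & forall w, `|reK (w - z)| < r -> `|imK (w - z)| < r -> A w.
Proof.
rewrite /reK /imK /scalars in z A *.
case: k z A => z A /nbhs_ballP[/= r r0 h].
  by exists r => // w wz _; apply: h; rewrite -ball_normE /= distrC.
case: r r0 h => r r' r0 h.
have [rp r'0] : 0 < r /\ r' = 0 by move: r0; rewrite ltcE /= => /andP[/eqP -> ->].
exists (r / 2); first by rewrite divr_gt0.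
move=> [a b] /=; case: z h => [c d] h ha hb; apply: h; rewrite -ball_normE /= distrC.
rewrite r'0 normc_def /= ltcR -[X in _ < X]ger0_norm ?(ltW rp) // -sqrtr_sqr.
rewrite ltr_sqrt ?exprn_gt0 //.
have sq_lt x : `|x| < r / 2 -> x ^+ 2 < (r / 2) ^+ 2.
  move=> xr; rewrite -[x ^+ 2]ger0_norm ?sqr_ge0 // normrX.
  by rewrite ltrXn2r // nnegrE // ltW // divr_gt0.
have := sq_lt (a - c) ha; have := sq_lt (b - d) hb.
have -> : (r / 2) ^+ 2 = r ^+ 2 / 4 by field.
have := exprn_gt0 2 rp; lra.
Qed.

End Scalars.

Section SmoothFunctionAlgebra.
Variables (R : realType) (k : scalar_kind).
Local Notation K := (scalars R k).

Section Basic.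
Variables (n : nat) (M : manifold R n).
Implicit Types (f g : M -> K^o).

Lemma smooth_funE f : smooth_fun f <->
  smooth_near setT (fun p => reK (f p)) /\ smooth_near setT (fun p => imK (f p)).
Proof.
rewrite /smooth_near; split=> [h|[h1 h2] c Ac].
  by split=> c Ac; rewrite chart_img_setT; have [] := h c Ac.
by rewrite -chart_img_setT; split; [exact: h1|exact: h2].
Qed.

Lemma smooth_fun_cst (a : K^o) : smooth_fun (fun _ : M => a).
Proof. by apply/smooth_funE; split; apply: smooth_near_cst openT. Qed.

Lemma smooth_funM f g : smooth_fun f -> smooth_fun g ->
  smooth_fun (fun p => f p * g p : K^o).
Proof.
move=> /smooth_funE[rf if_] /smooth_funE[rg ig]; apply/smooth_funE; split.
- apply: (smooth_near_eq openT) (smooth_nearD openT (smooth_nearM openT rf rg)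
    (smooth_nearZ (-1) openT (smooth_nearM openT if_ ig))) => p _.
  by rewrite reKM mulN1r.
- apply: (smooth_near_eq openT) (smooth_nearD openT (smooth_nearM openT rf ig)
    (smooth_nearM openT if_ rg)) => p _.
  by rewrite imKM.
Qed.

Lemma smooth_fun_lin (a : K) f g : smooth_fun f -> smooth_fun g ->
  smooth_fun (a *: f + g).
Proof.
move=> sf sg; have [_ h] := @smooth_submod_closed R k n M.
exact: (asboolW (h a f g (asboolT sf) (asboolT sg))).
Qed.

Lemma smooth_fun_sum (I : eqType) (l : seq I) (F : I -> M -> K^o) :
  (forall i, smooth_fun (F i)) -> smooth_fun (fun p => \sum_(i <- l) F i p : K^o).
Proof.
move=> sF; elim: l => [|i l IH].
  rewrite (_ : (fun _ => _) = fun _ => 0); first exact: smooth_fun_cst.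
  by apply/funext => p; rewrite big_nil.
rewrite (_ : (fun _ => _) = 1 *: F i + (fun p => \sum_(i <- l) F i p : K^o)).
  exact: smooth_fun_lin.
by apply/funext => p; rewrite big_cons scale1r.
Qed.

Lemma mkCinfE f : smooth_fun f -> val (mkCinf f) = f.
Proof. by move=> sf; rewrite /mkCinf insubdK //; exact: (asboolT sf). Qed.

Lemma Cinf_smooth (f : Cinf k M) : smooth_fun (val f).
Proof. exact: (asboolW (valP f)). Qed.

Lemma Cinf_linE (a : K) (f g : Cinf k M) : val (a *: f + g) = a *: val f + val g.
Proof. by rewrite GRing.valD GRing.valZ. Qed.

End Basic.

Lemma smooth_fun_pullback m n (M : manifold R m) (N : manifold R n) (phi : M -> N)
    (f : N -> K^o) : smooth_map phi -> smooth_fun f -> smooth_fun (f \o phi).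
Proof.
move=> sphi /smooth_funE[rf if_]; apply/smooth_funE; split.
  exact: (smooth_near_pullback sphi openT rf).
exact: (smooth_near_pullback sphi openT if_).
Qed.

End SmoothFunctionAlgebra.

(** * Partial derivatives at a point as distributions *)

Section ChartPartials.
Variables (R : realType) (k : scalar_kind) (n : nat) (M : manifold R n).
Local Notation K := (scalars R k).
Implicit Types (c : chart R M n) (s : seq 'I_n) (p : M) (f g : M -> K^o).

Definition chart_partial c s p f : K^o :=
  mkK k (ipartial s (fun y => reK (f (chart_inv c y))) (chart_map c p))
        (ipartial s (fun y => imK (f (chart_inv c y))) (chart_map c p)).

Lemma chart_partial_re c s p f : reK (chart_partial c s p f) =
  ipartial s (fun y => reK (f (chart_inv c y))) (chart_map c p).
Proof. exact: mkK_re. Qed.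

Lemma chart_partial_im c s p f : imK (chart_partial c s p f) =
  ipartial s (fun y => imK (f (chart_inv c y))) (chart_map c p).
Proof.
apply: mkK_imE => kE; rewrite (_ : (fun _ => _) = cst 0) ?ipartial_cst0 //.
by apply/funext => y; rewrite imK_real.
Qed.

Lemma ipartial_re_lin c s (a : K) f g y : atlas c -> chart_cod c y ->
  smooth_fun f -> smooth_fun g ->
  ipartial s (fun z => reK ((a *: f + g) (chart_inv c z))) y =
  reK a * ipartial s (fun z => reK (f (chart_inv c z))) y
  + (- imK a * ipartial s (fun z => imK (f (chart_inv c z))) y
     + ipartial s (fun z => reK (g (chart_inv c z))) y).
Proof.
move=> Ac cy sf sg; have [_ oc _ _ _] := atlas_is_chart Ac.
have [rf if_] := sf c Ac; have [rg _] := sg c Ac.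
have [s1 E1] := smooth_on_lin (- imK a) oc if_ rg.
have [_ E2] := smooth_on_lin (reK a) oc rf s1.
rewrite -(E1 s y cy) -(E2 s y cy); congr (ipartial s _ y).
by apply/funext => z; rewrite -reK_lin.
Qed.

Lemma ipartial_im_lin c s (a : K) f g y : atlas c -> chart_cod c y ->
  smooth_fun f -> smooth_fun g ->
  ipartial s (fun z => imK ((a *: f + g) (chart_inv c z))) y =
  reK a * ipartial s (fun z => imK (f (chart_inv c z))) y
  + (imK a * ipartial s (fun z => reK (f (chart_inv c z))) y
     + ipartial s (fun z => imK (g (chart_inv c z))) y).
Proof.
move=> Ac cy sf sg; have [_ oc _ _ _] := atlas_is_chart Ac.
have [rf if_] := sf c Ac; have [rg ig] := sg c Ac.
have [s1 E1] := smooth_on_lin (imK a) oc rf ig.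
have [_ E2] := smooth_on_lin (reK a) oc if_ s1.
rewrite -(E1 s y cy) -(E2 s y cy); congr (ipartial s _ y).
by apply/funext => z; rewrite -imK_lin.
Qed.

Lemma chart_partial_lin c s p (a : K) f g : atlas c -> chart_dom c p ->
  smooth_fun f -> smooth_fun g ->
  chart_partial c s p (a *: f + g) = a *: chart_partial c s p f + chart_partial c s p g.
Proof.
move=> Ac cp sf sg; have cy : chart_cod c (chart_map c p) by exists p.
apply: eqK.
  by rewrite reK_lin !chart_partial_re chart_partial_im ipartial_re_lin.
by rewrite imK_lin !chart_partial_im chart_partial_re ipartial_im_lin.
Qed.

Lemma chart_partial_local c s p f g (V : set M) : atlas c -> chart_dom c p ->
  open V -> V p -> (forall x, V x -> f x = g x) ->
  chart_partial c s p f = chart_partial c s p g.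
Proof.
move=> Ac cp oV Vp fg; have oI := chart_img_open Ac oV.
have Ip : chart_img c V (chart_map c p) by exists p.
have E y : chart_img c V y -> f (chart_inv c y) = g (chart_inv c y).
  by move=> /(chart_imgP _ _ Ac)[_ /fg].
rewrite /chart_partial; congr mkK; apply: (ipartial_eq_on s oI _ Ip) => y /E -> //.
Qed.

Lemma chart_partial_cst0 c s p : chart_partial c s p (fun _ => 0) = 0.
Proof.
apply: eqK; rewrite ?chart_partial_re ?chart_partial_im ?reK0 ?imK0;
  by rewrite (_ : (fun _ => _) = cst 0) ?ipartial_cst0 //; apply/funext => y;
     rewrite ?reK0 ?imK0.
Qed.

Lemma Cinf_subE (f g : Cinf k M) : val (g - f) = -1 *: val f + val g.
Proof. by rewrite GRing.valB scaleN1r addrC. Qed.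

Lemma Cinf_ball_nbhs c (Q : set 'rV[R]_n) s (f : Cinf k M) (r : R) :
  atlas c -> compact Q -> Q `<=` chart_cod c -> 0 < r ->
  nbhs f (Cinf_ball c Q s f r).
Proof.
move=> Ac cQ Qc r0; apply: open_nbhs_nbhs; split.
  exists [set Cinf_ball c Q s f r]; last by rewrite bigcup_set1.
  move=> _ ->; apply: finI_from1; exists c, Q, s, f, r; split=> //.
move=> y Qy; rewrite subrr GRing.val0.
by split; rewrite (_ : (fun _ => _) = cst 0) ?ipartial_cst0 ?normr0 //;
  apply/funext => z; rewrite ?reK0 ?imK0.
Qed.

(** The topology being given by a subbase, a neighbourhood contains a finite
    intersection of members of the subbase; these need not be centred at [f]. *)
Lemma Cinf_nbhs (f : Cinf k M) (A : set (Cinf k M)) : nbhs f A ->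
  exists2 E : seq (set (Cinf k M)), (forall B, B \in E -> Cinf_subbase B /\ B f) &
    forall g : Cinf k M, (forall B, B \in E -> B g) -> A g.
Proof.
move=> [_ [[D' sD' <-] [i D'i fi] sA]].
have [E sE iE] := sD' _ D'i.
exists (finmap.enum_fset E) => [B BE|g hg].
  split; first exact: (set_mem (sE B BE)).
  by have : i f by []; rewrite -iE; apply.
have ig : i g by rewrite -iE => B BE; exact: hg.
by apply: sA; exists i.
Qed.

(** Continuity comes from the subbasic neighbourhoods that measure the derivative
    of multi-index [s] on the compact set consisting of the single point
    [chart_map c p]. *)
Lemma chart_partial_distribution c s p : atlas c -> chart_dom c p ->
  point_distribution p (fun f : Cinf k M => chart_partial c s p (val f)).
Proof.
move=> Ac cp.
have lin : linear (fun f : Cinf k M => chart_partial c s p (val f)).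
  by move=> a f g; rewrite Cinf_linE chart_partial_lin //; exact: Cinf_smooth.
split=> //.
- move=> f A /nbhs_scalars[r r0 hr].
  have cQ : compact [set chart_map c p] by exact: compact_set1.
  have sQ : [set chart_map c p] `<=` chart_cod c by move=> _ ->; exists p.
  apply: filterS (Cinf_ball_nbhs s f Ac cQ sQ r0) => g /(_ _ erefl)[h1 h2].
  (* Differentiation commutes with the difference that defines the ball. *)
  have E : chart_partial c s p (val g) - chart_partial c s p (val f) =
      chart_partial c s p (val (g - f)).
    by rewrite [g - f]addrC -[- f]scaleN1r (lin (-1) f g) scaleN1r addrC.
  by apply: hr; rewrite E ?chart_partial_re ?chart_partial_im.
- move=> f nf.
  have [V [oV Vp] hV] : exists2 V, open_nbhs p V & forall x, V x -> val f x = 0.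
    exists (~` fun_support f); first by split=> //; apply: closed_openC; exact: closed_closure.
    move=> x nx; apply: contrapT => /eqP fx; apply: nx; exact: subset_closure.
  by rewrite (chart_partial_local s Ac cp oV Vp hV) chart_partial_cst0.
Qed.

End ChartPartials.

(** * Cutting off near a point of a manifold *)

Section ManifoldCutoff.
Variables (R : realType) (n : nat) (M : manifold R n).
Variables (c : chart R M n) (p : M) (chi : 'rV[R]_n -> R^o) (rho : R).
Hypotheses (Ac : atlas c) (cp : chart_dom c p) (rho0 : 0 < rho).
Hypothesis rho_cod : closed_ball (chart_map c p) rho `<=` chart_cod c.
Hypotheses (schi : smooth_on setT chi)
  (chi1 : exists2 r1 : R, 0 < r1 & forall x, `|x| <= r1 -> chi x = 1)
  (chi0 : forall x, 1 <= `|x| -> chi x = 0)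
  (bchi : forall s, exists C, forall x, `|ipartial s chi x| <= C).
Let a := chart_map c p.

(** Compatibility of the charts: smoothness needs to be tested in one chart
    only. *)
Lemma smooth_near_chart (V : set M) (g : M -> R^o) : open V -> V `<=` chart_dom c ->
  smooth_on (chart_img c V) (fun y => g (chart_inv c y)) -> smooth_near V g.
Proof.
move=> oV Vc sg d Ad.
have [s _] := pullback_formula (smooth_map_id M) Ad Ac oV sg.
by apply: smooth_onS s; apply: image_subset => x [dx Vx]; split=> //; split=> //; exact: Vc.
Qed.

Definition chart_ball (r : R) : set M := chart_inv c @` closed_ball a r.

Lemma closed_ball_le (r : R) x : 0 < r -> closed_ball a r x = (`|x - a| <= r).
Proof. by move=> r0; rewrite closed_ballE //= /closed_ball_ /= distrC. Qed.

Lemma chart_ballP r x : 0 < r -> r <= rho ->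
  chart_ball r x <-> chart_dom c x /\ `|chart_map c x - a| <= r.
Proof.
move=> r0 rr; split=> [[y]|[cx xr]].
  rewrite closed_ball_le // => yr <-.
  have /(chart_codP Ac)[h1 h2] : chart_cod c y.
    by apply: rho_cod; rewrite -/a closed_ball_le //; exact: le_trans yr rr.
  by rewrite h2.
have [_ _ cK _ _] := atlas_is_chart Ac.
by exists (chart_map c x); rewrite ?closed_ball_le // cK.
Qed.

Lemma closed_ball_compact r : compact (closed_ball a r).
Proof.
have [r0|r0] := ltP 0 r; last by rewrite closed_ball0 //; exact: compact0.
apply: bounded_closed_compact; last exact: closed_ball_closed.
exists (`|a| + r); split; first exact: num_real.
move=> N Nr x; rewrite closed_ball_le // => xr /=; apply: ltW; apply: le_lt_trans Nr.
by rewrite -[x](subrK a) addrC; apply: (le_trans (ler_normD _ _)); rewrite lerD2l.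
Qed.

Lemma chart_ball_compact r : r <= rho -> compact (chart_ball r).
Proof.
move=> rr; apply: continuous_compact; last exact: closed_ball_compact.
have [_ _ _ _ ci] := atlas_is_chart Ac.
apply: continuous_in_subspaceT => y /set_mem yr; apply: ci; apply: rho_cod.
by apply: le_closed_ball yr.
Qed.

Lemma chart_ball_closed r : r <= rho -> closed (chart_ball r).
Proof.
by move=> rr; apply: compact_closed; [exact: manifold_hausdorff|exact: chart_ball_compact].
Qed.

Definition mcutoff (r : R) (x : M) : R^o :=
  if `[< chart_dom c x >] then cutoff chi a r (chart_map c x) else 0.

Lemma mcutoff_out r x : 0 < r -> r <= rho -> ~ chart_ball r x -> mcutoff r x = 0.
Proof.
move=> r0 rr nx; rewrite /mcutoff; case: asboolP => // cx.
apply: chi0; rewrite -scalerBr normrZ normfV (gtr0_norm r0) -ler_pdivrMl ?invr_gt0 //.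
rewrite invrK mulr1 leNgt; apply/negP => xr; apply: nx; apply/chart_ballP => //.
by split=> //; exact: ltW.
Qed.

Lemma mcutoff_in r y : chart_cod c y -> mcutoff r (chart_inv c y) = cutoff chi a r y.
Proof. by move=> /(chart_codP Ac)[h1 h2]; rewrite /mcutoff asboolT // h2. Qed.

Lemma cutoff_smooth r : smooth_on setT (cutoff chi a r).
Proof. exact: (ipartial_scale r^-1 (- (r^-1 *: a)) schi).1. Qed.

(** The manifold is covered by the domain of the chart and the complement of the
    image of the closed ball; that image is compact, hence closed since the
    manifold is Hausdorff. *)
Lemma mcutoff_smooth r : 0 < r -> r <= rho -> smooth_near setT (mcutoff r).
Proof.
move=> r0 rr; have [oc oc' _ _ _] := atlas_is_chart Ac.
apply: smooth_near_local => x _; have [cx|cx] := pselect (chart_dom c x).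
  exists (chart_dom c) => //; apply: smooth_near_chart => //.
  have oI := chart_img_open Ac oc.
  apply: (smooth_on_eq oI) (smooth_onS (@subsetT _ _) (cutoff_smooth r)).
  by move=> y /(chart_imgP _ _ Ac)[cy _ _]; rewrite mcutoff_in.
exists (~` chart_ball r); first by move=> /(chart_ballP _ r0 rr)[].
have oB : open (~` chart_ball r) by apply: closed_openC; exact: chart_ball_closed.
apply: (smooth_near_eq oB) (smooth_near_cst 0 oB) => y yr.
by rewrite mcutoff_out.
Qed.

Lemma mcutoff_near1 r : 0 < r -> \forall x \near p, mcutoff r x = 1.
Proof.
move=> r0; have [oc _ _ cc _] := atlas_is_chart Ac; have [r1 r10 h1] := chi1.
have h : \forall x \near p, `|chart_map c x - a| < r * r1.
  have rr : 0 < r * r1 by rewrite mulr_gt0.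
  by have /cvgrPdist_lt /(_ _ rr) := cc p cp; apply: filterS => x; rewrite distrC.
have h' : \forall x \near p, chart_dom c x by exact: open_nbhs_nbhs.
near=> x; rewrite /mcutoff asboolT; last by near: x.
apply: h1; rewrite -scalerBr normrZ normfV (gtr0_norm r0) ler_pdivrMl //.
by apply: ltW; near: x.
Unshelve. all: by end_near. Qed.

(** The estimate of [cutoff_flat], transported from the chart [c] to an arbitrary
    chart [d] as needed for the seminorms. Points of [Q] outside the small ball
    contribute 0; on the others [chain_terms] expresses the derivative through
    those in the chart [c], with coefficients that are bounded on a compact set
    which does not depend on [r]. *)
Lemma mcutoff_vanishing (g : M -> R^o) (N : nat) d (Q : set 'rV[R]_n) s :
  smooth_near setT g -> flat_at N (fun y => g (chart_inv c y)) a ->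
  atlas d -> compact Q -> Q `<=` chart_cod d -> (size s <= N)%N ->
  vanishing (fun=> Q)
    (fun r => ipartial s (fun y => mcutoff r (chart_inv d y) * g (chart_inv d y) : R^o)).
Proof.
move=> sg fl Ad cQ Qd sN.
have [oc occ _ cc _] := atlas_is_chart Ac; have [od odc dK dc di] := atlas_is_chart Ad.
have sgc : smooth_on (chart_cod c) (fun y => g (chart_inv c y)).
  by rewrite -chart_img_setT; exact: sg.
have ac : chart_cod c a by exists p.
pose V := chart_img d (chart_dom c).
have oV : open V by exact: chart_img_open.
(* The part of [Q] on which the change of charts is defined and stays in a compact set, for every r <= rho. *)
pose Q' := chart_map d @` (chart_inv d @` Q `&` chart_ball rho).
have sQ' : Q' `<=` V.
  move=> _ [_ [[y Qy <-] h] <-]; have [h1 h2] := chart_codP Ad (Qd y Qy).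
  by exists (chart_inv d y) => //; split=> //; have [] := (chart_ballP _ rho0 (lexx _)).1 h.
have cQ' : compact Q'.
  have cdQ : compact (chart_inv d @` Q).
    apply: continuous_compact => //; apply: continuous_in_subspaceT => y.
    by move=> /set_mem /Qd; exact: di.
  apply: continuous_compact; last first.
    by apply: compact_closedI => //; exact: chart_ball_closed.
  apply: continuous_in_subspaceT => x /set_mem [[y Qy <-] _]; apply: dc.
  by have [] := chart_codP Ad (Qd y Qy).
pose tau := in_charts d c (fun x : M => x).
pose F r z : R^o := cutoff chi a r z * g (chart_inv c z).
have Vtau y : V y -> chart_cod c (tau y).
  by move=> /(chart_imgP _ _ Ad)[_ h _]; exists (chart_inv d y).
pose D (r : R) := [set y | Q' y /\ `|tau y - a| <= r].
suff h : vanishing D (fun r y => \sum_(q <- chain_terms tau s)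
    q.2 y * ipartial q.1 (F r) (tau y)).
  move=> e e0; have he := h e e0; near=> r => y Qy.
  have r0 : 0 < r by near: r; exact: nbhs_right_gt.
  have rr : r <= rho by near: r; exact: nbhs_right_le.
  have [h1 h2] := chart_codP Ad (Qd y Qy).
  have [yr|yr] := pselect (chart_ball r (chart_inv d y)).
    have [cy yra] := (chart_ballP _ r0 rr).1 yr.
    have Q'y : Q' y.
      exists (chart_inv d y) => //; split; first by exists y.
      by apply/(chart_ballP _ rho0 (lexx _)); split=> //; exact: le_trans yra rr.
    have sF : smooth_on (chart_img c setT) (fun z => mcutoff r (chart_inv c z) * g (chart_inv c z) : R^o).
      exact: (smooth_nearM openT (mcutoff_smooth r0 rr) sg).
    have [_ E] := pullback_formula (g := fun x => mcutoff r x * g x) (smooth_map_id M) Ad Ac openT sF.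
    rewrite E; last by rewrite setIT; exact: sQ'.
    have -> : \sum_(q <- chain_terms tau s) q.2 y *
         ipartial q.1 (fun z => mcutoff r (chart_inv c z) * g (chart_inv c z) : R^o) (tau y)
      = \sum_(q <- chain_terms tau s) q.2 y * ipartial q.1 (F r) (tau y).
      apply: eq_bigr => q _; congr (_ * _); apply: (ipartial_eq_on q.1 occ).
        by move=> z cz; rewrite mcutoff_in.
      exact/Vtau/sQ'.
    have Dy : D r y by split.
    by move: y Dy {Qy h1 h2 yr cy yra Q'y E}; near: r.
  have oB : open (~` chart_ball r) by apply: closed_openC; exact: chart_ball_closed.
  have oI := chart_img_open Ad oB.
  rewrite (@ipartial_eq_on R n (chart_img d (~` chart_ball r)) _ (cst 0)) //.
  - by rewrite ipartial_cst0 normr0 ltW.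
  - by move=> z /(chart_imgP _ _ Ad)[_ zr _]; rewrite mcutoff_out // mul0r.
  - by apply/(chart_imgP _ _ Ad); split=> //; exists (chart_inv d y).
apply: vanishing_sum => q qs.
have sq : smooth_on V q.2.
  apply: chain_terms_smooth oV _ qs => j; exact: (atlas_compatible Ad Ac j).
have [C hC] : exists C, forall y, Q' y -> `|q.2 y| <= C.
  have [->|/set0P ne] := eqVneq Q' set0; first by exists 0.
  have cq : {within Q', continuous (fun y => `|q.2 y|)}.
    apply: continuous_in_subspaceT => y /set_mem /sQ' Vy.
    exact: (cvg_norm (smooth_on_cont (s := [::]) sq Vy)).
  have [y0 _ hy0] := compact_EVT_max ne cQ' cq.
  by exists `|q.2 y0| => y Q'y; apply: hy0; exact: mem_set.
apply: (@vanishing_mul _ _ D (fun _ y => q.2 y) _ C).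
  by near=> r => y [Q'y _]; exact: hC.
have qN : (size q.1 <= N)%N by apply: leq_trans (chain_terms_size qs) sN.
move=> e e0; have he := cutoff_flat schi bchi occ ac sgc fl qN e0.
by near=> r => y [_ yr]; move: (tau y) yr; near: r.
Unshelve. all: by end_near. Qed.

End ManifoldCutoff.

(** * Distributions supported at a point are combinations of partial derivatives *)

Section KernelSpan.
Variables (K : fieldType) (V : lmodType K) (I : eqType) (L : I -> V -> K^o).
Hypothesis linL : forall i, linear (L i).

Let lin0 (T : V -> K^o) : linear T -> T 0 = 0.
Proof.
by move=> lT; have := lT (-1) 0 0; rewrite scaler0 addr0 scaleN1r addNr.
Qed.

Let linZ (T : V -> K^o) a v : linear T -> T (a *: v) = a * T v.
Proof. by move=> lT; have := lT a v 0; rewrite !addr0 lin0 // addr0. Qed.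

(** Induction on the list. If some [v0] in the common kernel of the tail is not
    killed by the head [L i], a multiple of [L i] is subtracted from [T] so that
    the difference vanishes on the common kernel of the tail; otherwise the head
    is redundant. *)
Lemma kernel_span (T : V -> K^o) (l : seq I) : linear T ->
  (forall v, (forall i, i \in l -> L i v = 0) -> T v = 0) ->
  exists cl : seq (K * I), forall v, T v = \sum_(q <- cl) q.1 * L q.2 v.
Proof.
elim: l T => [|i l IH] T lT kT.
  by exists [::] => v; rewrite big_nil kT.
have [[v0 v0l v0i]|nv] := pselect (exists2 v, (forall j, j \in l -> L j v = 0) & L i v != 0).
  (* The coefficient for which T - b L_i vanishes at v0. *)
  pose b := T v0 / L i v0.
  have lT' : linear (fun v => T v - b * L i v : K^o).
    move=> a u v; rewrite lT linL mulrDr opprD addrACA; congr (_ + _).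
    by rewrite scalerBr; congr (_ - _); rewrite -[LHS]/(b * (a * _)) mulrCA.
  have [|cl hcl] := IH _ lT'.
    move=> v vl /=; pose w := - (L i v / L i v0) *: v0 + v.
    have Tw : T w = 0.
      apply: kT => j; rewrite inE linL => /predU1P[->|jl].
        by rewrite -[_ *: _]/(_ * _) mulNr divfK // addNr.
      by rewrite (vl j jl) (v0l j jl) scaler0 addr0.
    move: Tw; rewrite /w lT => /eqP; rewrite addr_eq0 => /eqP h.
    rewrite -[T v]opprK -h -[_ *: _]/(_ * _) mulNr opprK /b.
    ring.
  exists ((b, i) :: cl) => v; rewrite big_cons -hcl /=.
  by rewrite addrC subrK.
apply: IH => // v vl; apply: kT => j; rewrite inE => /predU1P[->|]; last exact: vl.
by apply: contrapT => /eqP vi; apply: nv; exists v.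
Qed.

End KernelSpan.

Section StructureTheorem.
Variables (R : realType) (k : scalar_kind) (n : nat) (M : manifold R n).
Local Notation K := (scalars R k).
Variables (c : chart R M n) (p : M).
Hypotheses (Ac : atlas c) (cp : chart_dom c p).

Definition flat_fun N (f : M -> K^o) :=
  forall t : seq 'I_n, (size t <= N)%N -> chart_partial c t p f = 0.

Lemma strict_margin (Q : set 'rV[R]_n) (u : 'rV[R]_n -> R^o) (r : R) :
  compact Q -> (forall y, Q y -> {for y, continuous u}) -> 0 < r ->
  (forall y, Q y -> `|u y| < r) ->
  exists2 e, 0 < e & forall y, Q y -> `|u y| + e < r.
Proof.
move=> cQ cu r0 ur; have [Q0|/set0P ne] := eqVneq Q set0.
  by exists r => // y; rewrite Q0.
have cn : {within Q, continuous (fun y => `|u y|)}.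
  by apply: continuous_in_subspaceT => y /set_mem Qy; exact: (cvg_norm (cu y Qy)).
have [y0 /set_mem Qy0 hy0] := compact_EVT_max ne cQ cn.
exists ((r - `|u y0|) / 2); first by rewrite divr_gt0 // subr_gt0 ur.
move=> y Qy; have := hy0 y (mem_set Qy); have := ur y0 Qy0; lra.
Qed.

(** If [T f] were not 0, one could rescale [f] so that [T f = 1]. The cut off
    functions then tend to 0, whereas [T] takes the value 1 on all of them because
    they agree with [f] near [p]. *)
Lemma distribution_flat (T : Cinf k M -> K^o) : point_distribution p T ->
  exists N, forall f : Cinf k M, flat_fun N (val f) -> T f = 0.
Proof.
move=> [lT cT sT].
have [oc occ _ _ _] := atlas_is_chart Ac.
have [rho rho0 rho_cod] : exists2 rho : R, 0 < rho &
    closed_ball (chart_map c p) rho `<=` chart_cod c.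
  have /nbhs_closedballP[rho h] : nbhs (chart_map c p) (chart_cod c).
    by apply: open_nbhs_nbhs; split=> //; exists p.
  by exists rho%:num.
have [chi [schi chi1 chi0 bchi]] := bump_exists R n.
pose mc r := mcutoff c p chi r.
pose cutf r (f : Cinf k M) : M -> K^o := fun x => mkK k (mc r x) 0 * val f x.
have cutf_re r f x : reK (cutf r f x) = mc r x * reK (val f x).
  exact: reK_realM.
have cutf_im r f x : imK (cutf r f x) = mc r x * imK (val f x).
  exact: imK_realM.
have cutf_smooth r f : 0 < r -> r <= rho -> smooth_fun (cutf r f).
  move=> r0 rr; apply: smooth_funM; last exact: Cinf_smooth.
  have sm : smooth_near setT (mc r) by apply: mcutoff_smooth r0 rr.
  apply/smooth_funE; split.
    by rewrite (_ : (fun _ => _) = mc r) //; apply/funext => x; rewrite mkK_re.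
  rewrite (_ : (fun _ => _) = cst 0); first exact: smooth_near_cst openT.
  by apply/funext => x; rewrite mkK_imE.
pose cutC r f := mkCinf (cutf r f).
have T_cut r f : 0 < r -> r <= rho -> T (cutC r f) = T f.
  move=> r0 rr; apply/esym/eqP; rewrite -subr_eq0.
  have -> : T f - T (cutC r f) = T (-1 *: cutC r f + f) by rewrite lT scaleN1r addrC.
  apply/eqP/sT => /(_ [set x | mc r x = 1]) [].
    exact: mcutoff_near1.
  move=> x [nx mx]; move: nx; rewrite /mkset => /negP; apply; apply/eqP.
  rewrite (Cinf_linE (-1) (cutC r f) f) mkCinfE; last exact: cutf_smooth.
  rewrite -[LHS]/(-1 *: cutf r f x + val f x) /cutf mx.
  have -> : mkK k 1 0 = 1 :> K.
    by apply: eqK; rewrite ?mkK_re ?mkK_imE // /reK /imK /scalars; case: k.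
  by rewrite mul1r scaleN1r addNr.
(* Each subbasic neighbourhood of 0 leaves a margin, as its strict inequalities hold uniformly on a compact set. *)
have ballP B : Cinf_subbase B -> B 0 -> exists N, forall f : Cinf k M,
    flat_fun N (val f) -> \forall r \near (0 : R)^'+, B (cutC r f).
  move=> [d [Q [s [h [r [Ad cQ Qd r0 ->]]]]]] B0; exists (size s) => f ff.
  have [rh ih] := Cinf_smooth h Ad.
  have subE (g : Cinf k M) y : Q y ->
      (ipartial s (fun z => reK (val (g - h) (chart_inv d z))) y =
        ipartial s (fun z => reK (val g (chart_inv d z))) y
        - ipartial s (fun z => reK (val h (chart_inv d z))) y) /\
      (ipartial s (fun z => imK (val (g - h) (chart_inv d z))) y =
        ipartial s (fun z => imK (val g (chart_inv d z))) y
        - ipartial s (fun z => imK (val h (chart_inv d z))) y).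
    move=> Qy; have dy := Qd _ Qy; rewrite Cinf_subE.
    rewrite (ipartial_re_lin s (-1) Ad dy (Cinf_smooth h) (Cinf_smooth g)).
    rewrite (ipartial_im_lin s (-1) Ad dy (Cinf_smooth h) (Cinf_smooth g)).
    by rewrite reKN1 imKN1 !mulN1r oppr0 !mul0r !add0r; split; rewrite addrC.
  have zE (y : 'rV[R]_n) :
      ipartial s (fun z => reK (val (0 : Cinf k M) (chart_inv d z))) y = 0 /\
      ipartial s (fun z => imK (val (0 : Cinf k M) (chart_inv d z))) y = 0.
    rewrite GRing.val0; split; rewrite (_ : (fun _ => _) = cst 0) ?ipartial_cst0 //;
      by apply/funext => z; rewrite ?reK0 ?imK0.
  have [er er0 her] : exists2 e, 0 < e & forall y, Q y ->
      `|ipartial s (fun z => reK (val h (chart_inv d z))) y| + e < r.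
    apply: strict_margin => // y Qy; first exact: (smooth_on_cont rh (Qd _ Qy)).
    have [+ _] := B0 y Qy; have [-> _] := subE 0 y Qy; have [-> _] := zE y.
    by rewrite sub0r normrN.
  have [ei ei0 hei] : exists2 e, 0 < e & forall y, Q y ->
      `|ipartial s (fun z => imK (val h (chart_inv d z))) y| + e < r.
    apply: strict_margin => // y Qy; first exact: (smooth_on_cont ih (Qd _ Qy)).
    have [_ +] := B0 y Qy; have [_ ->] := subE 0 y Qy; have [_ ->] := zE y.
    by rewrite sub0r normrN.
  have [fr fi] := (smooth_funE _).1 (Cinf_smooth f).
  have flr : flat_at (size s) (fun y => reK (val f (chart_inv c y))) (chart_map c p).
    by move=> t ts; rewrite -chart_partial_re ff // reK0.
  have fli : flat_at (size s) (fun y => imK (val f (chart_inv c y))) (chart_map c p).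
    by move=> t ts; rewrite -chart_partial_im ff // imK0.
  have vr := mcutoff_vanishing Ac cp rho0 rho_cod schi chi0 bchi fr flr Ad cQ Qd (leqnn _) er0.
  have vi := mcutoff_vanishing Ac cp rho0 rho_cod schi chi0 bchi fi fli Ad cQ Qd (leqnn _) ei0.
  near=> e => y Qy.
  have e0 : 0 < e by near: e; exact: nbhs_right_gt.
  have ee : e <= rho by near: e; exact: nbhs_right_le.
  have [-> ->] := subE (cutC e f) y Qy.
  have -> : (fun z => reK (val (cutC e f) (chart_inv d z))) =
      (fun z => mc e (chart_inv d z) * reK (val f (chart_inv d z))).
    by apply/funext => z; rewrite mkCinfE ?cutf_re //; exact: cutf_smooth.
  have -> : (fun z => imK (val (cutC e f) (chart_inv d z))) =
      (fun z => mc e (chart_inv d z) * imK (val f (chart_inv d z))).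
    by apply/funext => z; rewrite mkCinfE ?cutf_im //; exact: cutf_smooth.
  split; (apply: le_lt_trans (ler_normB _ _) _); rewrite addrC.
    apply: le_lt_trans (her y Qy); rewrite lerD2l.
    by move: y Qy; near: e.
  apply: le_lt_trans (hei y Qy); rewrite lerD2l.
  by move: y Qy; near: e.
have [E hE sE] : exists2 E : seq (set (Cinf k M)),
    (forall B, B \in E -> Cinf_subbase B /\ B 0) &
    forall g : Cinf k M, (forall B, B \in E -> B g) -> T g != 1.
  apply: (@Cinf_nbhs R k n M 0 (fun g => T g != 1)).
  apply: (cT 0 [set w | w != 1]).
  apply: open_nbhs_nbhs; split.
    rewrite (_ : [set w : K^o | w != 1] = ~` [set 1]).
      apply: closed_openC; apply: accessible_closed_set1.
      by apply: hausdorff_accessible; exact: norm_hausdorff.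
    by apply/seteqP; split=> w /eqP.
  have -> : T 0 = 0.
    by have := lT (-1) 0 0; rewrite scaler0 addr0 scaleN1r addNr.
  by rewrite /= eq_sym oner_neq0.
have [N hN] : exists N, forall f : Cinf k M, flat_fun N (val f) ->
    \forall r \near (0 : R)^'+, forall B, B \in E -> B (cutC r f).
  elim: E hE {sE} => [_|B E IH hE].
    by exists 0%N => f _; near=> r.
  have [N1 h1] := IH (fun B0 BE => hE B0 (mem_behead (s := B :: E) BE)).
  have [N2 h2] := ballP B (hE B (mem_head _ _)).1 (hE B (mem_head _ _)).2.
  exists (maxn N1 N2) => f ff.
  have f1 := h1 f (fun t tN => ff t (leq_trans tN (leq_maxl _ _))).
  have f2 := h2 f (fun t tN => ff t (leq_trans tN (leq_maxr _ _))).
  near=> r => C; rewrite inE => /predU1P[->|]; first by near: r.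
  by move: C; near: r.
exists N => f ff; apply: contrapT => /eqP Tf.
pose g := (T f)^-1 *: f + 0.
have Tg : T g = 1.
  rewrite /g lT; have -> : T 0 = 0.
    by have := lT (-1) 0 0; rewrite scaler0 addr0 scaleN1r addNr.
  by rewrite addr0 -[LHS]/(_ * _) mulVf.
have fg : flat_fun N (val g).
  move=> t tN; rewrite Cinf_linE chart_partial_lin //; try exact: Cinf_smooth.
  by rewrite ff // scaler0 add0r GRing.val0 chart_partial_cst0.
have [r [r0 rr hr]] : exists r, [/\ 0 < r, r <= rho & forall B, B \in E -> B (cutC r g)].
  have hg := hN g fg.
  have : \forall r \near (0 : R)^'+, [/\ 0 < r, r <= rho & forall B, B \in E -> B (cutC r g)].
    near=> r; split; [|near: r; exact: nbhs_right_le|near: r; exact: hg].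
    by near: r; exact: nbhs_right_gt.
  by move=> /filter_ex[r]; exists r.
by have := sE _ hr; rewrite T_cut // Tg eqxx.
Unshelve. all: by end_near. Qed.

Definition multi_indices N : seq (seq 'I_n) :=
  flatten [seq [seq val t | t <- enum {: j.-tuple 'I_n}] | j <- iota 0 N.+1].

Lemma mem_multi_indices N (t : seq 'I_n) : (size t <= N)%N -> t \in multi_indices N.
Proof.
move=> tN; apply/flatten_mapP; exists (size t); first by rewrite mem_iota ltnS.
by apply/mapP; exists (in_tuple t); rewrite ?mem_enum.
Qed.

Theorem point_distribution_structure (T : Cinf k M -> K^o) : point_distribution p T ->
  exists cl : seq (K * seq 'I_n), forall f,
    T f = \sum_(q <- cl) q.1 * chart_partial c q.2 p (val f).
Proof.
move=> dT; have [N hN] := distribution_flat dT; have [lT _ _] := dT.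
apply: (@kernel_span K (Cinf k M) _ (fun s f => chart_partial c s p (val f)) _
  T (multi_indices N) lT) => [s|f hf].
  by have [] := chart_partial_distribution k s Ac cp.
by apply: hN => t tN; apply: hf; exact: mem_multi_indices.
Qed.

End StructureTheorem.

(** * Pushforwards and external products of point distributions *)

Section PointDistributions.
Variables (R : realType) (k : scalar_kind).
Local Notation K := (scalars R k).

Section OnePoint.
Variables (n : nat) (M : manifold R n) (e : M).
Implicit Types (S T : E' k e) (f g : M -> K^o).

(** The value of [T] on a function rather than on a packed smooth function. *)
Definition ap T g : K := val T (mkCinf g).

Lemma E'_point T : point_distribution e (val T).
Proof. exact: (asboolW (valP T)). Qed.

Lemma mkCinf_val (f : Cinf k M) : mkCinf (val f) = f.
Proof. exact: valKd. Qed.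

Lemma E'_ext S T : (forall g, smooth_fun g -> ap S g = ap T g) -> S = T.
Proof.
move=> h; apply: val_inj; apply/funext => f.
by have := h _ (Cinf_smooth f); rewrite /ap mkCinf_val.
Qed.

Lemma ap_lin T a f g : smooth_fun f -> smooth_fun g ->
  ap T (a *: f + g) = a * ap T f + ap T g.
Proof.
move=> sf sg; have [lT _ _] := E'_point T.
rewrite /ap -[a * _]/(a *: (_ : K^o)) -lT; congr (val T _); apply: val_inj.
by rewrite Cinf_linE !mkCinfE //; exact: smooth_fun_lin.
Qed.

Lemma ap0 T : ap T (fun _ => 0) = 0.
Proof.
have h := ap_lin T (-1) (@smooth_fun_cst R k n M 0) (@smooth_fun_cst R k n M 0).
by move: h; rewrite scaler0 addr0 mulN1r addNr.
Qed.

Lemma apZ T a f : smooth_fun f -> ap T (fun x => a * f x) = a * ap T f.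
Proof.
move=> sf; have := ap_lin T a sf (@smooth_fun_cst R k n M 0); rewrite ap0 [X in _ = X]addr0 => <-.
by congr (ap T _); apply/funext => x; rewrite -[RHS]/(a * f x + 0) addr0.
Qed.

Lemma ap_sum T (I : eqType) (l : seq I) (a : I -> K) (F : I -> M -> K^o) :
  (forall i, smooth_fun (F i)) ->
  ap T (fun x => \sum_(i <- l) a i * F i x) = \sum_(i <- l) a i * ap T (F i).
Proof.
move=> sF; elim: l => [|i l IH].
  by rewrite big_nil -[RHS](ap0 T); congr (ap T _); apply/funext => x; rewrite big_nil.
rewrite big_cons -IH -ap_lin //; last first.
  apply: smooth_fun_sum => j; have := smooth_fun_lin (a j) (sF j) (@smooth_fun_cst R k n M 0).
  congr smooth_fun; apply/funext => x; exact: addr0.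
by congr (ap T _); apply/funext => x; rewrite big_cons.
Qed.

Lemma ap_linE (a : K) S T g : ap (a *: S + T) g = a * ap S g + ap T g.
Proof. by rewrite /ap GRing.valD GRing.valZ. Qed.

Lemma ap_0 g : ap (0 : E' k e) g = 0.
Proof. by rewrite /ap GRing.val0. Qed.

Lemma apD S T g : ap (S + T) g = ap S g + ap T g.
Proof. by rewrite -[S]scale1r ap_linE mul1r scale1r. Qed.

Lemma ap_scale (a : K) S g : ap (a *: S) g = a * ap S g.
Proof. by rewrite -[a *: S]addr0 ap_linE ap_0 addr0. Qed.

Lemma ap_bigE (I : Type) (l : seq I) (a : I -> K) (U : I -> E' k e) g :
  ap (\sum_(i <- l) a i *: U i) g = \sum_(i <- l) a i * ap (U i) g.
Proof. by elim: l => [|i l IH]; rewrite ?big_nil ?ap_0 // !big_cons ap_linE IH. Qed.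

Lemma mkE'_eq (F : Cinf k M -> K^o) (U : E' k e) : (forall f : Cinf k M, F f = val U f) -> mkE' e F = U.
Proof. by move=> h; rewrite /mkE' (_ : F = val U) ?valKd //; apply/funext. Qed.

Lemma mkE'E (F : Cinf k M -> K^o) : point_distribution e F -> val (mkE' e F) = F.
Proof. by move=> dF; rewrite /mkE' insubdK //; exact: (asboolT dF). Qed.

Definition chart_dist (c : chart R M n) s : E' k e :=
  mkE' e (fun f : Cinf k M => chart_partial c s e (val f)).

Lemma ap_chart_dist c s g : atlas c -> chart_dom c e -> smooth_fun g ->
  ap (chart_dist c s) g = chart_partial c s e g.
Proof.
move=> Ac ce sg; rewrite /ap mkE'E ?mkCinfE //.
exact: chart_partial_distribution.
Qed.

Lemma E'_span c T : atlas c -> chart_dom c e -> exists cl : seq (K * seq 'I_n),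
  T = \sum_(q <- cl) q.1 *: chart_dist c q.2.
Proof.
move=> Ac ce; have [cl hcl] := point_distribution_structure Ac ce (E'_point T).
exists cl; apply: E'_ext => g sg; rewrite ap_bigE /ap hcl; apply: eq_bigr => q _.
by rewrite -/(ap _ _) ap_chart_dist // mkCinfE.
Qed.

Lemma ap_dirac g : smooth_fun g -> ap (dirac_at k e) g = g e.
Proof.
have [c Ac ce] := atlas_cover e; have [_ _ cK _ _] := atlas_is_chart Ac.
move=> sg; rewrite /ap /dirac_at (@mkE'_eq _ (chart_dist c [::])).
  rewrite -/(ap _ _) ap_chart_dist //; apply: eqK.
    by rewrite chart_partial_re /= cK.
  by rewrite chart_partial_im /= cK.
move=> f; rewrite -[f in RHS]mkCinf_val -/(ap _ _) ap_chart_dist //; last exact: Cinf_smooth.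
by apply: eqK; rewrite ?chart_partial_re ?chart_partial_im /= cK.
Qed.

End OnePoint.

Section Pushforward.
Variables (m n : nat) (M : manifold R m) (N : manifold R n) (phi : M -> N).
Variables (e1 : M) (e2 : N).
Hypotheses (sphi : smooth_map phi) (phie : phi e1 = e2).

Lemma chart_partial_pullback c d s (f : N -> K^o) :
  atlas c -> chart_dom c e1 -> atlas d -> chart_dom d e2 -> smooth_fun f ->
  chart_partial c s e1 (f \o phi) =
  \sum_(q <- chain_terms (in_charts c d phi) s)
     mkK k (q.2 (chart_map c e1)) 0 * chart_partial d q.1 e2 f.
Proof.
move=> Ac ce Ad de /smooth_funE[rf if_].
have [_ _ cK _ _] := atlas_is_chart Ac.
have [_ Er] := pullback_formula sphi Ac Ad openT (rf d Ad).
have [_ Ei] := pullback_formula sphi Ac Ad openT (if_ d Ad).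
have I1 : chart_img c (phi @^-1` (chart_dom d `&` setT)) (chart_map c e1).
  by exists e1 => //; split=> //; split=> //; rewrite phie.
have E1 : in_charts c d phi (chart_map c e1) = chart_map d e2.
  by rewrite /in_charts cK // phie.
apply: eqK.
  rewrite chart_partial_re reK_sum Er //; apply: eq_bigr => q _.
  by rewrite reK_realM chart_partial_re E1.
rewrite chart_partial_im imK_sum Ei //; apply: eq_bigr => q _.
by rewrite imK_realM chart_partial_im E1.
Qed.

(** On the basis of partial derivatives the functional is again a combination of
    partial derivatives, so it is a point distribution: the packing in the
    definition of the pushforward does not fall back on its default value. *)
Lemma ap_map (T : E' k e1) (g : N -> K^o) : smooth_fun g ->
  ap (E'_map phi e2 T) g = ap T (g \o phi).
Proof.
have [c Ac ce] := atlas_cover e1; have [d Ad de] := atlas_cover e2.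
have [cl ->] := E'_span T Ac ce => sg.
pose U : E' k e2 := \sum_(q <- cl) q.1 *: \sum_(r <- chain_terms (in_charts c d phi) q.2)
  mkK k (r.2 (chart_map c e1)) 0 *: chart_dist e2 d r.1.
have E (f : N -> K^o) : smooth_fun f ->
    ap (\sum_(q <- cl) q.1 *: chart_dist e1 c q.2) (f \o phi) = ap U f.
  move=> sf; rewrite /U !ap_bigE; apply: eq_bigr => q _; congr (_ * _).
  rewrite ap_chart_dist //; last exact: smooth_fun_pullback.
  rewrite (chart_partial_pullback _ Ac ce Ad de sf) ap_bigE.
  by apply: eq_bigr => r _; rewrite ap_chart_dist.
rewrite E // /E'_map (@mkE'_eq _ _ _ _ U) // => f.
by have := E _ (Cinf_smooth f); rewrite [X in _ = X]/ap mkCinf_val.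
Qed.

End Pushforward.

Section Product.
Variables (m n : nat) (M : manifold R m) (N : manifold R n) (e1 : M) (e2 : N).
Implicit Types (G : prod_manifold M N -> K^o).

Lemma smooth_slice G x : smooth_fun G -> smooth_fun (fun y => G (x, y)).
Proof.
move=> sG; apply: (smooth_fun_pullback (phi := fun y : N => (x, y) : prod_manifold M N) _ sG).
by apply: smooth_map_pair; [exact: smooth_map_cst|exact: smooth_map_id].
Qed.

Lemma slice_partial (c : chart R M m) (d : chart R N n) t (h : M * N -> R^o) y z :
  ipartial t (fun z => h (chart_inv c y, chart_inv d z)) z =
  ipartial (map (@rshift m n) t) (fun v => h (chart_inv (prod_chart c d) v)) (row_mx y z).
Proof.
have := ipartial_affine (fun v => h (chart_inv (prod_chart c d) v)) t (@slicer_affine R m n y).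
move=> /(congr1 (fun F => F z)) /= <-; congr (ipartial t _ z).
by apply/funext => w /=; rewrite row_mxKl row_mxKr.
Qed.

Lemma slice_partial2 (c : chart R M m) (d : chart R N n) s t (h : M * N -> R^o) y z :
  ipartial s (fun y => ipartial t (fun z => h (chart_inv c y, chart_inv d z)) z) y =
  ipartial (map (@lshift m n) s ++ map (@rshift m n) t)
    (fun v => h (chart_inv (prod_chart c d) v)) (row_mx y z).
Proof.
rewrite (_ : (fun y => _) = ipartial (map (@rshift m n) t)
   (fun v => h (chart_inv (prod_chart c d) v)) \o (fun y => row_mx y z)).
  by rewrite (ipartial_affine _ s (@slicel_affine R m n z)) /= ipartial_cat.
by apply/funext => w /=; exact: slice_partial.
Qed.

Lemma smooth_partial_slice d t G : atlas d -> chart_dom d e2 -> smooth_fun G ->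
  smooth_fun (fun x => chart_partial d t e2 (fun y => G (x, y))).
Proof.
move=> Ad de sG c Ac.
have Acd : atlas (prod_chart c d : chart R (prod_manifold M N) (m + n)) by exists c, d.
have [rG iG] := sG _ Acd.
have cod z : chart_cod c z -> chart_cod (prod_chart c d) (row_mx z (chart_map d e2)).
  by rewrite prod_chart_cod /= row_mxKl row_mxKr; split=> //; exists e2.
have sm (h : M * N -> R^o) :
    smooth_on (chart_cod (prod_chart c d)) (fun v => h (chart_inv (prod_chart c d) v)) ->
    smooth_on (chart_cod c) (fun y => ipartial t (fun z => h (chart_inv c y, chart_inv d z)) (chart_map d e2)).
  move=> sh; rewrite (_ : (fun _ => _) = ipartial (map (@rshift m n) t)
     (fun v => h (chart_inv (prod_chart c d) v)) \o (fun y => row_mx y (chart_map d e2))).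
    exact: (smooth_on_affine (@slicel_affine R m n _) cod (smooth_on_ipartial _ sh)).
  by apply/funext => w /=; exact: slice_partial.
split.
  rewrite (_ : (fun _ => _) = (fun y => ipartial t
     (fun z => reK (G (chart_inv c y, chart_inv d z))) (chart_map d e2))).
    exact: (sm (fun p => reK (G p))).
  by apply/funext => y; rewrite chart_partial_re.
rewrite (_ : (fun _ => _) = (fun y => ipartial t
   (fun z => imK (G (chart_inv c y, chart_inv d z))) (chart_map d e2))).
  exact: (sm (fun p => imK (G p))).
by apply/funext => y; rewrite chart_partial_im.
Qed.

(** A partial derivative in the second variable at a fixed point is smooth in the
    first variable; the structure theorem reduces the general case to this one. *)
Lemma smooth_ap_slice (T : E' k e2) G : smooth_fun G ->
  smooth_fun (fun x => ap T (fun y => G (x, y)) : K^o).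
Proof.
move=> sG; have [d Ad de] := atlas_cover e2; have [cl ->] := E'_span T Ad de.
rewrite (_ : (fun _ => _) = (fun x => \sum_(q <- cl)
    (q.1 *: (fun x => chart_partial d q.2 e2 (fun y => G (x, y))) + (fun=> 0)) x : K^o)).
  apply: smooth_fun_sum => q; apply: smooth_fun_lin; last exact: smooth_fun_cst.
  exact: smooth_partial_slice.
apply/funext => x; rewrite ap_bigE; apply: eq_bigr => q _.
by rewrite ap_chart_dist //; [rewrite -[RHS]/(_ * _ + 0) addr0|exact: smooth_slice].
Qed.

Lemma chart_partial2 c d s t G : atlas c -> chart_dom c e1 -> atlas d -> chart_dom d e2 ->
  chart_partial c s e1 (fun x => chart_partial d t e2 (fun y => G (x, y))) =
  chart_partial (prod_chart c d : chart R (prod_manifold M N) (m + n))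
    (map (@lshift m n) s ++ map (@rshift m n) t) (e1, e2) G.
Proof.
move=> Ac ce Ad de; apply: eqK.
- rewrite !chart_partial_re -(slice_partial2 c d s t (fun p => reK (G p))).
  by congr (ipartial s _ _); apply/funext => y; rewrite chart_partial_re.
- rewrite !chart_partial_im -(slice_partial2 c d s t (fun p => imK (G p))).
  by congr (ipartial s _ _); apply/funext => y; rewrite chart_partial_im.
Qed.

(** As for pushforwards: on partial derivatives the functional is a partial
    derivative in the product chart. *)
Lemma ap_F2 (S : E' k e1) (T : E' k e2) G : smooth_fun G ->
  ap (F2 S T) G = ap S (fun x => ap T (fun y => G (x, y))).
Proof.
have [c Ac ce] := atlas_cover e1; have [d Ad de] := atlas_cover e2.
have [cl Scl] := E'_span S Ac ce; have [dl Tdl] := E'_span T Ad de.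
have Acd : atlas (prod_chart c d : chart R (prod_manifold M N) (m + n)) by exists c, d.
pose U : E' k ((e1, e2) : prod_manifold M N) :=
  \sum_(p <- cl) p.1 *: \sum_(q <- dl) q.1 *: chart_dist ((e1, e2) : prod_manifold M N)
     (prod_chart c d) (map (@lshift m n) p.2 ++ map (@rshift m n) q.2).
have E (H : prod_manifold M N -> K^o) : smooth_fun H -> ap S (fun x => ap T (fun y => H (x, y))) = ap U H.
  move=> sH; rewrite Scl /U !ap_bigE; apply: eq_bigr => p _; congr (_ * _).
  rewrite ap_bigE.
  have -> : (fun x => ap T (fun y => H (x, y))) = (fun x => \sum_(q <- dl)
      q.1 * chart_partial d q.2 e2 (fun y => H (x, y))).
    apply/funext => x; rewrite Tdl ap_bigE; apply: eq_bigr => q _.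
    by rewrite ap_chart_dist //; exact: smooth_slice.
  rewrite ap_sum => [|q]; last exact: smooth_partial_slice.
  apply: eq_bigr => q _; congr (_ * _).
  rewrite ap_chart_dist //; last exact: smooth_partial_slice.
  by rewrite chart_partial2 // ap_chart_dist.
move=> sG; rewrite E // /F2 (@mkE'_eq _ _ _ _ U) // => f.
by have := E _ (Cinf_smooth f); rewrite [X in _ = X]/ap mkCinf_val.
Qed.

End Product.

Section Diagonal.
Variables (n : nat) (M : manifold R n) (e : M).

Lemma smooth_map_diag : smooth_map (fun x : M => (x, x) : prod_manifold M M).
Proof. by apply: smooth_map_pair; exact: smooth_map_id. Qed.

(** [diag_formula] read on distributions; the right-hand side is the coproduct of
    the partial derivative, before it is lifted to a tensor. *)
Lemma ap_diag c s (G : prod_manifold M M -> K^o) : atlas c -> chart_dom c e -> smooth_fun G ->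
  ap (chart_dist e c s) (fun x => G (x, x)) =
  \sum_(p <- splits s) ap (F2 (chart_dist e c p.1) (chart_dist e c p.2)) G.
Proof.
move=> Ac ce sG.
have Acc : atlas (prod_chart c c : chart R (prod_manifold M M) (n + n)) by exists c, c.
have [rG iG] := sG _ Acc.
have [_ oc _ _ _] := atlas_is_chart Ac; have [_ occ _ _ _] := atlas_is_chart Acc.
have Ucc z : chart_cod c z -> chart_cod (prod_chart c c) (row_mx z z).
  by rewrite prod_chart_cod /= row_mxKl row_mxKr.
have ae : chart_cod c (chart_map c e) by exists e.
have E (h : M * M -> R^o) :
    smooth_on (chart_cod (prod_chart c c)) (fun v => h (chart_inv (prod_chart c c) v)) ->
    ipartial s (fun y => h (chart_inv c y, chart_inv c y)) (chart_map c e) =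
    \sum_(p <- splits s) ipartial (map (@lshift n n) p.1 ++ map (@rshift n n) p.2)
       (fun v => h (chart_inv (prod_chart c c) v)) (row_mx (chart_map c e) (chart_map c e)).
  move=> sh; have [_ <-] := diag_formula occ oc Ucc sh; last exact: ae.
  by congr (ipartial s _ _); apply/funext => y /=; rewrite row_mxKl row_mxKr.
rewrite ap_chart_dist //; last exact: (smooth_fun_pullback smooth_map_diag sG).
have -> : \sum_(p <- splits s) ap (F2 (chart_dist e c p.1) (chart_dist e c p.2)) G =
   \sum_(p <- splits s) chart_partial (prod_chart c c : chart R (prod_manifold M M) (n + n))
    (map (@lshift n n) p.1 ++ map (@rshift n n) p.2) (e, e) G.
  apply: eq_bigr => p _; rewrite ap_F2 //.
  rewrite -(chart_partial2 p.1 p.2 G Ac ce Ac ce) -ap_chart_dist //; last exact: smooth_partial_slice.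
  by congr (ap _ _); apply/funext => x; rewrite ap_chart_dist //; exact: smooth_slice.
apply: eqK.
  rewrite chart_partial_re reK_sum (E (fun p => reK (G p))) //.
  by apply: eq_bigr => p _; rewrite chart_partial_re.
rewrite chart_partial_im imK_sum (E (fun p => imK (G p))) //.
by apply: eq_bigr => p _; rewrite chart_partial_im.
Qed.

End Diagonal.
End PointDistributions.

(** * Tensors and polynomial sequences *)

Section TensorAlgebra.
Variable K : fieldType.
Implicit Types (A B C D V W : lmodType K).

Lemma linear_0 V W (f : V -> W) : linear f -> f 0 = 0.
Proof. by move=> lf; have := lf (-1) 0 0; rewrite !scaleN1r oppr0 addr0 addNr. Qed.

Lemma linear_Z V W (f : V -> W) a v : linear f -> f (a *: v) = a *: f v.
Proof. by move=> lf; have := lf a v 0; rewrite !addr0 (linear_0 lf) addr0. Qed.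

Lemma linear_D V W (f : V -> W) u v : linear f -> f (u + v) = f u + f v.
Proof. by move=> lf; have := lf 1 u v; rewrite !scale1r. Qed.

Lemma linear_sum V W (f : V -> W) (I : Type) (l : seq I) (F : I -> V) : linear f ->
  f (\sum_(i <- l) F i) = \sum_(i <- l) f (F i).
Proof.
move=> lf; elim: l => [|i l IH]; first by rewrite !big_nil (linear_0 lf).
by rewrite !big_cons (linear_D _ _ lf) IH.
Qed.

Lemma linear_comp V W C (f : V -> W) (g : W -> C) : linear f -> linear g ->
  linear (fun v => g (f v)).
Proof. by move=> lf lg a u v; rewrite lf lg. Qed.

Lemma tlift_bilin_comp A B V W (beta : A -> B -> V) (f : V -> W) :
  bilinear_map beta -> linear f -> bilinear_map (fun a b => f (beta a b)).
Proof. by move=> [h1 h2] lf; split=> [b a u v|a b u v] /=; rewrite (h1, h2) lf. Qed.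

Lemma bilin_map A A' B B' V (beta : A' -> B' -> V) (f : A -> A') (g : B -> B') :
  bilinear_map beta -> linear f -> linear g -> bilinear_map (fun a b => beta (f a) (g b)).
Proof.
move=> [h1 h2] lf lg; split=> [b a u v|a b u v] /=; first by rewrite lf h1.
by rewrite lg h2.
Qed.

Lemma bilin_prod A B (f : A -> K^o) (g : B -> K^o) : linear f -> linear g ->
  bilinear_map (fun a b => f a * g b : K^o).
Proof.
move=> lf lg; split=> [b a u v|a b u v] /=.
  by rewrite lf mulrDl -scalerAl.
by rewrite lg mulrDr -[X in X + _]/(f a * (b * g u)) mulrCA.
Qed.

(** Elementary tensors span. *)
Lemma tens_lin_eq A B V (f g : tens A B -> V) : linear f -> linear g ->
  (forall a b, f (tmul a b) = g (tmul a b)) -> f =1 g.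
Proof.
move=> lf lg fg u; have [s ->] := tens_span u.
by rewrite (linear_sum _ _ lf) (linear_sum _ _ lg); apply: eq_bigr => p _.
Qed.

Lemma tmap_linear A A' B B' (f : A -> A') (g : B -> B') : linear f -> linear g ->
  linear (tmap f g).
Proof. by move=> lf lg; apply: tlift_linear; apply: bilin_map => //; exact: tmul_bilinear. Qed.

Lemma tmap_tmul A A' B B' (f : A -> A') (g : B -> B') a b : linear f -> linear g ->
  tmap f g (tmul a b) = tmul (f a) (g b).
Proof.
by move=> lf lg; rewrite /tmap tlift_tmul //; apply: bilin_map => //; exact: tmul_bilinear.
Qed.

Lemma id_linear V : linear (@id V). Proof. by []. Qed.

Lemma tswap_bilin A B : bilinear_map (fun (a : A) (b : B) => tmul b a).
Proof. by have [h1 h2] := tmul_bilinear B A; split=> [b|a]; [exact: h2|exact: h1]. Qed.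

Lemma tswap_linear A B : linear (@tswap K A B).
Proof. exact: tlift_linear (tswap_bilin A B). Qed.

Lemma tassoc_bilin_in A B C (c : C) :
  bilinear_map (fun (a : A) (b : B) => tmul a (tmul b c)).
Proof.
split=> [b k x y|a k x y] /=; first by rewrite (tmul_bilinear A (tens B C)).1.
by rewrite (tmul_bilinear B C).1 (tmul_bilinear A (tens B C)).2.
Qed.

Lemma tassoc_bilin A B C :
  bilinear_map (fun (u : tens A B) (c : C) => tlift (fun a b => tmul a (tmul b c)) u).
Proof.
split=> [c|v]; first exact: tlift_linear (tassoc_bilin_in A B c).
move=> k x y; rewrite /tlift /tsum scaler_sumr -big_split; apply: eq_bigr => p _ /=.
by rewrite (tmul_bilinear B C).2 (tmul_bilinear A (tens B C)).2.
Qed.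

Lemma tassoc_linear A B C : linear (@tassoc K A B C).
Proof. exact: tlift_linear (tassoc_bilin A B C). Qed.

Lemma tlift_param_bilin A B C D V (ga : A -> B -> C -> D -> V) (v : tens C D) :
  (forall c d, bilinear_map (fun a b => ga a b c d)) ->
  bilinear_map (fun a b => tlift (ga a b) v).
Proof.
move=> bg; split=> [b a x y|a b x y]; rewrite /tlift /tsum scaler_sumr -big_split;
  apply: eq_bigr => p _ /=; by [rewrite (bg _ _).1|rewrite (bg _ _).2].
Qed.

Lemma tlift2_bilin A B C D V (ga : A -> B -> C -> D -> V) :
  (forall c d, bilinear_map (fun a b => ga a b c d)) ->
  (forall a b, bilinear_map (ga a b)) ->
  bilinear_map (fun (u : tens A B) (v : tens C D) => tlift (fun a b => tlift (ga a b) v) u).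
Proof.
move=> h1 h2; split=> [v|u]; first exact: tlift_linear (tlift_param_bilin _ h1).
move=> a x y; rewrite /tlift /tsum scaler_sumr -big_split; apply: eq_bigr => p _ /=.
exact: (tlift_linear (h2 _ _)).
Qed.

Lemma interchange_bilin A B C D :
  (forall c d, bilinear_map (fun (a : A) (b : B) => tmul (tmul a c) (tmul b d) : tens (tens A C) (tens B D))) /\
  (forall a b, bilinear_map (fun (c : C) (d : D) => tmul (tmul a c) (tmul b d) : tens (tens A C) (tens B D))).
Proof.
have t1 := tmul_bilinear (tens A C) (tens B D).
split=> [c d|a b]; split=> [y z u v|y z u v] /=.
- by rewrite (tmul_bilinear A C).1 t1.1.
- by rewrite (tmul_bilinear B D).1 t1.2.
- by rewrite (tmul_bilinear A C).2 t1.1.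
- by rewrite (tmul_bilinear B D).2 t1.2.
Qed.

Lemma tinterchange_linear A B C D : linear (@tinterchange K A B C D).
Proof. by apply: tlift_linear; apply: tlift2_bilin; have [] := interchange_bilin A B C D. Qed.

Lemma bilin_sum A B V (beta : A -> B -> V) (I J : Type) (l : seq I) (l' : seq J)
    (f : I -> A) (g : J -> B) : bilinear_map beta ->
  beta (\sum_(i <- l) f i) (\sum_(j <- l') g j) = \sum_(i <- l) \sum_(j <- l') beta (f i) (g j).
Proof.
move=> [h1 h2]; rewrite (linear_sum _ _ (h1 _)); apply: eq_bigr => i _.
exact: (linear_sum _ _ (h2 _)).
Qed.

Lemma tinterchange_sum A B C D (l : seq (A * B)) (l' : seq (C * D)) :
  tinterchange (tmul (\sum_(p <- l) tmul p.1 p.2) (\sum_(q <- l') tmul q.1 q.2)) =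
  \sum_(p <- l) \sum_(q <- l') tmul (tmul p.1 q.1) (tmul p.2 q.2).
Proof.
have [h1 h2] := interchange_bilin A B C D; have h := tlift2_bilin h1 h2.
rewrite /tinterchange tlift_tmul // (bilin_sum _ _ _ _ h).
apply: eq_bigr => p _; apply: eq_bigr => q _.
rewrite tlift_tmul ?tlift_tmul //; exact: (tlift_param_bilin _ h1).
Qed.

(** Induction on the number of terms of [t]. If [a] is the left factor of the
    first term and [Phi i a] is not 0, applying [Phi i] to the left factors gives a
    linear relation between the right factors; it expresses the first of them by
    the others, and [t] by one term less. *)
Lemma tens_separated A B (I J : Type) (Phi : I -> A -> K^o) (Psi : J -> B -> K^o) :
  (forall i, linear (Phi i)) -> (forall j, linear (Psi j)) ->
  (forall a, (forall i, Phi i a = 0) -> a = 0) ->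
  (forall b, (forall j, Psi j b = 0) -> b = 0) ->
  forall t : tens A B,
  (forall i j, tlift (fun a b => Phi i a * Psi j b : K^o) t = 0) -> t = 0.
Proof.
move=> lP lQ sP sQ t; have [s ->] := tens_span t.
elim: {t}(size s) {-2}s (erefl (size s)) => [|r IH] [|[a b] s'] //=.
- by rewrite big_nil.
- move=> [sr] h.
have bPQ i j := bilin_prod (lP i) (lQ j).
have ltP i j := tlift_linear (bPQ i j).
have [a0|/existsNP[i /eqP ai]] := pselect (forall i, Phi i a = 0).
  have {}a0 := sP _ a0; move: h; rewrite a0 => h.
  have t0 : tmul (0 : A) b = 0.
    by have := bilinear_mapZl 0 0 b (tmul_bilinear A B); rewrite !scale0r.
  rewrite big_cons /= t0 add0r; apply: IH => // i j.
  by have := h i j; rewrite big_cons /= t0 add0r.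
have bE : b = - \sum_(p <- s') (Phi i p.1 / Phi i a) *: p.2.
  apply/eqP; rewrite -subr_eq0 opprK; apply/eqP; apply: sQ => j.
  have := h i j; rewrite (linear_sum _ _ (ltP i j)) big_cons /= tlift_tmul // => hij.
  rewrite (linear_D _ _ (lQ j)) (linear_sum _ _ (lQ j)).
  apply: (mulfI ai); rewrite mulr0 mulrDr -[RHS]hij; congr (_ + _).
  rewrite mulr_sumr; apply: eq_bigr => p _; rewrite tlift_tmul //.
  by rewrite (linear_Z _ _ (lQ j)) -[_ *: _]/(_ * _) mulrA [Phi i a * _]mulrC divfK.
(* The first right factor [b] has been eliminated by means of [bE]. *)
pose s2 := [seq (p.1 - (Phi i p.1 / Phi i a) *: a, p.2) | p <- s'].
have tE : \sum_(p <- (a, b) :: s') tmul p.1 p.2 = \sum_(p <- s2) tmul p.1 p.2.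
  rewrite big_cons /s2 big_map /= bE -scaleN1r (linear_Z _ _ ((tmul_bilinear A B).2 a)).
  rewrite (linear_sum _ _ ((tmul_bilinear A B).2 a)) scaler_sumr -big_split /=.
  apply: eq_bigr => p _; rewrite (linear_D _ _ ((tmul_bilinear A B).1 p.2)) addrC.
  congr (_ + _); rewrite -scaleNr (linear_Z _ _ ((tmul_bilinear A B).2 a)).
  by rewrite (linear_Z _ _ ((tmul_bilinear A B).1 p.2)) scalerA mulN1r.
rewrite tE; apply: IH; first by rewrite size_map.
by move=> i' j; rewrite -tE; exact: h.
Qed.

End TensorAlgebra.

Section PolynomialSequences.
Variable K : numFieldType.

(** Strong induction on the size: the difference of the monomial of degree n + 1 is
    n + 1 times the monomial of degree n, up to lower terms. *)
Lemma antidifference (q : {poly K}) : exists Q : {poly K},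
  Q \Po ('X + 1) - Q = q.
Proof.
elim: {q}(size q) {-2}q (leqnn (size q)) => [|n IH] q.
  by rewrite leqn0 size_poly_eq0 => /eqP ->; exists 0; rewrite comp_poly0 subr0.
(* The leading term of the antidifference. *)
move=> qn; pose Q1 : {poly K} := (q`_n / n.+1%:R) *: 'X^(n.+1).
have E : Q1 \Po ('X + 1) - Q1 =
    (q`_n / n.+1%:R) *: \sum_(i < n.+1) ('X^i *+ 'C(n.+1, i)).
  rewrite /Q1 comp_polyZ -scalerBr; congr (_ *: _).
  rewrite comp_Xn_poly ['X + 1]addrC exprDn big_ord_recr /= binn subnn expr0 mul1r mulr1n.
  by rewrite addrK; apply: eq_bigr => i _; rewrite expr1n mul1r.
have [|Q2 E2] := IH (q - (Q1 \Po ('X + 1) - Q1)).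
  apply/leq_sizeP => j; rewrite leq_eqVlt => /predU1P[<-|nj].
    rewrite coefB E coefZ coef_sum big_ord_recr /= big1 => [|i _].
      by rewrite coefMn coefXn eqxx add0r binSn divfK ?subrr ?pnatr_eq0.
    by rewrite coefMn coefXn gtn_eqF ?mul0rn.
  rewrite coefB E coefZ coef_sum big1 ?mulr0 ?subr0 => [|i _].
    by move/leq_sizeP : qn; apply.
  by rewrite coefMn coefXn gtn_eqF ?mul0rn //; exact: leq_ltn_trans (leq_ord i) nj.
exists (Q1 + Q2); rewrite comp_polyD opprD addrACA E2 addrCA.
by rewrite subrr addr0.
Qed.

Section Vector.
Variable V : lmodType K.
Implicit Types (u : nat -> V) (v : V).

(** [u] is a polynomial function with vector coefficients and [v] is its value at
    -1. A relation rather than a function, so that its stability under the linear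
    and bilinear operations is visible without uniqueness. *)
Definition polyval u v := exists l : seq ({poly K} * V),
  (forall j, u j = \sum_(q <- l) q.1.[j%:R] *: q.2) /\ v = \sum_(q <- l) q.1.[-1] *: q.2.

Lemma polyval_cst v : polyval (fun=> v) v.
Proof. by exists [:: (1, v)]; split=> [j|]; rewrite big_seq1 hornerC scale1r. Qed.

Lemma polyval_lin a u v u' v' : polyval u v -> polyval u' v' ->
  polyval (fun j => a *: u j + u' j) (a *: v + v').
Proof.
move=> [l [hu ->]] [l' [hu' ->]].
exists ([seq (q.1, a *: q.2) | q <- l] ++ l'); split=> [j|].
  rewrite big_cat big_map hu hu' scaler_sumr; congr (_ + _).
  by apply: eq_bigr => q _; rewrite !scalerA mulrC.
rewrite big_cat big_map scaler_sumr; congr (_ + _).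
by apply: eq_bigr => q _; rewrite !scalerA mulrC.
Qed.

Lemma polyvalD u v u' v' : polyval u v -> polyval u' v' ->
  polyval (fun j => u j + u' j) (v + v').
Proof.
move=> h h'; have := polyval_lin 1 h h'; rewrite scale1r.
by congr polyval; apply/funext => j; rewrite scale1r.
Qed.

Lemma polyval_sum (I : eqType) (l : seq I) (F : I -> nat -> V) (f : I -> V) :
  (forall i, i \in l -> polyval (F i) (f i)) ->
  polyval (fun j => \sum_(i <- l) F i j) (\sum_(i <- l) f i).
Proof.
elim: l => [_|i l IH h].
  rewrite big_nil (_ : (fun _ => _) = fun=> 0); first exact: polyval_cst.
  by apply/funext => j; rewrite big_nil.
rewrite big_cons (_ : (fun _ => _) = fun j => F i j + \sum_(i <- l) F i j).
  apply: polyvalD; first by apply: h; rewrite mem_head.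
  by apply: IH => i' il; apply: h; rewrite inE il orbT.
by apply/funext => j; rewrite big_cons.
Qed.

(** The value at -1 of the shifted function is the value at 0 of the original one;
    this is how the counit appears in the antipode axioms. *)
Lemma polyval_shift u v : polyval u v -> polyval (fun j => u j.+1) (u 0%N).
Proof.
move=> [l [hu _]]; exists [seq (q.1 \Po ('X + 1), q.2) | q <- l]; split=> [j|].
  rewrite hu big_map; apply: eq_bigr => q _ /=.
  by rewrite horner_comp !hornerE natr1.
rewrite hu big_map; apply: eq_bigr => q _ /=.
by rewrite horner_comp !hornerE addNr.
Qed.

Lemma polyval_antidifference u v : polyval (fun j => u j.+1 - u j) v ->
  exists w, polyval u w.
Proof.
move=> [l [hu _]].
pose Q q := projT1 (cid (antidifference q)).
have hQ q : Q q \Po ('X + 1) - Q q = q by exact: projT2 (cid (antidifference q)).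
pose l' := (1, u 0%N) :: [seq (Q q.1 - (Q q.1).[0]%:P, q.2) | q : {poly K} * V <- l].
exists (\sum_(q <- l') q.1.[-1] *: q.2); exists l'; split=> //.
elim=> [|j IH].
  rewrite big_cons big_map hornerC scale1r big1 ?addr0 // => q _ /=.
  by rewrite !hornerE subrr scale0r.
rewrite -[LHS](subrK (u j)) hu IH !big_cons !big_map !hornerC addrCA; congr (_ + _).
rewrite -big_split; apply: eq_bigr => q _ /=; rewrite -scalerDl; congr (_ *: _).
have := congr1 (fun p => p.[j%:R]) (hQ q.1).
rewrite !hornerE horner_comp !hornerE natr1 => <-.
by rewrite /= subrK.
Qed.

(** A polynomial that vanishes at all natural numbers is 0 in characteristic 0;
    the separating functionals reduce vectors to scalars. *)
Lemma polyval_unique (I : Type) (Phi : I -> V -> K^o) u v v' :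
  (forall i, linear (Phi i)) -> (forall x, (forall i, Phi i x = 0) -> x = 0) ->
  polyval u v -> polyval u v' -> v = v'.
Proof.
move=> lP sP h h'; apply/eqP; rewrite -subr_eq0; apply/eqP.
have [l [hl hv]] := polyval_lin (-1) h' h.
have -> : v - v' = -1 *: v' + v by rewrite scaleN1r addrC.
rewrite hv; apply: sP => i.
pose p : {poly K} := \sum_(q <- l) Phi i q.2 *: q.1.
have pE x : p.[x] = Phi i (\sum_(q <- l) q.1.[x] *: q.2).
  rewrite /p horner_sum (linear_sum _ _ (lP i)); apply: eq_bigr => q _.
  by rewrite hornerZ (linear_Z _ _ (lP i)) mulrC.
have p0 : p = 0.
  apply/eqP/negPn/negP => pn0.
  suff: (size [seq (j%:R : K) | j <- iota 0 (size p)] < size p)%N.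
    by rewrite size_map size_iota ltnn.
  apply: max_poly_roots pn0 _ _.
    apply/allP => _ /mapP[j _ ->]; rewrite /root pE -hl scaleN1r addNr.
    by rewrite (linear_0 (lP i)).
  rewrite map_inj_uniq ?iota_uniq // => a b /eqP; rewrite eqr_nat.
  by move/eqP.
by rewrite -pE p0 horner0.
Qed.

End Vector.

Lemma polyval_map (V W : lmodType K) (f : V -> W) u v : linear f ->
  polyval u v -> polyval (fun j => f (u j)) (f v).
Proof.
move=> lf [l [hu ->]]; exists [seq (q.1, f q.2) | q <- l]; split=> [j|].
  by rewrite hu (linear_sum _ _ lf) big_map; apply: eq_bigr => q _; rewrite (linear_Z _ _ lf).
by rewrite (linear_sum _ _ lf) big_map; apply: eq_bigr => q _; rewrite (linear_Z _ _ lf).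
Qed.

Lemma polyval_bilin (V V' W : lmodType K) (beta : V -> V' -> W) u v u' v' :
  bilinear_map beta -> polyval u v -> polyval u' v' ->
  polyval (fun j => beta (u j) (u' j)) (beta v v').
Proof.
move=> [b1 b2] [l [hu ->]] [l' [hu' ->]].
have E x : beta (\sum_(q <- l) q.1.[x] *: q.2) (\sum_(q <- l') q.1.[x] *: q.2) =
  \sum_(r <- [seq (q.1 * q'.1, beta q.2 q'.2) | q <- l, q' <- l']) r.1.[x] *: r.2.
  rewrite big_allpairs_dep (linear_sum _ _ (b1 _)); apply: eq_bigr => q _.
  rewrite (linear_Z _ _ (b1 _)) (linear_sum _ _ (b2 _)) scaler_sumr.
  by apply: eq_bigr => q' _; rewrite (linear_Z _ _ (b2 _)) scalerA hornerM.
exists [seq (q.1 * q'.1, beta q.2 q'.2) | q <- l, q' <- l'].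
by split=> [j|]; rewrite -?E // hu hu'.
Qed.

End PolynomialSequences.

(** * The coalgebra of point distributions *)

Section DistributionCoalgebra.
Variables (R : realType) (k : scalar_kind) (n : nat) (D : manifold R n) (e : D).
Local Notation K := (scalars R k).
Local Notation A := (E' k e).
Local Notation X := (F_coalg k e).
Implicit Types (S T : A) (g h : D -> K^o) (G : prod_manifold D D -> K^o).

Lemma ap_linear g : linear (fun T : A => ap T g : K^o).
Proof. by move=> a S T; rewrite ap_linE. Qed.

Lemma ap_separated T : (forall f : Cinf k D, ap T (val f) = 0) -> T = 0.
Proof.
move=> h; apply: E'_ext => g sg; rewrite ap_0 -(h (mkCinf g)).
by rewrite mkCinfE.
Qed.

(** The elementary test functionals on the tensor square: by [ap2_separated] they
    separate tensors, so identities between tensors are checked on them. *)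
Definition ap2 g h : tens A A -> K^o := tlift (fun S T => ap S g * ap T h : K^o).

Lemma ap2_bilin g h : bilinear_map (fun S T : A => ap S g * ap T h : K^o).
Proof. by apply: bilin_prod; exact: ap_linear. Qed.

Lemma ap2_linear g h : linear (ap2 g h).
Proof. exact: tlift_linear (ap2_bilin g h). Qed.

Lemma ap2_tmul g h S T : ap2 g h (tmul S T) = ap S g * ap T h.
Proof. by rewrite /ap2 tlift_tmul //; exact: ap2_bilin. Qed.

Lemma ap2_separated (t u : tens A A) :
  (forall g h, smooth_fun g -> smooth_fun h -> ap2 g h t = ap2 g h u) -> t = u.
Proof.
move=> h; apply/eqP; rewrite -subr_eq0; apply/eqP.
apply: (@tens_separated K A A (Cinf k D) (Cinf k D) (fun f T => ap T (val f))
  (fun f T => ap T (val f))).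
- by move=> f; exact: ap_linear.
- by move=> f; exact: ap_linear.
- exact: ap_separated.
- exact: ap_separated.
- move=> f g; rewrite -/(ap2 (val f) (val g)) -scaleN1r addrC.
  rewrite (ap2_linear (val f) (val g)) h; [|exact: Cinf_smooth|exact: Cinf_smooth].
  by rewrite scaleN1r addNr.
Qed.

Lemma F2_bilin : bilinear_map (@F2 R k n n D D e e).
Proof.
split=> [T a S1 S2|S a T1 T2]; apply: E'_ext => G sG; rewrite ap_linE !ap_F2 //.
have -> : (fun x => ap (a *: T1 + T2) (fun y => G (x, y))) =
    a *: ((fun x => ap T1 (fun y => G (x, y))) : D -> K^o) + (fun x => ap T2 (fun y => G (x, y))).
  by apply/funext => x; rewrite ap_linE.
by rewrite ap_lin //; exact: smooth_ap_slice.
Qed.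

Lemma F2_tens_linear : linear (@F2_tens R k n n D D e e).
Proof. exact: tlift_linear F2_bilin. Qed.

Lemma F2_tens_tmul S T : F2_tens (tmul S T) = F2 S T.
Proof. by rewrite /F2_tens tlift_tmul //; exact: F2_bilin. Qed.

Lemma tensor_smooth g h : smooth_fun g -> smooth_fun h ->
  smooth_fun ((fun p => g p.1 * h p.2) : prod_manifold D D -> K^o).
Proof.
move=> sg sh; apply: (@smooth_funM R k _ (prod_manifold D D) (g \o fst) (h \o snd)).
  exact: (smooth_fun_pullback (@smooth_map_fst R n n D D) sg).
exact: (smooth_fun_pullback (@smooth_map_snd R n n D D) sh).
Qed.

Lemma ap_mulr T a f : smooth_fun f -> ap T (fun x => f x * a) = ap T f * a.
Proof.
by move=> sf; rewrite mulrC -apZ //; congr (ap T _); apply/funext => x; rewrite mulrC.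
Qed.

Lemma ap2E g h t : smooth_fun g -> smooth_fun h ->
  ap2 g h t = ap (F2_tens t) ((fun p => g p.1 * h p.2) : prod_manifold D D -> K^o).
Proof.
move=> sg sh.
apply: (@tens_lin_eq K A A K^o (ap2 g h) (fun t => ap (F2_tens t)
  ((fun p => g p.1 * h p.2) : prod_manifold D D -> K^o))).
- exact: ap2_linear.
- by move=> a u v; rewrite F2_tens_linear ap_linE.
move=> S T; rewrite ap2_tmul F2_tens_tmul ap_F2 /=; last exact: tensor_smooth.
rewrite -ap_mulr //; congr (ap S _); apply/funext => x.
by rewrite apZ.
Qed.

(** The tensor is obtained from [ap_diag]; this gives a meaning to the inverse that
    occurs in the definition of the coproduct. *)
Lemma comul_exists T : exists t : tens A A,
  F2_tens t = E'_map (fun x => (x, x) : prod_manifold D D) (e, e) T.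
Proof.
have [c Ac ce] := atlas_cover e; have [cl ->] := E'_span T Ac ce.
exists (\sum_(q <- cl) q.1 *: \sum_(p <- splits q.2) tmul (chart_dist k e c p.1) (chart_dist k e c p.2)).
apply: E'_ext => G sG; rewrite ap_map //; last exact: smooth_map_diag.
rewrite (linear_sum _ _ F2_tens_linear).
under eq_bigr do rewrite (linear_Z _ _ F2_tens_linear) (linear_sum _ _ F2_tens_linear).
rewrite !ap_bigE; apply: eq_bigr => q _; congr (_ * _).
rewrite (ap_diag _ Ac ce sG).
under [X in ap X G]eq_bigr do rewrite F2_tens_tmul -[F2 _ _]scale1r.
by rewrite ap_bigE; apply: eq_bigr => p _; rewrite mul1r.
Qed.

Lemma ap_comul T G : smooth_fun G ->
  ap (F2_tens (comul X T)) G = ap T (fun x => G (x, x)).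
Proof.
move=> sG; rewrite /= /F2_inv.
have /(xgetPex 0) /= -> := comul_exists T.
by rewrite ap_map //; exact: smooth_map_diag.
Qed.

(** The coproduct is dual to the product of functions. Together with
    [ap2_separated], this characterises it. *)
Lemma ap2_comul g h T : smooth_fun g -> smooth_fun h ->
  ap2 g h (comul X T) = ap T (fun x => g x * h x).
Proof. by move=> sg sh; rewrite ap2E // ap_comul //; exact: tensor_smooth. Qed.

Lemma comul_linear : linear (comul X).
Proof.
move=> a S T; apply: ap2_separated => g h sg sh.
by rewrite (ap2_linear g h) !ap2_comul // ap_linE.
Qed.

Lemma E'_counitE T : E'_counit T = ap T (fun=> 1).
Proof. by []. Qed.

Lemma counitE T : counit X T = ap T (fun=> 1).
Proof. by []. Qed.

Lemma one_smooth : smooth_fun (fun _ : D => 1 : K^o).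
Proof. exact: smooth_fun_cst. Qed.

Definition ap3 g h l : tens A (tens A A) -> K^o :=
  tlift (fun S t => ap S g * ap2 h l t : K^o).

Lemma ap3_bilin g h l : bilinear_map (fun (S : A) t => ap S g * ap2 h l t : K^o).
Proof. by apply: bilin_prod; [exact: ap_linear|exact: ap2_linear]. Qed.

Lemma ap3_linear g h l : linear (ap3 g h l).
Proof. exact: tlift_linear (ap3_bilin g h l). Qed.

Lemma ap3_separated (t u : tens A (tens A A)) :
  (forall g h l, smooth_fun g -> smooth_fun h -> smooth_fun l ->
    ap3 g h l t = ap3 g h l u) -> t = u.
Proof.
move=> E; apply/eqP; rewrite -subr_eq0; apply/eqP.
apply: (@tens_separated K A (tens A A) (Cinf k D) (Cinf k D * Cinf k D)
  (fun f T => ap T (val f)) (fun f t => ap2 (val f.1) (val f.2) t)).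
- by move=> f; exact: ap_linear.
- by move=> f; exact: ap2_linear.
- exact: ap_separated.
- move=> v h; apply: ap2_separated => g l sg sl.
  by have := h (mkCinf g, mkCinf l); rewrite /= !mkCinfE // => ->; rewrite (linear_0 (ap2_linear g l)).
- move=> f [g l] /=; rewrite -/(ap3 (val f) (val g) (val l)) -scaleN1r addrC.
  rewrite (ap3_linear (val f) (val g) (val l)) E; try exact: Cinf_smooth.
  by rewrite scaleN1r addNr.
Qed.

(** Both sides are linear in [u]. *)
Lemma ap3_assoc g h l (u : tens A A) S : ap3 g h l (tassoc (tmul u S)) = ap2 g h u * ap S l.
Proof.
rewrite /tassoc tlift_tmul; last exact: tassoc_bilin.
have l3 := ap3_linear g h l.
apply: (@tens_lin_eq K A A K^o (fun u => ap3 g h l (tlift (fun a b : A => tmul a (tmul b S)) u))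
  (fun u => ap2 g h u * ap S l : K^o)).
- exact: linear_comp (tlift_linear (tassoc_bilin_in A A S)) l3.
- by move=> a x y; rewrite (ap2_linear g h) mulrDl -scalerAl.
- move=> a b; rewrite tlift_tmul; last exact: tassoc_bilin_in.
  rewrite /ap3 tlift_tmul; last exact: ap3_bilin.
  by rewrite !ap2_tmul mulrA.
Qed.

(** Coassociativity, the counit laws and the axioms on the unit become
    associativity of the product of functions, neutrality of the constant function
    1 and multiplicativity of the evaluation at [e]. *)
Lemma F_C3_coalgebra : is_C3_coalgebra X.
Proof.
split.
- split; first exact: comul_linear.
  by move=> a S T; rewrite !counitE ap_linE.
- move=> T; apply: ap3_separated => g h l sg sh sl.
  have l3 := ap3_linear g h l.
  have ll : linear (fun t => ap3 g h l (tassoc (tmap (comul X) id t))).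
    apply: linear_comp l3; apply: linear_comp (@tassoc_linear K A A A).
    by apply: tmap_linear; [exact: comul_linear|exact: id_linear].
  have lr : linear (fun t => ap3 g h l (tmap id (comul X) t)).
    apply: linear_comp l3; by apply: tmap_linear; [exact: id_linear|exact: comul_linear].
  have sgh := smooth_funM sg sh; have shl := smooth_funM sh sl.
  have -> : ap3 g h l (tassoc (tmap (comul X) id (comul X T))) =
      ap2 (fun x => g x * h x) l (comul X T).
    apply: (tens_lin_eq ll (ap2_linear _ _)) => a b.
    rewrite tmap_tmul; [|exact: comul_linear|exact: id_linear].
    by rewrite ap3_assoc ap2_comul // ap2_tmul.
  have -> : ap3 g h l (tmap id (comul X) (comul X T)) =
      ap2 g (fun x => h x * l x) (comul X T).
    apply: (tens_lin_eq lr (ap2_linear _ _)) => a b.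
    rewrite tmap_tmul; [|exact: id_linear|exact: comul_linear].
    rewrite /ap3 tlift_tmul; last exact: ap3_bilin.
    by rewrite ap2_comul // ap2_tmul.
  rewrite !ap2_comul //; congr (ap T _); apply/funext => x; by rewrite mulrA.
- move=> T; split; apply: E'_ext => g sg.
  + have bb : bilinear_map (fun b c : A => counit X b *: c).
      split=> [c a x y|b a x y] /=.
        by rewrite !E'_counitE ap_linE scalerDl scalerA.
      by rewrite scalerDr !scalerA mulrC.
    have -> : ap (tlift (fun b c => counit X b *: c) (comul X T)) g = ap2 (fun=> 1) g (comul X T).
      apply: (tens_lin_eq (f := fun t => ap (tlift (fun b c : A => counit X b *: c) t) g : K^o)).
      * exact: linear_comp (tlift_linear bb) (ap_linear g).
      * exact: ap2_linear.
      * by move=> a b; rewrite tlift_tmul // ap2_tmul ap_scale counitE.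
    rewrite ap2_comul //; last exact: one_smooth.
    by congr (ap T _); apply/funext => x; rewrite mul1r.
  + have bb : bilinear_map (fun b c : A => counit X c *: b).
      split=> [c a x y|b a x y] /=.
        by rewrite scalerDr !scalerA mulrC.
      by rewrite !E'_counitE ap_linE scalerDl scalerA.
    have -> : ap (tlift (fun b c => counit X c *: b) (comul X T)) g = ap2 g (fun=> 1) (comul X T).
      apply: (tens_lin_eq (f := fun t => ap (tlift (fun b c : A => counit X c *: b) t) g : K^o)).
      * exact: linear_comp (tlift_linear bb) (ap_linear g).
      * exact: ap2_linear.
      * by move=> a b; rewrite tlift_tmul // ap2_tmul ap_scale counitE mulrC.
    rewrite ap2_comul //; last exact: one_smooth.
    by congr (ap T _); apply/funext => x; rewrite mulr1.
- apply: ap2_separated => g h sg sh; rewrite ap2_comul // ap2_tmul.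
  by rewrite !ap_dirac //; exact: smooth_funM.
- by rewrite counitE ap_dirac //; exact: one_smooth.
Qed.

Lemma F_cocommutative : cocommutative X.
Proof.
move=> T; apply: ap2_separated => g h sg sh.
have -> : ap2 g h (tswap (comul X T)) = ap2 h g (comul X T).
  apply: (tens_lin_eq (f := fun t => ap2 g h (tswap t))).
  - exact: linear_comp (@tswap_linear K A A) (ap2_linear g h).
  - exact: ap2_linear.
  - move=> a b; rewrite /tswap tlift_tmul ?ap2_tmul 1?mulrC //.
    exact: tswap_bilin.
rewrite !ap2_comul //; congr (ap T _); apply/funext => x; by rewrite mulrC.
Qed.

End DistributionCoalgebra.

(** * The dialgebra of a Lie dimonoid and its antipode *)

Section DistributionProduct.
Variables (R : realType) (k : scalar_kind) (n : nat) (D : manifold R n) (e : D).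
Local Notation K := (scalars R k).
Local Notation A := (E' k e).
Local Notation X := (F_coalg k e).
Implicit Types (S T U : A) (g h : D -> K^o).

Definition smooth_op (op : D -> D -> D) :=
  smooth_map (fun p : prod_manifold D D => op p.1 p.2) /\ op e e = e.

Section OneOperation.
Variable op : D -> D -> D.
Hypothesis sop : smooth_op op.
Local Notation mu := (F_mul k e op).

Lemma op_smooth g : smooth_fun g ->
  smooth_fun ((fun p => g (op p.1 p.2)) : prod_manifold D D -> K^o).
Proof. exact: (smooth_fun_pullback sop.1). Qed.

Lemma ap_F_mul g (t : tens A A) : smooth_fun g ->
  ap (mu t) g = ap (F2_tens t) ((fun p => g (op p.1 p.2)) : prod_manifold D D -> K^o).
Proof. by move=> sg; rewrite /F_mul ap_map //; [exact: sop.1|exact: sop.2]. Qed.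

Lemma F_mul_linear : linear mu.
Proof.
by move=> a u v; apply: E'_ext => g sg; rewrite ap_linE !ap_F_mul // F2_tens_linear ap_linE.
Qed.

Lemma ap_mul S T g : smooth_fun g ->
  ap (mu (tmul S T)) g = ap S (fun x => ap T (fun y => g (op x y))).
Proof.
by move=> sg; rewrite ap_F_mul // F2_tens_tmul ap_F2 //; exact: op_smooth.
Qed.

Lemma mul_bilin : bilinear_map (fun S T : A => mu (tmul S T)).
Proof. exact: tlift_bilin_comp (tmul_bilinear A A) F_mul_linear. Qed.

(** Both coproducts are expanded into elementary tensors. Evaluating first those of
    [a], for fixed terms of the coproduct of [b], and then those of [b], the two
    sides become the value of [a] and [b] on the product of [g] and [h] composed
    with the operation. *)
Lemma F_mul_comul (u : tens A A) :
  comul X (mu u) = tmap mu mu (comul (coalg_tensor X X) u).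
Proof.
have l2 : linear (fun u => tmap mu mu (comul (coalg_tensor X X) u)).
  apply: linear_comp (tmap_linear F_mul_linear F_mul_linear).
  apply: linear_comp (@tinterchange_linear _ _ _ _ _).
  by apply: tmap_linear; exact: comul_linear.
have l1 : linear (fun u => comul X (mu u)).
  exact: linear_comp F_mul_linear (@comul_linear _ _ _ _ _).
apply: (tens_lin_eq l1 l2) => a b.
apply: ap2_separated => g h sg sh; rewrite ap2_comul // ap_mul; last exact: smooth_funM.
have -> : comul (coalg_tensor X X) (tmul a b) = tinterchange (tmul (comul X a) (comul X b)).
  by rewrite [LHS]/= tmap_tmul //; exact: comul_linear.
have [pl pE] := tens_span (comul X a); have [ql qE] := tens_span (comul X b).
rewrite {1}pE {1}qE tinterchange_sum.
rewrite (linear_sum _ _ (tmap_linear F_mul_linear F_mul_linear)) (linear_sum _ _ (ap2_linear g h)).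
under eq_bigr do rewrite (linear_sum _ _ (tmap_linear F_mul_linear F_mul_linear)) (linear_sum _ _ (ap2_linear g h)).
rewrite exchange_big /=.
have sG f (S : A) : smooth_fun f -> smooth_fun (fun x => ap S (fun y => f (op x y)) : K^o).
  by move=> sf; exact: (smooth_ap_slice S (op_smooth sf)).
have -> : (fun x => ap b (fun y => g (op x y) * h (op x y))) =
   (fun x => \sum_(q <- ql) 1 * (ap q.1 (fun y => g (op x y)) * ap q.2 (fun y => h (op x y)))).
  apply/funext => x.
  rewrite -(ap2_comul b (smooth_slice x (op_smooth sg)) (smooth_slice x (op_smooth sh))).
  rewrite qE (linear_sum _ _ (ap2_linear _ _)); apply: eq_bigr => q _.
  by rewrite ap2_tmul mul1r.
rewrite ap_sum => [|q]; last by apply: smooth_funM; exact: sG.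
apply: eq_bigr => q _; rewrite mul1r -ap2_comul; try exact: sG.
rewrite pE (linear_sum _ _ (ap2_linear _ _)); apply: eq_bigr => p _.
rewrite tmap_tmul; [|exact: F_mul_linear|exact: F_mul_linear].
by rewrite !ap2_tmul !ap_mul.
Qed.

Lemma F_mul_C3_morphism : C3_morphism (coalg_tensor X X) X mu.
Proof.
split; first exact: F_mul_linear.
- exact: F_mul_comul.
- have bc : bilinear_map (fun a b : A => counit X a * counit X b : K^o).
    by apply: bilin_prod; exact: (ap_linear (fun=> 1)).
  apply: (tens_lin_eq (f := fun u => counit X (mu u) : K^o)).
  + exact: linear_comp F_mul_linear (ap_linear _).
  + exact: tlift_linear bc.
  + move=> a b; rewrite [RHS]/= tlift_tmul // !counitE ap_mul; last exact: one_smooth.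
    rewrite -[ap a (fun=> 1) * _]ap_mulr; last exact: one_smooth.
    by congr (ap a _); apply/funext => x; rewrite mul1r.
- apply: E'_ext => g sg; rewrite ap_mul // [grouplike1 _]/=.
  rewrite ap_dirac; last exact: (smooth_ap_slice _ (op_smooth sg)).
  rewrite !ap_dirac ?sop.2 //; exact: (smooth_slice e (op_smooth sg)).
Qed.

End OneOperation.

Lemma eq_ap3 S T U (f f' : D -> D -> D -> K^o) : (forall x y z, f x y z = f' x y z) ->
  ap S (fun x => ap T (fun y => ap U (fun z => f x y z))) =
  ap S (fun x => ap T (fun y => ap U (fun z => f' x y z))).
Proof.
move=> ff'; have -> // : f = f'.
by apply/funext => x; apply/funext => y; apply/funext => z.
Qed.

Lemma ap_mul_l op1 op2 S T U g : smooth_op op1 -> smooth_op op2 -> smooth_fun g ->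
  ap (F_mul k e op2 (tmul (F_mul k e op1 (tmul S T)) U)) g =
  ap S (fun x => ap T (fun y => ap U (fun z => g (op2 (op1 x y) z)))).
Proof.
move=> s1 s2 sg; rewrite (ap_mul s2 _ U sg); apply: (ap_mul s1).
exact: (smooth_ap_slice U (op_smooth s2 sg)).
Qed.

Lemma ap_mul_r op1 op2 S T U g : smooth_op op1 -> smooth_op op2 -> smooth_fun g ->
  ap (F_mul k e op1 (tmul S (F_mul k e op2 (tmul T U)))) g =
  ap S (fun x => ap T (fun y => ap U (fun z => g (op1 x (op2 y z))))).
Proof.
move=> s1 s2 sg; rewrite (ap_mul s1 S _ sg); congr (ap S _); apply/funext => x.
by apply: (ap_mul s2); exact: (smooth_slice x (op_smooth s1 sg)).
Qed.

Variables vd dv : D -> D -> D.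
Hypothesis hD : barunital_Lie_dimonoid e vd dv.

Lemma dimonoid_smooth : smooth_op vd /\ smooth_op dv.
Proof.
have [s1 s2 [_ _ _ _ [e1 e2]]] := hD.
by split; split.
Qed.

Lemma F_barunital_dialgebra : barunital_dialgebra (dirac_at k e) (F_mul k e vd) (F_mul k e dv).
Proof.
have [_ _ [[avd adv] d1 d2 d3 [e1 e2]]] := hD; have [svd sdv] := dimonoid_smooth.
split; [exact: F_mul_linear|exact: F_mul_linear|split].
- split=> S T U; apply: E'_ext => g sg.
    apply: (etrans (ap_mul_r S T U svd svd sg)); apply/esym/(etrans (ap_mul_l S T U svd svd sg))/esym.
    by apply: eq_ap3 => x y z; rewrite avd.
  apply: (etrans (ap_mul_r S T U sdv sdv sg)); apply/esym/(etrans (ap_mul_l S T U sdv sdv sg))/esym.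
  by apply: eq_ap3 => x y z; rewrite adv.
- move=> S T U; apply: E'_ext => g sg.
  apply: (etrans (ap_mul_l S T U svd svd sg)); apply/esym/(etrans (ap_mul_l S T U sdv svd sg))/esym.
  by apply: eq_ap3 => x y z; rewrite d1.
- move=> S T U; apply: E'_ext => g sg.
  apply: (etrans (ap_mul_r S T U sdv sdv sg)); apply/esym/(etrans (ap_mul_r S T U sdv svd sg))/esym.
  by apply: eq_ap3 => x y z; rewrite d2.
- move=> S T U; apply: E'_ext => g sg.
  apply: (etrans (ap_mul_l S T U svd sdv sg)); apply/esym/(etrans (ap_mul_r S T U svd sdv sg))/esym.
  by apply: eq_ap3 => x y z; rewrite d3.
- split=> S; apply: E'_ext => g sg.
    rewrite (ap_mul svd _ S sg) ap_dirac; last exact: (smooth_ap_slice _ (op_smooth svd sg)).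
    by congr (ap S _); apply/funext => y; rewrite e1.
  rewrite (ap_mul sdv S _ sg); congr (ap S _); apply/funext => x.
  by rewrite ap_dirac ?e2 //; exact: (smooth_slice x (op_smooth sdv sg)).
Qed.

Hypothesis bal : balanced e vd dv.

Lemma F_balanced : balanced (dirac_at k e) (fun a b => F_mul k e vd (tmul a b))
  (fun a b => F_mul k e dv (tmul a b)).
Proof.
have [svd sdv] := dimonoid_smooth.
move=> S; apply: E'_ext => g sg; apply: (etrans (ap_mul svd S _ sg)).
apply/esym/(etrans (ap_mul sdv _ S sg))/esym.
rewrite [RHS]ap_dirac; last exact: (smooth_ap_slice _ (op_smooth sdv sg)).
congr (ap S _); apply/funext => x; rewrite ap_dirac ?bal //.
exact: (smooth_slice x (op_smooth svd sg)).
Qed.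

(** The power [j] of [x], ending with the bar-unit: the innermost factor [e] makes
    [power 0] constant, and the pushforward by it the counit times the unit. *)
Fixpoint power (j : nat) (x : D) : D := if j is j'.+1 then vd x (power j' x) else e.

Lemma power_smooth j : smooth_map (power j) /\ power j e = e.
Proof.
have [[svd vde] _] := dimonoid_smooth; elim: j => [|j [sp pe]].
  by split=> //; exact: smooth_map_cst.
split; last by rewrite /= pe.
have h := smooth_map_pair (smooth_map_id D) sp.
exact: (smooth_map_comp h svd).
Qed.

(** The two multiplications are exchanged at the innermost factor, where
    balancedness applies. *)
Lemma power_dv j x : dv (power j x) x = power j.+1 x.
Proof.
have [_ _ [_ _ _ d3 _]] := hD.
elim: j => [|j IH] /=; first by rewrite -bal.
by rewrite d3 IH.
Qed.

Definition power_map (j : nat) (T : A) : A := E'_map (power j) e T.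

Lemma ap_power j T g : smooth_fun g -> ap (power_map j T) g = ap T (g \o power j).
Proof. by move=> sg; rewrite /power_map ap_map //; have [] := power_smooth j. Qed.

Lemma power_fun_smooth j g : smooth_fun g -> smooth_fun (g \o power j).
Proof. by move=> sg; apply: smooth_fun_pullback sg; exact: (power_smooth j).1. Qed.

Lemma power_map_linear j : linear (power_map j).
Proof. by move=> a S T; apply: E'_ext => g sg; rewrite ap_linE !ap_power // ap_linE. Qed.

Lemma power_map_comul j T : comul X (power_map j T) =
  tmap (power_map j) (power_map j) (comul X T).
Proof.
apply: ap2_separated => g h sg sh; rewrite ap2_comul // ap_power; last exact: smooth_funM.
have -> : ap2 g h (tmap (power_map j) (power_map j) (comul X T)) =
    ap2 (g \o power j) (h \o power j) (comul X T).
  apply: (tens_lin_eq (f := fun t => ap2 g h (tmap (power_map j) (power_map j) t))).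
  - exact: linear_comp (tmap_linear (power_map_linear j) (power_map_linear j)) (ap2_linear g h).
  - exact: ap2_linear.
  - move=> a b; rewrite tmap_tmul; [|exact: power_map_linear|exact: power_map_linear].
    by rewrite !ap2_tmul !ap_power.
by rewrite ap2_comul //; exact: power_fun_smooth.
Qed.

(** The left-hand side is [T] applied to the restriction to the diagonal of
    [g (x |- power j y)]. *)
Lemma power_mapS j T :
  F_mul k e vd (tmap id (power_map j) (comul X T)) = power_map j.+1 T.
Proof.
have [svd _] := dimonoid_smooth; apply: E'_ext => g sg; rewrite ap_power //.
pose G : prod_manifold D D -> K^o := fun p => g (vd p.1 (power j p.2)).
have sG : smooth_fun G.
  have h := smooth_map_pair (@smooth_map_fst R n n D D)
    (smooth_map_comp (@smooth_map_snd R n n D D) (power_smooth j).1).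
  exact: (smooth_fun_pullback h (op_smooth svd sg)).
have -> : ap (F_mul k e vd (tmap id (power_map j) (comul X T))) g = ap (F2_tens (comul X T)) G.
  apply: (tens_lin_eq (f := fun t => ap (F_mul k e vd (tmap id (power_map j) t)) g : K^o)
    (g := fun t => ap (F2_tens t) G : K^o)).
  - apply: linear_comp (ap_linear g); apply: linear_comp (F_mul_linear svd).
    exact: (tmap_linear (@id_linear K A) (power_map_linear j)).
  - exact: linear_comp (@F2_tens_linear _ _ _ _ _) (ap_linear G).
  - move=> a b; rewrite tmap_tmul; [|exact: id_linear|exact: power_map_linear].
    rewrite (ap_mul svd _ _ sg) F2_tens_tmul (ap_F2 _ _ sG); congr (ap a _); apply/funext => x.
    by rewrite ap_power //; exact: (smooth_slice x (op_smooth svd sg)).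
by rewrite ap_comul.
Qed.

Lemma power_mapS_dv j T :
  F_mul k e dv (tmap (power_map j) id (comul X T)) = power_map j.+1 T.
Proof.
have [_ sdv] := dimonoid_smooth; apply: E'_ext => g sg; rewrite ap_power //.
pose G : prod_manifold D D -> K^o := fun p => g (dv (power j p.1) p.2).
have sG : smooth_fun G.
  have h := smooth_map_pair (smooth_map_comp (@smooth_map_fst R n n D D) (power_smooth j).1)
    (@smooth_map_snd R n n D D).
  exact: (smooth_fun_pullback h (op_smooth sdv sg)).
have -> : ap (F_mul k e dv (tmap (power_map j) id (comul X T))) g = ap (F2_tens (comul X T)) G.
  apply: (tens_lin_eq (f := fun t => ap (F_mul k e dv (tmap (power_map j) id t)) g : K^o)
    (g := fun t => ap (F2_tens t) G : K^o)).
  - apply: linear_comp (ap_linear g); apply: linear_comp (F_mul_linear sdv).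
    exact: (tmap_linear (power_map_linear j) (@id_linear K A)).
  - exact: linear_comp (@F2_tens_linear _ _ _ _ _) (ap_linear G).
  - move=> a b; rewrite tmap_tmul; [|exact: power_map_linear|exact: id_linear].
    rewrite (ap_mul sdv _ _ sg) F2_tens_tmul (ap_F2 _ _ sG) ap_power //.
    exact: (smooth_ap_slice b (op_smooth sdv sg)).
rewrite ap_comul //; congr (ap T _); apply/funext => x.
by rewrite /G /= power_dv.
Qed.

Lemma power_map0 T : power_map 0 T = counit X T *: dirac_at k e.
Proof.
apply: E'_ext => g sg; rewrite ap_power // ap_scale ap_dirac // counitE.
rewrite -ap_mulr; last exact: one_smooth.
by congr (ap T _); apply/funext => x; rewrite mul1r.
Qed.

(** In [splits s] the left part is empty exactly once. *)
Lemma splits_nil (V : nmodType) (I : Type) (s : seq I) (F : seq I * seq I -> V) :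
  \sum_(p <- splits s) F p = F ([::], s) + \sum_(p <- splits s | ~~ nilp p.1) F p.
Proof.
elim: s F => [|i s IH] F; first by rewrite !big_cons !big_nil.
rewrite /= !big_cat !big_map /= (IH (fun p => F (p.1, i :: p.2))) /=.
by rewrite addrCA; congr (_ + _); congr (_ + _).
Qed.

(** The terms of the sum have smaller order in their second factor, as the first
    factor takes at least one of the derivatives. *)
Lemma power_chart_dist c s j : atlas c -> chart_dom c e ->
  power_map j.+1 (chart_dist k e c s) = power_map j (chart_dist k e c s) +
  \sum_(p <- [seq p <- splits s | ~~ nilp p.1])
    F_mul k e vd (tmul (chart_dist k e c p.1) (power_map j (chart_dist k e c p.2))).
Proof.
move=> Ac ce; have [svd _] := dimonoid_smooth; have [_ _ [_ _ _ _ [e1 _]]] := hD.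
pose G g : prod_manifold D D -> K^o := fun p => g (vd p.1 (power j p.2)).
have sG g : smooth_fun g -> smooth_fun (G g).
  move=> sg; have h := smooth_map_pair (@smooth_map_fst R n n D D)
    (smooth_map_comp (@smooth_map_snd R n n D D) (power_smooth j).1).
  exact: (smooth_fun_pullback h (op_smooth svd sg)).
have E g S T : smooth_fun g -> ap (F_mul k e vd (tmul S (power_map j T))) g = ap (F2 S T) (G g).
  move=> sg; rewrite (ap_mul svd _ _ sg) (ap_F2 _ _ (sG g sg)); congr (ap S _); apply/funext => x.
  by rewrite ap_power //; exact: (smooth_slice x (op_smooth svd sg)).
(* The derivative of order 0 is the unit; its product with [power_map j T] is [power_map j T]. *)
have D0 : chart_dist k e c [::] = dirac_at k e.
  have [_ _ cK _ _] := atlas_is_chart Ac.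
  apply: E'_ext => g sg; rewrite ap_chart_dist // ap_dirac //.
  by apply: eqK; rewrite ?chart_partial_re ?chart_partial_im /= cK.
apply: E'_ext => g sg; rewrite ap_power //.
have -> : g \o power j.+1 = (fun x => G g (x, x)) by [].
rewrite (ap_diag _ Ac ce (sG g sg)) splits_nil apD; congr (_ + _).
  rewrite /= -(E _ _ _ sg) D0 (ap_mul svd _ _ sg) ap_dirac; last first.
    exact: (smooth_ap_slice _ (op_smooth svd sg)).
  by congr (ap _ _); apply/funext => y; rewrite e1.
rewrite -big_filter [RHS](linear_sum _ _ (ap_linear g)); apply: eq_bigr => p _.
by rewrite (E _ _ _ sg).
Qed.

Lemma power_map_poly T : exists v, polyval (fun j => power_map j T) v.
Proof.
have [c Ac ce] := atlas_cover e; have [svd _] := dimonoid_smooth.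
have poly_dist s : exists v, polyval (fun j => power_map j (chart_dist k e c s)) v.
  elim: {s}(size s).+1 {-2}s (ltnSn (size s)) => [//|N IH] s sN.
  have ex p : p \in [seq p <- splits s | ~~ nilp p.1] -> exists v,
      polyval (fun j => F_mul k e vd (tmul (chart_dist k e c p.1) (power_map j (chart_dist k e c p.2)))) v.
    rewrite mem_filter => /andP[p1 ps].
    have [|v hv] := IH p.2.
      rewrite ltnS in sN; apply: leq_trans sN; rewrite -(splits_size ps).
      by rewrite -[X in (X < _)%N]add0n ltn_add2r lt0n.
    exists (F_mul k e vd (tmul (chart_dist k e c p.1) v)).
    exact: (polyval_bilin (mul_bilin svd) (polyval_cst (chart_dist k e c p.1)) hv).
  have h p : exists v, p \in [seq p <- splits s | ~~ nilp p.1] ->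
      polyval (fun j => F_mul k e vd (tmul (chart_dist k e c p.1) (power_map j (chart_dist k e c p.2)))) v.
    have [/ex[v hv]|] := boolP (p \in [seq p <- splits s | ~~ nilp p.1]); first by exists v.
    by exists 0.
  have [f hf] := choice h.
  apply: (@polyval_antidifference _ _ _ (\sum_(p <- [seq p <- splits s | ~~ nilp p.1]) f p)).
  rewrite (_ : (fun _ => _) = fun j => \sum_(p <- [seq p <- splits s | ~~ nilp p.1])
    F_mul k e vd (tmul (chart_dist k e c p.1) (power_map j (chart_dist k e c p.2)))).
    by apply: polyval_sum => p; exact: hf.
  by apply/funext => j; rewrite power_chart_dist // addrC addKr.
have [cl ->] := E'_span T Ac ce; have [f hf] := choice poly_dist.
exists (\sum_(q <- cl) q.1 *: f q.2).
rewrite (_ : (fun _ => _) = fun j => \sum_(q <- cl) q.1 *: power_map j (chart_dist k e c q.2)).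
  apply: polyval_sum => q _; have := polyval_lin q.1 (hf q.2) (polyval_cst (0 : A)).
  by rewrite addr0; congr polyval; apply/funext => j; rewrite addr0.
apply/funext => j; rewrite (linear_sum _ _ (power_map_linear j)); apply: eq_bigr => q _.
by rewrite (linear_Z _ _ (power_map_linear j)).
Qed.

(** The value at [-1] of the polynomial function [j |-> (power j)_* T]. *)
Definition antipode (T : A) : A := xget 0 [set v | polyval (fun j => power_map j T) v].

Lemma antipodeP T : polyval (fun j => power_map j T) (antipode T).
Proof.
by rewrite /antipode; have := xgetPex 0 (power_map_poly T).
Qed.

Lemma polyval_E'_unique (u : nat -> A) v v' : polyval u v -> polyval u v' -> v = v'.
Proof.
apply: (@polyval_unique K A (Cinf k D) (fun f T => ap T (val f))).
  by move=> f; exact: ap_linear.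
exact: ap_separated.
Qed.

Lemma polyval_tens_unique (u : nat -> tens A A) v v' :
  polyval u v -> polyval u v' -> v = v'.
Proof.
apply: (@polyval_unique K (tens A A) (Cinf k D * Cinf k D)
  (fun f t => ap2 (val f.1) (val f.2) t)).
  by move=> f; exact: ap2_linear.
move=> t h; apply: ap2_separated => g l sg sl.
have := h (mkCinf g, mkCinf l); rewrite /= !mkCinfE // => ->.
by rewrite (linear_0 (ap2_linear g l)).
Qed.

Lemma antipode_linear : linear antipode.
Proof.
move=> a S T; apply: polyval_E'_unique (antipodeP _) _.
have := polyval_lin a (antipodeP S) (antipodeP T).
by congr polyval; apply/funext => j; rewrite power_map_linear.
Qed.

Lemma polyval_tmap (f : nat -> A -> A) (f' : nat -> A -> A) (g g' : A -> A) (t : tens A A) :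
  (forall j, linear (f j)) -> (forall j, linear (f' j)) -> linear g -> linear g' ->
  (forall T, polyval (f^~ T) (g T)) -> (forall T, polyval (f'^~ T) (g' T)) ->
  polyval (fun j => tmap (f j) (f' j) t) (tmap g g' t).
Proof.
move=> lf lf' lg lg' h h'; have [s ->] := tens_span t.
rewrite (linear_sum _ _ (tmap_linear lg lg')).
rewrite (_ : (fun _ => _) = fun j => \sum_(p <- s) tmul (f j p.1) (f' j p.2)).
  apply: polyval_sum => p _; rewrite tmap_tmul //.
  exact: (polyval_bilin (tmul_bilinear A A) (h p.1) (h' p.2)).
apply/funext => j; rewrite (linear_sum _ _ (tmap_linear (lf j) (lf' j))).
by apply: eq_bigr => p _; rewrite tmap_tmul.
Qed.

Lemma antipode_C3_morphism : C3_morphism X X antipode.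
Proof.
split; first exact: antipode_linear.
- move=> T; apply: polyval_tens_unique.
    exact: polyval_map (@comul_linear _ _ _ _ _) (antipodeP T).
  have -> : (fun j => comul X (power_map j T)) =
      (fun j => tmap (power_map j) (power_map j) (comul X T)).
    by apply/funext => j; exact: power_map_comul.
  by apply: polyval_tmap => // *; try exact: power_map_linear; try exact: antipode_linear;
     exact: antipodeP.
- move=> T; apply: (@polyval_unique K (K^o : lmodType K) unit (fun _ x => x) (fun=> counit X T : K^o)) => //.
  + by move=> x /(_ tt).
  + have := polyval_map (ap_linear (fun _ : D => 1)) (antipodeP T).
    congr polyval; apply/funext => j; rewrite ap_power //; exact: one_smooth.
  + exact: polyval_cst.
- apply: polyval_E'_unique (antipodeP _) _.
  rewrite (_ : (fun _ => _) = fun=> grouplike1 X); first exact: polyval_cst.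
  apply/funext => j; apply: E'_ext => g sg; rewrite ap_power // [grouplike1 _]/= !ap_dirac //.
    by rewrite /= (power_smooth j).2.
  exact: power_fun_smooth.
Qed.

(** Both convolutions of the identity with [power_map j] give [power_map j.+1],
    whose value at -1 is [power_map 0]. *)
Lemma antipode_inverse T :
  F_mul k e vd (tmap id antipode (comul X T)) = counit X T *: grouplike1 X /\
  F_mul k e dv (tmap antipode id (comul X T)) = counit X T *: grouplike1 X.
Proof.
have [svd sdv] := dimonoid_smooth.
rewrite -[_ *: _]/(counit X T *: dirac_at k e) -power_map0.
have hshift := polyval_shift (antipodeP T).
split; apply: polyval_E'_unique hshift.
- have -> : (fun j => power_map j.+1 T) =
      (fun j => F_mul k e vd (tmap id (power_map j) (comul X T))).
    by apply/funext => j; rewrite power_mapS.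
  apply: polyval_map (F_mul_linear svd) _.
  by apply: (polyval_tmap (f := fun=> id)) => // *; try exact: power_map_linear;
    try exact: antipode_linear; try exact: polyval_cst; exact: antipodeP.
- have -> : (fun j => power_map j.+1 T) =
      (fun j => F_mul k e dv (tmap (power_map j) id (comul X T))).
    by apply/funext => j; rewrite power_mapS_dv.
  apply: polyval_map (F_mul_linear sdv) _.
  by apply: (polyval_tmap (f' := fun=> id)) => // *; try exact: power_map_linear;
    try exact: antipode_linear; try exact: polyval_cst; exact: antipodeP.
Qed.

Lemma F_Hopf : cocommutative_Hopf_dialgebra X (F_mul k e vd) (F_mul k e dv).
Proof.
have [svd sdv] := dimonoid_smooth; split.
- by split; [exact: F_C3_coalgebra|exact: F_cocommutative].
- exact: F_barunital_dialgebra.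
- exact: F_balanced.
- by split; exact: F_mul_C3_morphism.
- exists antipode; [exact: antipode_C3_morphism|exact: antipode_inverse].
Qed.

End DistributionProduct.

(** If [y] is the common inverse of [x] then
    [x |- e = x |- (y -| x) = (x |- y) -| x = e -| x]. *)
Lemma Lie_digroup_balanced (R : realType) n (D : manifold R n) (e : D) vd dv :
  Lie_digroup e vd dv -> balanced e vd dv.
Proof.
move=> [[[_ _ [_ _ _ d3 _]] hr hl] heq] x.
have [y xy] := hr x; have [z zx] := hl x.
by rewrite -{1}zx -d3 -(heq x y z xy zx) xy.
Qed.

Theorem theorem3p5 (R : realType) (k : scalar_kind) (n : nat)
    (D : manifold R n) (e : D) (vd dv : D -> D -> D)
    (hD : barunital_Lie_dimonoid e vd dv) :
  (barunital_dialgebra (dirac_at k e) (F_mul k e vd) (F_mul k e dv) /\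
   (balanced e vd dv ->
    cocommutative_Hopf_dialgebra (F_coalg k e) (F_mul k e vd) (F_mul k e dv)))
  /\
  (Lie_digroup e vd dv ->
   cocommutative_Hopf_dialgebra (F_coalg k e) (F_mul k e vd) (F_mul k e dv)).
Proof.
split; first by split; [exact: F_barunital_dialgebra|exact: F_Hopf].
by move=> /Lie_digroup_balanced; exact: F_Hopf.
Qed.
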